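(* Let $d\geq 2$ be an integer. (i) There exist a positive constant $\alpha$ (depending on $d$) and an ffiid $3$-coloring of $\mathbb{Z}^d$ whose coding radius $R$ satisfies $$\mathbb{P}(R>r)<r^{-\alpha}\qquad\text{for all } r\geq 0,$$ where $0^{-\alpha}$ is interpreted as $+\infty$. (ii) Every ffiid $3$-coloring of $\mathbb{Z}^d$ has coding radius $R$ satisfying $\mathbb{E}(R^2)=\infty$.
   Context: Write $|\cdot|$ for the $1$-norm on $\mathbb{Z}^d$ and $B(r)=\{v\in\mathbb{Z}^d:|v|\leq r\}$. A $q$-coloring of $\mathbb{Z}^d$ is a random element $X=(X_v)_{v\in\mathbb{Z}^d}$ of $\{1,\dots,q\}^{\mathbb{Z}^d}$ such that almost surely $X_u\neq X_v$ whenever $|u-v|=1$. A process $X$ on $\mathbb{Z}^d$ is ffiid (a finitary factor of an iid process) if $X=F(Y)$ for some family $Y=(Y_v)_{v\in\mathbb{Z}^d}$ of iid random variables (with values in an arbitrary measurable space) and some measurable map $F$ that commutes with every translation of $\mathbb{Z}^d$, such that for almost every $y$ (with respect to the law of $Y$) there exists $r<\infty$ such that whenever $y'$ agrees with $y$ on $B(r)$ we have $F(y')_0=F(y)_0$. The minimum such non-negative integer $r$ is denoted $R(y)$, and $R=R(Y)$ is the coding radius of the factor. *)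

(* Defs.v *)
From HB Require Import structures.
From mathcomp Require Import all_boot all_order all_algebra.
From mathcomp Require Import all_classical all_reals all_analysis.

Set Implicit Arguments.
Unset Strict Implicit.
Unset Printing Implicit Defensive.

Import Order.TTheory GRing.Theory Num.Theory.

Local Open Scope classical_set_scope.
Local Open Scope ring_scope.

(* The colours 1, ..., q are represented by 0, ..., q - 1 in 'I_q, with the
   discrete sigma-algebra. Measurable types are nonempty, hence 'I_q.+1. *)
HB.instance Definition _ (q : nat) := isPointed.Build 'I_q.+1 ord0.
HB.instance Definition _ (q : nat) :=
  @isMeasurable.Build default_measure_display 'I_q.+1
    discrete_measurable discrete_measurable0
    discrete_measurableC discrete_measurableU.

Notation site d := 'rV[int]_d.

Definition norm1 (d : nat) (v : site d) : nat := (\sum_(i < d) `|v ord0 i|)%N.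

(* A ^ (Z^d) with its product sigma-algebra. *)
Definition cylinders (d : nat) (dA : measure_display) (A : measurableType dA) :
    set (set (site d -> A)) :=
  [set C | exists (v : site d) (B : set A),
     measurable B /\ C = [set y | B (y v)]].

Notation config d A := (g_sigma_algebraType (@cylinders d _ A)).

Definition translate (d : nat) (T : Type) (u : site d) (y : site d -> T) :
    site d -> T :=
  fun v => y (v + u).

Section Factor.
Context (d : nat) (dA dC : measure_display).
Context (A : measurableType dA) (C : measurableType dC).
Variable F : {mfun config d A >-> config d C}.

Definition equivariant : Prop :=
  forall (u : site d) (y : config d A), F (translate u y) = translate u (F y).

Definition determined_by (r : nat) (y : config d A) : Prop :=
  forall y' : config d A,
    (forall v : site d, (norm1 v <= r)%N -> y' v = y v) -> F y' 0 = F y 0.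

(* The value is +oo when no ball determines the colour of the origin. *)
Definition coding_radius (R : realType) (y : config d A) : \bar R :=
  ereal_inf [set (r%:R)%:E | r in [set r : nat | determined_by r y]].

End Factor.

Section Processes.
Context (R : realType) (dO : measure_display) (Omega : measurableType dO).
Variable P : probability Omega R.
Context (d : nat) (dA dC : measure_display).
Context (A : measurableType dA) (C : measurableType dC).

Definition identically_distributed (Y : {RV P >-> config d A}) : Prop :=
  forall (u v : site d) (B : set A), measurable B ->
    P [set w | B (Y w u)] = P [set w | B (Y w v)].

Definition independent (Y : {RV P >-> config d A}) : Prop :=
  forall (s : seq (site d)) (B : site d -> set A),
    uniq s -> (forall v, measurable (B v)) ->
    P [set w | forall v, v \in s -> B v (Y w v)] =
    (\prod_(v <- s) P [set w | B v (Y w v)])%E.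

Definition iid (Y : {RV P >-> config d A}) : Prop :=
  identically_distributed Y /\ independent Y.

Definition coloring (X : {RV P >-> config d C}) : Prop :=
  {ae P, forall w, forall u v : site d, norm1 (u - v) = 1%N -> X w u <> X w v}.

Definition ffiid_via (X : {RV P >-> config d C}) (Y : {RV P >-> config d A})
    (F : {mfun config d A >-> config d C}) : Prop :=
  [/\ iid Y,
      equivariant F,
      {ae distribution P Y, forall y, exists r : nat, determined_by F r y} &
      forall w, X w = F (Y w)].

(* The coding radius need not be measurable when A is an arbitrary measurable
   space, so P(coding radius > r) is the outer probability; it agrees with P
   on measurable events, and with the completion of P. *)
Definition radius_tail (Y : {RV P >-> config d A})
    (F : {mfun config d A >-> config d C}) (r : R) : \bar R :=
  mu_ext P [set w | (r%:E < coding_radius F R (Y w))%E].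

(* Without measurability, the integral is the supremum of the integrals of the
   simple functions below the integrand, so that being +oo is the strongest
   reading. *)
Definition radius_second_moment (Y : {RV P >-> config d A})
    (F : {mfun config d A >-> config d C}) : \bar R :=
  (\int[P]_w (coding_radius F R (Y w) ^+ 2))%E.

End Processes.

(* r ^ (-a), with 0 ^ (-a) = +oo; powR alone gives 0 `^ (- a) = 0 for a != 0. *)
Definition neg_power (R : realType) (r a : R) : \bar R :=
  if r == 0 then +oo%E else (r `^ (- a))%:E.

(* Main.v *)
Require Import Defs.
From HB Require Import structures.
From mathcomp Require Import all_boot all_order all_algebra.
From mathcomp Require Import all_classical all_reals all_analysis.
From mathcomp Require Import measurable_realfun.
From mathcomp Require Import ring lra zify.
Import Order.TTheory GRing.Theory Num.Theory.
Local Open Scope classical_set_scope.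
Local Open Scope ring_scope.
Set Implicit Arguments.
Unset Strict Implicit.
Unset Printing Implicit Defensive.

(** The two halves rest on independent arguments.

    Existence. At every site there is a bit of each level: a bit of level
    [k >= 1] marks a centre at scale [32 ^ k], a bit of level [0] marks a
    seed. A centre is valid if it has no rival of its level within
    [5 * 32 ^ k] and no chain of [k] distinct seeds starts close to it. A
    valid centre owns a domain: a box of radius [32 ^ k] together with the
    clusters of smaller boxes (around seeds and around valid centres of lower
    level) that meet it. A smaller box is then inside a domain or disjoint
    from it, and clusters are small because valid centres of one level are far
    apart ([conn_diam]). The smallest domain that contains a site colours it
    by the checkerboard with colours [0] and [1] centred at its centre. Two
    domains may have checkerboards of opposite phase; outside the smaller one
    there is then a collar of width two. Read as heights modulo 3, the
    checkerboards [{0,1}], [{1,2}], [{2,3}], [{3,4}] follow each other across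
    the collar, and the last is the first with the opposite phase, so that
    neighbours keep distinct colours ([color_proper]). The bits of levels up
    to [K] within distance [12 * 32 ^ K] reveal whether the origin is in a
    domain of level at most [K], and its colour ([color_loc]). The probability
    of a bit of level [k] is of the order of the inverse of the volume of the
    box of radius [5 * 32 ^ k], so each level covers the origin with
    probability bounded below, independently of the other levels, up to the
    seed chains, which have probability at most [2 ^- k]. The probability that
    the first levels fail is thus exponentially small in their number while
    the scale grows exponentially: a power law ([power_law_coloring]). The
    bound is required for all [r], hence [P(R > 1) < 1]; this is why a seed
    without adjacent seeds is given colour [2], which the bits within
    distance 1 reveal. The bits are blocks of binary digits
    of a uniform variable on the unit interval.

    Infinite second moment. Let [undetermined r] be the event that the colour
    of the origin is still random once the labels outside the ball of radius
    [r] are resampled. It is measurable and contained in [R >= r]. If its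
    probability is small then, by Fubini, some fixed labels outside the ball
    give a colouring rule of range [r] which errs with small probability
    ([good_outside]). A rule of range [r] that violates every edge with
    probability at most [e] satisfies [e * r ^ 2 >= 10 ^- 4]
    ([local_rule_error]). To see this, apply the rule to labels that are
    periodic in one direction with period [n] of order [r]; locally they look
    like the original ones. The colour increments, which are [1] or [-1]
    modulo 3, sum to zero around a properly coloured unit square, so their sum
    around the cylinder (the winding) agrees in two rows far apart
    ([winding_row]), unless one of the [O(r ^ 2)] edges between them is
    violated. These rows are independent and have the same law, so the winding
    is nearly a constant [w_n] ([winding_concentrated]): a multiple of 3, of
    the parity of [n], and at most [n] in absolute value. The insertion of one
    more column changes the winding by an amount that is a function of the
    labels near that column ([winding_insert_const]), hence [w_n] is affine in
    [n]; its slope is an odd multiple of 3, so [|w_n|] outgrows [n]. This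
    contradiction shows that [P(R >= r)] is at least of order [r ^- 2] for
    every [r], and all dyadic scales contribute equally to the second moment
    ([second_moment_dyadic]). *)

(** * Probabilities as real numbers *)

Section Pr.
Context (R : realType) (dO : measure_display) (O : measurableType dO).
Variable P : probability O R.

Definition prob (E : set O) : R := fine (P E).
Notation pr := prob.

Lemma prE (E : set O) : measurable E -> P E = (pr E)%:E.
Proof. by move=> mE; rewrite /prob fineK // fin_num_measure. Qed.

Lemma pr_ge0 (E : set O) : 0 <= pr E.
Proof. by rewrite /prob fine_ge0. Qed.

Lemma le_pr (E G : set O) : measurable E -> measurable G -> E `<=` G -> pr E <= pr G.
Proof.
by move=> mE mG EG; rewrite -lee_fin -!prE //; apply: le_measure; rewrite ?inE.
Qed.

Lemma prT : pr setT = 1.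
Proof. by rewrite /prob probability_setT. Qed.

Lemma pr0 : pr set0 = 0.
Proof. by rewrite /prob measure0. Qed.

Lemma pr_le1 (E : set O) : measurable E -> pr E <= 1.
Proof. by move=> mE; rewrite -prT; apply: le_pr. Qed.

Lemma prU (E G : set O) : measurable E -> measurable G -> E `&` G = set0 ->
  pr (E `|` G) = pr E + pr G.
Proof.
move=> mE mG EG; apply: EFin_inj; rewrite EFinD -!prE //; last exact: measurableU.
exact: measureU.
Qed.

Lemma prC (E : set O) : measurable E -> pr (~` E) = 1 - pr E.
Proof.
move=> mE; apply: EFin_inj; rewrite EFinB -!prE //; last exact: measurableC.
exact: probability_setC.
Qed.

Lemma prD (E G : set O) : measurable E -> measurable G ->
  pr (E `\` G) = pr E - pr (E `&` G).
Proof.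
move=> mE mG; have mEG : measurable (E `&` G) by exact: measurableI.
have := prU mEG (measurableD mE mG).
by rewrite setUIDK setDE setIACA setICr setI0 -setDE => /(_ erefl) ->; lra.
Qed.

Lemma prU_le (E G : set O) : measurable E -> measurable G ->
  pr (E `|` G) <= pr E + pr G.
Proof.
move=> mE mG; have -> : E `|` G = E `|` (G `\` E).
  by apply/seteqP; split => x /=; case: (pselect (E x)); tauto.
rewrite prU //; last 2 first.
- exact: measurableD.
- by rewrite setDE setICA setICr setI0.
by rewrite lerD2l; apply: le_pr => //; exact: measurableD.
Qed.

End Pr.

(** * Laws of random families *)

Section Product.
Context (R : realType) (dO : measure_display) (O : measurableType dO).
Variable P : probability O R.
Context (I : eqType) (dT : measure_display) (T : measurableType dT).
Notation pr := (prob P).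

(** The cylinders of a product over an arbitrary index type: lattice sites,
    pairs of a site and a level, or positions of binary digits. Over the
    lattice they are the generators of [config]. *)
Definition cyl : set (set (I -> T)) :=
  [set C | exists (v : I) (B : set T), measurable B /\ C = [set y | B (y v)]].

Definition coord_meas (Y : O -> I -> T) :=
  forall i B, measurable B -> measurable [set w | B (Y w i)].

Lemma measurable_all (Y : O -> I -> T) (s : seq I) (B : I -> set T) :
  coord_meas Y -> (forall i, measurable (B i)) ->
  measurable [set w | forall i, i \in s -> B i (Y w i)].
Proof.
move=> mY mB; have -> : [set w | forall i, i \in s -> B i (Y w i)] =
    \bigcap_(i in [set` s]) [set w | B i (Y w i)] by [].
by apply: fin_bigcap_measurable => // i _; exact: mY.
Qed.

Lemma measurable_pre (Y : O -> I -> T) (E : set (I -> T)) :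
  coord_meas Y -> <<s cyl >> E -> measurable [set w | E (Y w)].
Proof.
move=> mY; move: E; apply: smallest_sub.
  split.
  - by rewrite (_ : mkset _ = set0) //.
  - move=> A mA; rewrite [X in measurable X](_ : _ = ~` [set w | A (Y w)]); first exact: measurableC.
    by apply/seteqP; split => [w [_]|w] //.
  - move=> A mA; rewrite [X in measurable X](_ : _ = \bigcup_k [set w | A k (Y w)]) //.
    exact: bigcup_measurable.
by move=> _ [v [B [mB ->]]]; exact: mY.
Qed.

(** Finite intersections of cylinders are stable under intersection and the
    events on which the two finite measures agree form a Dynkin system. The
    events [H], [H'] and the factor [c] allow the lemma to be used for a law
    conditioned on an event, which is what independence asks for. *)
Lemma law_unique (Y Y' : O -> I -> T) (H H' : set O) (c : R) :
  0 <= c -> coord_meas Y -> coord_meas Y' -> measurable H -> measurable H' ->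
  (forall (s : seq I) (B : I -> set T), (forall i, measurable (B i)) ->
     pr ([set w | forall i, i \in s -> B i (Y w i)] `&` H) =
     c * pr ([set w | forall i, i \in s -> B i (Y' w i)] `&` H')) ->
  forall E, <<s cyl >> E ->
    pr ([set w | E (Y w)] `&` H) = c * pr ([set w | E (Y' w)] `&` H').
Proof.
move=> c0 mY mY' mH mH' hc E mE.
pose G : set (set (I -> T)) := [set C | exists (s : seq I) (B : I -> set T),
  (forall i, measurable (B i)) /\ C = [set y | forall i, i \in s -> B i (y i)]].
have GI : setI_closed G.
  move=> A1 A2 [s1 [B1 [m1 ->]]] [s2 [B2 [m2 ->]]].
  exists (s1 ++ s2); exists (fun i => [set t | (i \in s1 -> B1 i t) /\ (i \in s2 -> B2 i t)]); split.
    move=> i; case: (i \in s1); case: (i \in s2).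
    - rewrite (_ : mkset _ = B1 i `&` B2 i); first exact: measurableI.
      by apply/seteqP; split => t /= [h1 h2]; split => //; [apply: h1|apply: h2].
    - rewrite (_ : mkset _ = B1 i) //.
      by apply/seteqP; split => t /= h; [apply: h.1|].
    - rewrite (_ : mkset _ = B2 i) //.
      by apply/seteqP; split => t /= h; [apply: h.2|].
    - rewrite (_ : mkset _ = setT) //; by apply/seteqP; split.
  apply/seteqP; split => y /=.
    by move=> [h1 h2] i _; split; [exact: h1|exact: h2].
  by move=> h; split => i si; have [|h1 h2] := h i; rewrite ?mem_cat ?si ?orbT //; auto.
have GE : <<s cyl >> `<=` <<s G >>.
  apply: smallest_sub; first exact: smallest_sigma_algebra.
  move=> _ [v [B [mB ->]]]; apply: sub_gen_smallest.
  exists [:: v]; exists (fun=> B); split => //; apply/seteqP; split => y /=.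
    by move=> h i; rewrite inE => /eqP ->.
  by apply; rewrite inE.
pose Q : set (set (I -> T)) := [set E | <<s cyl >> E /\
    pr ([set w | E (Y w)] `&` H) = c * pr ([set w | E (Y' w)] `&` H')].
suff : <<s G >> `<=` Q by move=> /(_ E (GE _ mE)) [].
have QT : Q setT.
  split; first exact: (@measurableT _ (g_sigma_algebraType cyl)).
  have := hc [::] (fun=> setT) (fun=> measurableT).
  by congr (pr (_ `&` _) = _ * pr (_ `&` _)); apply/seteqP; split.
apply: lambda_system_subset => //; last first.
  move=> _ [s [B [mB ->]]]; split; last exact: hc.
  have -> : [set y | forall i, i \in s -> B i (y i)] =
      \bigcap_(i in [set` s]) [set y : I -> T | B i (y i)] by [].
  apply: (@fin_bigcap_measurable _ (g_sigma_algebraType cyl)) => // i _.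
  by apply: sub_gen_smallest; exists i; exists (B i).
apply/dynkin_lambda_system; split => //.
- move=> A [mA eA]; split; first exact: sigma_algebraC.
  have mA1 : measurable ([set w | A (Y w)]) by exact: measurable_pre.
  have mA2 : measurable ([set w | A (Y' w)]) by exact: measurable_pre.
  have -> : [set w | (~` A) (Y w)] `&` H = H `\` [set w | A (Y w)].
    by apply/seteqP; split => w [? ?]; split.
  have -> : [set w | (~` A) (Y' w)] `&` H' = H' `\` [set w | A (Y' w)].
    by apply/seteqP; split => w [? ?]; split.
  rewrite !prD // !(setIC H) !(setIC H') eA mulrBr; congr (_ - _).
  by have := QT.2; rewrite (_ : [set w | setT (Y w)] = setT) // !setTI.
- move=> F tF hF; split; first by apply: sigma_algebra_bigcup => i; have [] := hF i.
  have bigE (Z : O -> I -> T) (K : set O) : coord_meas Z -> measurable K ->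
      P ([set w | (\bigcup_k F k) (Z w)] `&` K) =
      (\sum_(0 <= k <oo) P ([set w | F k (Z w)] `&` K))%E.
    move=> mZ mK; have -> : [set w | (\bigcup_k F k) (Z w)] `&` K =
        \bigcup_k ([set w | F k (Z w)] `&` K) by rewrite setI_bigcupl.
    rewrite measure_bigcup //.
    - by apply: eq_eseriesl => k; rewrite in_setT.
    - move=> k _; apply: measurableI => //; apply: measurable_pre => //.
      by have [] := hF k.
    - apply/trivIsetP => i j _ _ ij; apply/seteqP; split => // w [[/= h1 _] [h2 _]].
      by have /trivIsetP/(_ i j Logic.I Logic.I ij)/seteqP[h _] := tF; exact: (h (Z w)).
  have mU (Z : O -> I -> T) (K : set O) : coord_meas Z -> measurable K ->
      measurable ([set w | (\bigcup_k F k) (Z w)] `&` K).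
    move=> mZ mK; apply: measurableI => //; apply: measurable_pre => //.
    by apply: sigma_algebra_bigcup => i; have [] := hF i.
  apply: EFin_inj; rewrite EFinM -!prE; [|exact: mU|exact: mU].
  rewrite !bigE // -nneseriesZl //.
  apply: eq_eseriesr => k _; have [mF eF] := hF k.
  rewrite !prE ?eF //; apply: measurableI => //; exact: measurable_pre.
Qed.

Definition indep (Y : O -> I -> T) := forall (s : seq I) (B : I -> set T),
  uniq s -> (forall i, measurable (B i)) ->
  pr [set w | forall i, i \in s -> B i (Y w i)] = \prod_(i <- s) pr [set w | B i (Y w i)].

(** One implication suffices: the roles of the configurations can be
    exchanged. *)
Definition depends_on (U : set I) (E : set (I -> T)) :=
  forall y y', (forall i, U i -> y i = y' i) -> E y -> E y'.

(** Replaces the coordinates outside [U] by a constant: the law of an event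
    that depends on [U] becomes the law of a family that ignores the other
    coordinates, and its cylinders are again cylinders. *)
Definition mask (U : set I) (y : I -> T) : I -> T :=
  fun i => if `[< U i >] then y i else point.

Lemma maskE U y i : U i -> mask U y i = y i.
Proof. by move=> Ui; rewrite /mask asboolT. Qed.

Lemma depends_on_mask U E y : depends_on U E -> E (mask U y) <-> E y.
Proof.
by move=> hE; split; apply: hE => i Ui; rewrite maskE.
Qed.

Lemma mask_meas U Y : coord_meas Y -> coord_meas (fun w => mask U (Y w)).
Proof.
move=> mY i B mB; rewrite /mask; case: asboolP => _; first exact: mY.
case: (pselect (B point)) => h.
  by rewrite (_ : mkset _ = setT) //; apply/seteqP; split.
by rewrite (_ : mkset _ = set0) //; apply/seteqP; split.
Qed.

Lemma mask_cyl U Y (s : seq I) (B : I -> set T) :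
  [set w | forall i, i \in s -> B i (mask U (Y w) i)] =
  (if `[< forall i, i \in s -> ~ U i -> B i point >] then
     [set w : O | forall i, i \in [seq i <- s | `[< U i >]] -> B i (Y w i)] else set0).
Proof.
apply/seteqP; split => [w /= h|w].
  rewrite asboolT.
    move=> i /=; rewrite mem_filter => /andP[/asboolP Ui si].
    by have := h i si; rewrite maskE.
  by move=> i si Ui; have := h i si; rewrite /mask asboolF.
case: asboolP => // h0 /= h i si; rewrite /mask.
case: asboolP => Ui; last exact: h0.
by apply: h; rewrite mem_filter si andbT; apply/asboolP.
Qed.

Lemma indep_undup Y (s : seq I) (B : I -> set T) :
  indep Y -> (forall i, measurable (B i)) ->
  pr [set w | forall i, i \in s -> B i (Y w i)] =
  \prod_(i <- undup s) pr [set w | B i (Y w i)].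
Proof.
move=> iY mB; rewrite -iY ?undup_uniq //; congr (fine (P _)).
by apply/seteqP; split => w /= h i si; apply: h; rewrite ?mem_undup // -mem_undup.
Qed.

(** Two applications of [law_unique], one for each event, reduce the product
    formula to cylinders, where it is the independence of the coordinates. *)
Lemma indep2 Y (U V : set I) (E G : set (I -> T)) :
  coord_meas Y -> indep Y -> U `&` V = set0 -> depends_on U E -> depends_on V G ->
  <<s cyl >> E -> <<s cyl >> G ->
  pr ([set w | E (Y w)] `&` [set w | G (Y w)]) =
  pr [set w | E (Y w)] * pr [set w | G (Y w)].
Proof.
move=> mY iY UV dE dG mE mG.
have eE W D : depends_on W D -> [set w | D (Y w)] = [set w | D (mask W (Y w))].
  by move=> hD; apply/seteqP; split => w /= /(depends_on_mask _ hD).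
rewrite (eE _ _ dE) (eE _ _ dG).
have mU := mask_meas U mY; have mV := mask_meas V mY.
have mE' : measurable [set w | E (mask U (Y w))] by exact: measurable_pre.
have mall := @measurable_all.
rewrite setIC mulrC [RHS]mulrC -[[set w | G _] in RHS]setIT.
apply: law_unique => // [|s' B' mB']; first exact: pr_ge0.
rewrite setIT setIC mulrC -[[set w | E _] in RHS]setIT.
rewrite [LHS](_ : _ = pr [set w | forall i, i \in s' -> B' i (mask V (Y w) i)] * pr ([set w | E (mask U (Y w))] `&` setT)); first by rewrite mulrC.
apply: law_unique => //; [exact: pr_ge0 | exact: mall | move=> s B mB].
rewrite setIT !mask_cyl; case: asboolP => h1; case: asboolP => h2;
  rewrite ?set0I ?setI0 ?pr0 ?mulr0 ?mul0r //.
set s1 := [seq i <- s | _]; set s2 := [seq i <- s' | _].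
(* The blocks are disjoint, so one family of sets prescribes both
   cylinders. *)
pose B2 i := if `[< U i >] then B i else B' i.
have mB2 i : measurable (B2 i) by rewrite /B2; case: ifP.
have e1 : [set w | forall i, i \in s1 -> B i (Y w i)] = [set w | forall i, i \in s1 -> B2 i (Y w i)].
  apply/seteqP; split => w /= h i si; have := h i si; have := si;
  by rewrite mem_filter /B2 => /andP[-> _].
have e2 : [set w | forall i, i \in s2 -> B' i (Y w i)] = [set w | forall i, i \in s2 -> B2 i (Y w i)].
  have hV i : i \in s2 -> `[< U i >] = false.
    rewrite mem_filter => /andP[/asboolP Vi _]; apply/asboolP => Ui.
    by have /seteqP[h _] := UV; exact: (h i).
  by apply/seteqP; split => w /= h i si; have := h i si; rewrite /B2 hV.
rewrite e1 e2 [LHS](_ : _ = pr [set w | forall i, i \in s1 ++ s2 -> B2 i (Y w i)]); last first.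
  congr (fine (P _)); apply/seteqP; split => w /=.
    by move=> [ha hb] i; rewrite mem_cat => /orP[/ha|/hb].
  by move=> h; split => i si; apply: h; rewrite mem_cat si ?orbT.
rewrite !indep_undup // mulrC -big_cat /=; apply: perm_big.
apply: uniq_perm; rewrite ?undup_uniq //; last by move=> i; rewrite mem_undup !mem_cat !mem_undup.
rewrite cat_uniq !undup_uniq andbT /=; apply/hasPn => i; rewrite mem_undup mem_filter => /andP[/asboolP Vi _].
rewrite mem_undup mem_filter; apply/negP => /andP[/asboolP Ui _].
by have /seteqP[h _] := UV; exact: (h i).
Qed.

Lemma indep_blocks (J : eqType) Y (U : J -> set I) (E : J -> set (I -> T)) (s : seq J) :
  coord_meas Y -> indep Y -> uniq s ->
  (forall i j, i != j -> U i `&` U j = set0) ->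
  (forall j, depends_on (U j) (E j)) -> (forall j, <<s cyl >> (E j)) ->
  pr [set w | forall j, j \in s -> E j (Y w)] = \prod_(j <- s) pr [set w | E j (Y w)].
Proof.
move=> mY iY us dU dE mE; elim: s us => [_|j s IH /= /andP[js us]].
  by rewrite big_nil (_ : mkset _ = setT) ?prT //; apply/seteqP; split.
rewrite big_cons -IH //.
pose V := \bigcup_(i in [set` s]) U i.
pose G := \bigcap_(i in [set` s]) E i.
rewrite [LHS](_ : _ = pr ([set w | E j (Y w)] `&` [set w | G (Y w)])).
  apply: (indep2 (U := U j) (V := V)) => //.
  - apply/seteqP; split => // i [Uji [k /= ks Uki]].
    have jk : j != k by apply: contraNneq js => ->.
    by have /seteqP[h _] := dU _ _ jk; exact: (h i).
  - move=> y y' yy' h k ks; apply: (dE k y) => [i Uki|]; last exact: h.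
    by apply: yy'; exists k.
  - by apply: (@fin_bigcap_measurable _ (g_sigma_algebraType cyl)) => // i _; exact: mE.
congr (fine (P _)); apply/seteqP; split => w /=.
  by move=> h; split => [|k ks]; apply: h; rewrite inE ?eqxx ?ks ?orbT.
by move=> [h1 h2] k; rewrite inE => /orP[/eqP->//|]; exact: h2.
Qed.

(** An independent family of identically distributed labels keeps its law when
    it is read through a map that is injective on the coordinates that matter;
    elsewhere the map may repeat labels, which is how the lattice is wrapped
    around a cylinder. *)
Lemma law_relabel Y (W : set I) (f : I -> I) (E : set (I -> T)) :
  coord_meas Y -> indep Y ->
  (forall i j, W i -> W j -> f i = f j -> i = j) ->
  (forall i B, W i -> measurable B -> pr [set w | B (Y w (f i))] = pr [set w | B (Y w i)]) ->
  depends_on W E -> <<s cyl >> E ->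
  pr [set w | E (fun i => Y w (f i))] = pr [set w | E (Y w)].
Proof.
move=> mY iY fI id dE mE.
pose Z w i := Y w (f i).
have mZ : coord_meas Z by move=> i B mB; exact: mY.
have eE D X : depends_on W D -> [set w | D (X w)] = [set w : O | D (mask W (X w))].
  by move=> hD; apply/seteqP; split => w /= /(depends_on_mask _ hD).
rewrite (eE _ Z dE) (eE _ Y dE).
rewrite -[X in pr X = _]setIT -[X in _ = pr X]setIT -[RHS]mul1r.
apply: law_unique => //; [exact: mask_meas|exact: mask_meas|move=> s B mB].
rewrite mul1r !setIT !mask_cyl; case: asboolP => // _.
set s1 := [seq i <- s | _].
rewrite [RHS]indep_undup //.
have s1W i : i \in s1 -> W i by rewrite mem_filter => /andP[/asboolP].
pose B' j : set T := [set t | forall i, i \in s1 -> f i = j -> B i t].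
have mB' j : measurable (B' j).
  rewrite (_ : B' j = \bigcap_(i in [set` s1] `&` [set i | f i = j]) B i).
    by apply: fin_bigcap_measurable => //; exact: finite_setIl.
  by apply/seteqP; split => t /= h i => [[]|] *; apply: h.
have B'E i : i \in s1 -> B' (f i) = B i.
  move=> si; apply/seteqP; split => t /=; first exact.
  move=> Bt k sk /fI e; rewrite (e (s1W _ sk) (s1W _ si)) //.
rewrite [LHS](_ : _ = pr [set w | forall j, j \in map f (undup s1) -> B' j (Y w j)]); last first.
  congr (fine (P _)); apply/seteqP; split => w /=.
    by move=> h j /mapP[i]; rewrite mem_undup => si ->; rewrite B'E //; exact: h.
  move=> h i si; rewrite -(B'E i si); apply: h; apply/mapP; exists i => //.
  by rewrite mem_undup.
rewrite iY // ?big_map.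
  rewrite big_seq [RHS]big_seq; apply: eq_bigr => i; rewrite mem_undup => si.
  by rewrite B'E // id //; exact: s1W.
rewrite map_inj_in_uniq ?undup_uniq // => i j; rewrite !mem_undup => /s1W ? /s1W ?; exact: fI.
Qed.
End Product.

(** * Height increments of a 3-colouring *)

(** The representative in [{-1, 0, 1}] of [b - a] modulo 3. It is [1] or [-1]
    between adjacent sites of a proper colouring. *)
Definition step (a b : 'I_3) : int :=
  if a == b then 0 else if (b == (a + 1)%N %% 3 :> nat)%N then 1 else -1.

Lemma step_le1 a b : `|step a b| <= 1.
Proof. by rewrite /step; case: ifP => // _; case: ifP. Qed.

Lemma step_neq a b : a != b -> step a b = 1 \/ step a b = -1.
Proof. by rewrite /step => /negbTE ->; case: ifP => _; [left|right]. Qed.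

Lemma step_mod3 a b : exists k : int, step a b = (val b)%:Z - (val a)%:Z + k * 3.
Proof.
case: a b => [[|[|[|//]]] ?] [[|[|[|//]]] ?]; rewrite /step /=;
  by [exists 0|exists 1|exists (-1)].
Qed.

(** A colouring of a 4-cycle with three colours has no winding: the sum of
    four numbers [1] or [-1] is even, at most 4 in absolute value, and
    divisible by 3 around a cycle, hence zero. *)
Lemma step_square a b c e : a != b -> b != e -> c != e -> a != c ->
  step a b + step b e = step a c + step c e.
Proof.
by case: a b c e => [[|[|[|//]]] ?] [[|[|[|//]]] ?] [[|[|[|//]]] ?] [[|[|[|//]]] ?].
Qed.

Lemma sum_step_mod3 (c : nat -> 'I_3) n : exists k : int,
  \sum_(0 <= i < n) step (c i) (c i.+1) = (val (c n))%:Z - (val (c 0%N))%:Z + k * 3.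
Proof.
elim: n => [|n [k IH]]; first by exists 0; rewrite big_geq //; lia.
have [l hl] := step_mod3 (c n) (c n.+1).
by exists (k + l); rewrite big_nat_recr //= IH hl; ring.
Qed.

Lemma sum_step_odd (c : nat -> 'I_3) n : (forall i, (i < n)%N -> c i != c i.+1) ->
  exists k : int, \sum_(0 <= i < n) step (c i) (c i.+1) = n%:Z + k * 2.
Proof.
elim: n => [|n IH] h; first by exists 0; rewrite big_geq.
have [i hi|k hk] := IH; first by apply: h; lia.
rewrite big_nat_recr //= hk; have [->|->] := step_neq (h n (ltnSn n)).
  by exists k; lia.
by exists (k - 1); lia.
Qed.

Lemma sum_step_le (c : nat -> 'I_3) n :
  `|\sum_(0 <= i < n) step (c i) (c i.+1)| <= n%:Z.
Proof.
elim: n => [|n IH]; first by rewrite big_geq.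
rewrite big_nat_recr //= -[n.+1]addn1 PoszD; apply: le_trans (ler_normD _ _) _.
by rewrite lerD // step_le1.
Qed.

(** * Winding of a local rule on a cylinder *)

Definition wrap_mod (n : nat) (x : int) : int := (x %% n%:Z)%Z.
(** Omits the coordinate [h]. A cylinder of circumference [n] with a skipped
    coordinate and one of circumference [n + 1] differ by the insertion of one
    column. *)
Definition skip (h x : int) : int := if x < h then x else x + 1.
Definition wrap_skip h n x := skip h (wrap_mod n x).

Lemma wrap_mod_small n (x : int) : 0 <= x < n%:Z -> wrap_mod n x = x.
Proof. by move=> ?; rewrite /wrap_mod modz_small. Qed.

Lemma wrap_mod_neg n (x : int) : - n%:Z <= x < 0 -> wrap_mod n x = x + n%:Z.
Proof. by move=> hx; rewrite /wrap_mod -modzDr modz_small //; clear -hx; lia. Qed.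

Lemma wrap_mod_ge n (x : int) : n%:Z <= x < n%:Z * 2 -> wrap_mod n x = x - n%:Z.
Proof. by move=> hx; rewrite /wrap_mod -(subrK n%:Z x) modzDr modz_small //; clear -hx; lia. Qed.

Lemma wrap_mod_per n x : wrap_mod n (x + n%:Z) = wrap_mod n x.
Proof. by rewrite /wrap_mod modzDr. Qed.

Lemma wrap_mod_inj n (x x' : int) : `|x - x'| < n%:Z -> wrap_mod n x = wrap_mod n x' -> x = x'.
Proof.
move=> h /eqP; rewrite /wrap_mod eqz_mod_dvd => /dvdzP[q hq].
have : q = 0 by nia.
by move=> q0; move: hq; rewrite q0; lia.
Qed.

Lemma skip_lt (h x : int) : x < h -> skip h x = x.
Proof. by rewrite /skip => ->. Qed.

Lemma skip_ge (h x : int) : h <= x -> skip h x = x + 1.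
Proof. by rewrite /skip leNgt => /negbTE ->. Qed.

Lemma skip_inj h : injective (skip h).
Proof. by move=> x y; rewrite /skip; case: ifP; case: ifP; lia. Qed.

Lemma norm1_coord d (v : site d) k : (`|v ord0 k| <= norm1 v)%N.
Proof. by rewrite /norm1 (bigD1 k) //= leq_addr. Qed.

Section Cycle.
Context (d : nat) (i0 i1 : 'I_d).
Context (A : Type) (f : (site d -> A) -> 'I_3).

Definition plane (i j : int) : site d :=
  \row_k (if k == i0 then i else if k == i1 then j else 0).

(** With [k] the reduction modulo [n], the labels become periodic along the
    first axis. *)
Definition reindex_axis (k : int -> int) (v : site d) : site d :=
  \row_l (if l == i0 then k (v ord0 i0) else v ord0 l).

Definition cell k (i j : int) (y : site d -> A) : 'I_3 := f (fun v => y (reindex_axis k (v + plane i j))).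

Definition winding k n (j : int) y : int :=
  \sum_(0 <= i < n) step (cell k i%:Z j y) (cell k i.+1%:Z j y).

Lemma cell_per n j y : cell (wrap_mod n) n%:Z j y = cell (wrap_mod n) 0 j y.
Proof.
congr f; apply/funext => v; congr y; apply/rowP => l; rewrite !mxE eqxx.
by case: eqP => // _; rewrite addr0 wrap_mod_per.
Qed.

(** The increments around each unit square cancel, so the difference of the
    windings of two consecutive rows telescopes around the cylinder. *)
Lemma winding_row n m y :
  (forall i j : nat, (i < n)%N -> (j <= m)%N ->
     cell (wrap_mod n) i%:Z j%:Z y != cell (wrap_mod n) i.+1%:Z j%:Z y) ->
  (forall i j : nat, (i < n)%N -> (j < m)%N ->
     cell (wrap_mod n) i%:Z j%:Z y != cell (wrap_mod n) i%:Z j.+1%:Z y) ->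
  winding (wrap_mod n) n 0 y = winding (wrap_mod n) n m%:Z y.
Proof.
move=> hh hv; have [n0|n0] := posnP n; first by rewrite /winding n0 !big_geq.
elim: m hh hv => [//|m IH] hh hv.
rewrite IH; [|by move=> i j ? ?; apply: hh => //; lia|by move=> i j ? ?; apply: hv => //; lia].
have hv' i : (i <= n)%N -> cell (wrap_mod n) i%:Z m%:Z y != cell (wrap_mod n) i%:Z m.+1%:Z y.
  by rewrite leq_eqVlt => /orP[/eqP ->|hi]; rewrite ?cell_per; apply: hv.
have e i : (i < n)%N ->
    step (cell (wrap_mod n) i%:Z m%:Z y) (cell (wrap_mod n) i.+1%:Z m%:Z y) =
    step (cell (wrap_mod n) i%:Z m.+1%:Z y) (cell (wrap_mod n) i.+1%:Z m.+1%:Z y) -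
    (step (cell (wrap_mod n) i.+1%:Z m%:Z y) (cell (wrap_mod n) i.+1%:Z m.+1%:Z y) -
     step (cell (wrap_mod n) i%:Z m%:Z y) (cell (wrap_mod n) i%:Z m.+1%:Z y)).
  move=> hi; have := step_square (hh i m hi (leqnSn m)) (hv' i.+1 hi) (hh i m.+1 hi (leqnn _)) (hv' i (ltnW hi)).
  by lia.
rewrite /winding big_nat (eq_bigr _ (fun i hi => e i (andP hi).2)) -big_nat sumrB.
by rewrite (telescope_sumr (fun i => step (cell (wrap_mod n) i%:Z m%:Z y) (cell (wrap_mod n) i%:Z m.+1%:Z y))) // !cell_per subrr subr0.
Qed.

Variable r : nat.
Hypothesis f_dep : forall y y', (forall v, (norm1 v <= r)%N -> y v = y' v) -> f y = f y'.

Lemma cell_ext (k k' : int -> int) (s i j : int) y : (forall x : int, `|x - i| <= r%:Z -> k x = k' (x + s)) ->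
  cell k i j y = cell k' (i + s) j y.
Proof.
move=> h; apply: f_dep => v hv; congr y.
apply/rowP => l; rewrite !mxE eqxx; case: eqP => // _.
have := norm1_coord v i0; set a := v ord0 i0 => ha.
by rewrite h; [congr k'; ring|lia].
Qed.

(* The column [h] is inserted. Up to column [r] the rule sees columns below
   [h] and, across the seam, the last ones; from column [q] on it sees columns
   above [h] and, across the seam, the first ones. *)
Let h := (2 * r + 1)%N.
Let q := (3 * r + 2)%N.

(** Outside a window around the inserted column, the two cylinders show the
    same labels up to a shift by one column, so that only the increments
    inside the window can differ. *)
Lemma winding_insert_local N y : (4 * r + 3 <= N)%N ->
  winding (wrap_mod N.+1) N.+1 0 y - winding (wrap_skip h%:Z N) N 0 y =
  \sum_(r <= i < q) step (cell (wrap_mod N.+1) i%:Z 0 y) (cell (wrap_mod N.+1) i.+1%:Z 0 y) -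
  \sum_(r <= i < q.-1) step (cell (wrap_skip h%:Z N) i%:Z 0 y) (cell (wrap_skip h%:Z N) i.+1%:Z 0 y).
Proof.
move=> hN; rewrite /winding.
(* Both sums are cut into the part before the window, the window, and the part
   after it. *)
rewrite (@big_cat_nat _ _ _ r 0 N.+1) //=; last by lia.
rewrite (@big_cat_nat _ _ _ q r N.+1) //=; [|rewrite /q; lia|rewrite /q; lia].
rewrite [X in _ - X](@big_cat_nat _ _ _ r 0 N) //=; last by lia.
rewrite [X in _ - (_ + X)](@big_cat_nat _ _ _ q.-1 r N) //=; [|rewrite /q; lia|rewrite /q; lia].
set a1 := \sum_(0 <= i < r) _; set a2 := \sum_(r <= i < q) _; set a3 := \sum_(q <= i < N.+1) _.
set b1 := \sum_(0 <= i < r) _; set b2 := \sum_(r <= i < q.-1) _; set b3 := \sum_(q.-1 <= i < N) _.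
have e1 : a1 = b1.
  rewrite /a1 /b1 !big_nat; apply: eq_bigr => i /andP[_ hi].
  have eC (k : nat) : (k <= r)%N -> cell (wrap_mod N.+1) k%:Z 0 y = cell (wrap_skip h%:Z N) k%:Z 0 y.
    move=> hk; rewrite -[in RHS](addr0 k%:Z); apply: cell_ext => x hx.
    rewrite addr0 /wrap_skip; have [x0|x0] := ltP x 0.
      by rewrite wrap_mod_neg ?(@wrap_mod_neg N) ?skip_ge /h; lia.
    by rewrite wrap_mod_small ?(@wrap_mod_small N) ?skip_lt /h; lia.
  by rewrite !eC //; lia.
have e3 : a3 = b3.
  have q1 : q = q.-1.+1 by rewrite /q; lia.
  rewrite /a3 /b3 [X in \sum_(X <= _ < _) _]q1 big_add1 /=.
  rewrite !big_nat; apply: eq_bigr => i /andP[hi1 hi2].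
  have eC (k : nat) : (q.-1 <= k <= N)%N -> cell (wrap_skip h%:Z N) k%:Z 0 y = cell (wrap_mod N.+1) k.+1%:Z 0 y.
    move=> hk; rewrite (_ : k.+1%:Z = k%:Z + 1); last by lia.
    rewrite /q in hk; apply: cell_ext => x hx; rewrite /wrap_skip; have [x0|x0] := ltP x N%:Z.
      by rewrite wrap_mod_small ?(@wrap_mod_small N.+1) ?skip_ge /h; lia.
    by rewrite wrap_mod_ge ?(@wrap_mod_ge N.+1) ?skip_lt /h; lia.
  by rewrite !eC //; lia.
by move: e1 e3; clearbody a1 a2 a3 b1 b2 b3 => -> ->; ring.
Qed.

(** The window of [winding_insert_local] does not see the circumference, so
    the effect of an inserted column is the same for all circumferences. *)
Lemma winding_insert_const n y : (4 * r + 3 <= n)%N ->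
  winding (wrap_mod n.+2) n.+2 0 y - winding (wrap_skip h%:Z n.+1) n.+1 0 y =
  winding (wrap_mod n.+1) n.+1 0 y - winding (wrap_skip h%:Z n) n 0 y.
Proof.
move=> hn; rewrite !winding_insert_local //; last by lia.
congr (_ - _); rewrite !big_nat; apply: eq_bigr => i /andP[hi1 hi2].
  have eC (k : nat) : (r <= k <= q)%N -> cell (wrap_mod n.+2) k%:Z 0 y = cell (wrap_mod n.+1) k%:Z 0 y.
    move=> hk; rewrite -[in RHS](addr0 k%:Z); apply: cell_ext => x hx.
    by rewrite addr0 !wrap_mod_small //; rewrite /q in hk; lia.
  by rewrite !eC //; lia.
have eC (k : nat) : (r <= k <= q.-1)%N -> cell (wrap_skip h%:Z n.+1) k%:Z 0 y = cell (wrap_skip h%:Z n) k%:Z 0 y.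
  move=> hk; rewrite -[in RHS](addr0 k%:Z); apply: cell_ext => x hx.
  by rewrite addr0 /wrap_skip !wrap_mod_small //; rewrite /q in hk; lia.
by rewrite !eC //; lia.
Qed.

End Cycle.

(** * Measurable functions with discrete values *)

Section DiscreteMeasurable.
Context (T : pointedType) (G : set (set T)).

Definition disc_meas (K : Type) (g : T -> K) := forall B : set K, <<s G >> (g @^-1` B).

Lemma disc_meas1 (K : countType) (g : T -> K) :
  (forall k, <<s G >> [set y | g y = k]) -> disc_meas g.
Proof.
move=> h B.
rewrite (_ : g @^-1` B = \bigcup_(n : nat)
   (if unpickle n is Some k then if `[< B k >] then [set y | g y = k] else set0 else set0)).
  apply: (@bigcupT_measurable _ (g_sigma_algebraType G)) => n.
  case: unpickle => [k|]; last exact: (@measurable0 _ (g_sigma_algebraType G)).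
  by case: ifP => _; [exact: h|exact: (@measurable0 _ (g_sigma_algebraType G))].
apply/seteqP; split => y /=.
  by move=> By; exists (pickle (g y)) => //; rewrite pickleK asboolT.
by move=> [n _]; case: unpickle => //= k; case: asboolP => // Bk /= ->.
Qed.

Lemma disc_meas_comp (K L : Type) (g : T -> K) (h : K -> L) :
  disc_meas g -> disc_meas (fun y => h (g y)).
Proof. by move=> hg B; exact: (hg (h @^-1` B)). Qed.

Lemma disc_meas_pair (K L : countType) (g : T -> K) (h : T -> L) :
  disc_meas g -> disc_meas h -> disc_meas (fun y => (g y, h y)).
Proof.
move=> hg hh; apply: disc_meas1 => -[k l].
rewrite (_ : mkset _ = g @^-1` [set k] `&` h @^-1` [set l]).
  by apply: (@measurableI _ (g_sigma_algebraType G)); [exact: hg|exact: hh].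
by apply/seteqP; split => y /= => [[-> ->]|[-> ->]].
Qed.

Lemma disc_meas2 (K L : countType) M (g : T -> K) (h : T -> L) (b : K -> L -> M) :
  disc_meas g -> disc_meas h -> disc_meas (fun y => b (g y) (h y)).
Proof.
move=> hg hh; exact: (disc_meas_comp (fun p => b p.1 p.2) (disc_meas_pair hg hh)).
Qed.

Lemma disc_meas_cst (K : Type) (k : K) : disc_meas (fun=> k).
Proof.
move=> B; case: (pselect (B k)) => h.
  rewrite (_ : _ @^-1` _ = setT); first exact: (@measurableT _ (g_sigma_algebraType G)).
  by apply/seteqP; split.
rewrite (_ : _ @^-1` _ = set0); first exact: (@measurable0 _ (g_sigma_algebraType G)).
by apply/seteqP; split.
Qed.

Lemma disc_meas_sum (g : nat -> T -> int) n : (forall i, disc_meas (g i)) ->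
  disc_meas (fun y => \sum_(0 <= i < n) g i y).
Proof.
move=> hg; elim: n => [|n IH].
  rewrite (_ : (fun _ => _) = fun=> 0); first exact: disc_meas_cst.
  by apply/funext => y; rewrite big_geq.
rewrite (_ : (fun _ => _) = fun y => \sum_(0 <= i < n) g i y + g n y).
  exact: (disc_meas2 +%R IH (hg n)).
by apply/funext => y; rewrite big_nat_recr.
Qed.
End DiscreteMeasurable.

Lemma cyl_relabel (I : eqType) dT (T : measurableType dT) (t : I -> I) (E : set (I -> T)) :
  <<s @cyl I dT T >> E -> <<s @cyl I dT T >> [set y | E (fun i => y (t i))].
Proof.
move=> mE.
apply: (@measurable_pre _ (g_sigma_algebraType (@cyl I dT T)) I dT T (fun (y : I -> T) i => y (t i))) => //.
by move=> i B mB; apply: sub_gen_smallest; exists (t i); exists B.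
Qed.

(** * Nearly constant variables and union bounds *)

Section FinitePartition.
Context (R : realType) (dO : measure_display) (O : measurableType dO).
Variable P : probability O R.
Notation pr := (prob P).

Lemma pr_partition (X : O -> nat) (H : set O) N :
  (forall a, measurable [set w | X w = a]) -> measurable H ->
  pr ([set w | (X w < N)%N] `&` H) = \sum_(a < N) pr ([set w | X w = a] `&` H).
Proof.
move=> mX mH; have mlt n : measurable [set w | (X w < n)%N].
  elim: n => [|n IH].
    by rewrite (_ : mkset _ = set0) //; apply/seteqP; split => w.
  rewrite (_ : mkset _ = [set w | (X w < n)%N] `|` [set w | X w = n]).
    exact: measurableU.
  apply/seteqP; split => w /=; first by rewrite ltnS leq_eqVlt => /orP[/eqP|]; auto.
  by move=> [h|->//]; rewrite ltnS ltnW.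
elim: N => [|N IH].
  by rewrite big_ord0 (_ : _ `&` _ = set0) ?pr0 //; apply/seteqP; split => w [].
rewrite big_ord_recr /= -IH -prU; last 3 first.
- exact: measurableI.
- exact: measurableI.
- by apply/seteqP; split => // w [[/= h1 _] [/= h2 _]]; rewrite h2 ltnn in h1.
congr (fine (P _)); apply/seteqP; split => w /=.
  by rewrite ltnS leq_eqVlt => -[/orP[/eqP|]]; auto.
by move=> [[h ?]|[-> ?]]; split => //; rewrite ltnS ltnW.
Qed.

(** For independent copies,
    [P(X = X') = sum_a P(X = a) ^ 2 <= max_a P(X = a)]. *)
Lemma atom_of_agreeing_copies (X X' : O -> nat) N (eta : R) :
  (forall a, measurable [set w | X w = a]) -> (forall a, measurable [set w | X' w = a]) ->
  (forall w, (X w < N)%N) ->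
  (forall a, pr ([set w | X w = a] `&` [set w | X' w = a]) =
             pr [set w | X w = a] * pr [set w | X' w = a]) ->
  (forall a, pr [set w | X' w = a] = pr [set w | X w = a]) ->
  1 - eta <= pr [set w | X w = X' w] -> 0 < 1 - eta ->
  exists a, 1 - eta <= pr [set w | X w = a].
Proof.
move=> mX mX' XN ind law h h0; apply: contrapT => /forallNP hn.
have mXX : measurable [set w | X w = X' w].
  rewrite (_ : mkset _ = \bigcup_a ([set w | X w = a] `&` [set w | X' w = a])).
    by apply: bigcupT_measurable => a; exact: measurableI.
  apply/seteqP; split => w /=; first by exists (X w).
  by move=> [a _ [-> ->]].
have e1 : pr [set w | X w = X' w] = \sum_(a < N) pr [set w | X w = a] ^+ 2.
  rewrite -[in LHS](setTI [set w | X w = X' w]) (_ : setT = [set w | (X w < N)%N]); last first.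
    by apply/seteqP; split => w //= _.
  rewrite pr_partition //; apply: eq_bigr => a _; rewrite expr2 -[X in _ * X]law -ind.
  by congr (fine (P _)); apply/seteqP; split => w /= => [[-> ->]|[-> ->]].
have e2 : \sum_(a < N) pr [set w | X w = a] = 1.
  rewrite -(prT P) (_ : setT = [set w | (X w < N)%N] `&` setT); last first.
    by rewrite setIT; apply/seteqP; split => w //= _.
  by rewrite pr_partition //; apply: eq_bigr => a _; rewrite setIT.
have : \sum_(a < N) pr [set w | X w = a] ^+ 2 < (1 - eta) * \sum_(a < N) pr [set w | X w = a].
  rewrite mulr_sumr.
  have [a ha] : exists a : 'I_N, pr [set w | X w = a] != 0.
    apply: contrapT => /forallNP hz; move: e2; rewrite big1; first by move/eqP; rewrite eq_sym oner_eq0.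
    by move=> i _; have /negP := hz i; rewrite negbK => /eqP.
  rewrite (bigD1 a) //= [ltRHS](bigD1 a) //=; apply: ltr_leD.
    rewrite expr2 ltr_pM2r ?lt_neqAle ?pr_ge0 ?andbT 1?eq_sym //.
    by have /negP := hn a; rewrite -ltNge lt_neqAle eq_sym.
  apply: ler_sum => i _; rewrite expr2; apply: ler_wpM2r; first exact: pr_ge0.
  by have /negP := hn i; rewrite -ltNge => /ltW.
by rewrite e2 mulr1 -e1; lra.
Qed.

Lemma pr_bigcup_sum (J : choiceType) (s : seq J) (E : J -> set O) (c : J -> R) :
  (forall j, j \in s -> measurable (E j)) -> (forall j, j \in s -> pr (E j) <= c j) ->
  pr (\bigcup_(j in [set` s]) E j) <= \sum_(j <- s) c j.
Proof.
elim: s => [|j s IH] mE hE.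
  by rewrite (_ : [set` _] = set0) ?bigcup_set0 ?pr0 ?big_nil //; apply/seteqP; split.
rewrite bigcup_seq big_cons -bigcup_seq.
have mE' k : k \in s -> measurable (E k) by move=> ks; apply: mE; rewrite inE ks orbT.
apply: le_trans (prU_le _ _ _) _.
- by apply: mE; rewrite inE eqxx.
- exact: fin_bigcup_measurable.
rewrite big_cons lerD //; first by apply: hE; rewrite inE eqxx.
by apply: IH => // k ks; apply: hE; rewrite inE ks orbT.
Qed.

Lemma pr_bigcup_le (J : choiceType) (s : seq J) (E : J -> set O) (c : R) :
  (forall j, j \in s -> measurable (E j)) -> (forall j, j \in s -> pr (E j) <= c) ->
  pr (\bigcup_(j in [set` s]) E j) <= c *+ size s.
Proof.
move=> mE hE; apply: le_trans (pr_bigcup_sum mE hE) _.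
by rewrite big_const_seq count_predT iter_addr_0.
Qed.

Lemma pr_meet (E G : set O) : measurable E -> measurable G -> 1 < pr E + pr G ->
  exists w, E w /\ G w.
Proof.
move=> mE mG h; apply: contrapT => /forallNP hn.
have := prU P mE mG; rewrite (_ : E `&` G = set0); last by apply/seteqP; split.
by move/(_ erefl) => e; have := pr_le1 P (measurableU _ _ mE mG); lra.
Qed.

Lemma prI_ge (E G : set O) : measurable E -> measurable G ->
  pr E + pr G - 1 <= pr (E `&` G).
Proof.
move=> mE mG; rewrite -[E `&` G]setCK prC; last by apply: measurableC; exact: measurableI.
rewrite setCI; have := prU_le P (measurableC mE) (measurableC mG).
by rewrite !prC //; lra.
Qed.
End FinitePartition.

(** * Rigidity of local colouring rules *)

Section Rigidity.
Context (R : realType) (dO : measure_display) (O : measurableType dO).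
Variable P : probability O R.
Context (d : nat) (dA : measure_display) (A : measurableType dA).
Notation pr := (prob P).
Notation G := (@cyl (site d) dA A).

Variable Y : O -> site d -> A.
Hypothesis mY : coord_meas Y.
Hypothesis iY : indep P Y.
Hypothesis idY : forall u v B, measurable B -> pr [set w | B (Y w u)] = pr [set w | B (Y w v)].

Variables (i0 i1 : 'I_d) (i01 : i0 != i1).
Variables (r : nat) (f : (site d -> A) -> 'I_3) (e : R).
Hypothesis f_meas : disc_meas G f.
Hypothesis f_dep : forall y y', (forall v, (norm1 v <= r)%N -> y v = y' v) -> f y = f y'.
Hypothesis f_proper : forall u u', norm1 (u - u') = 1%N ->
  pr [set w | f (fun v => Y w (v + u)) = f (fun v => Y w (v + u'))] <= e.

Notation plane := (plane i0 i1).
Notation reindex_axis := (reindex_axis i0).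
Notation cell := (cell i0 i1 f).
Notation winding := (winding i0 i1 f).

Lemma law_inj (t : site d -> site d) (W : set (site d)) (E : set (site d -> A)) :
  {in W &, injective t} -> depends_on W E -> <<s G >> E ->
  pr [set w | E (fun v => Y w (t v))] = pr [set w | E (Y w)].
Proof.
move=> tI dE mE; apply: (law_relabel mY iY _ _ dE mE).
  by move=> i j Wi Wj; apply: tI; rewrite inE.
by move=> i B _ mB; exact: idY.
Qed.

Lemma depends_on_setT (E : set (site d -> A)) : depends_on setT E.
Proof. by move=> y y' yy'; rewrite (_ : y = y') //; apply/funext => v; exact: yy'. Qed.

Lemma f_shift_meas t : disc_meas G (fun y => f (fun v => y (t v))).
Proof. by move=> B; exact: (cyl_relabel t (f_meas B)). Qed.

Lemma cell_meas k i j : disc_meas G (cell k i j).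
Proof. exact: (f_shift_meas (fun v => reindex_axis k (v + plane i j))). Qed.

Lemma winding_meas k n j : disc_meas G (winding k n j).
Proof.
apply: (disc_meas_sum (g := fun i y => step (cell k i%:Z j y) (cell k i.+1%:Z j y))) => i.
by apply: disc_meas2; exact: cell_meas.
Qed.

Lemma meas_eq (K : countType) (g g' : (site d -> A) -> K) :
  disc_meas G g -> disc_meas G g' -> <<s G >> [set y | g y = g' y].
Proof.
move=> mg mg'; have /(_ [set b | b]) := disc_meas2 (fun a b => a == b : Prop) mg mg'.
by congr (_ _); apply/seteqP; split => y /= /eqP.
Qed.

Lemma event_meas (E : set (site d -> A)) : <<s G >> E -> measurable [set w | E (Y w)].
Proof. exact: measurable_pre. Qed.

(** Seen through a window shorter than the circumference, the labels of the
    cylinder have the law of those of the lattice. *)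
Lemma edge_proper n i j i' j' : (2 * r + 2 <= n)%N ->
  norm1 (plane i j - plane i' j') = 1%N -> `|i - i'| <= 1 ->
  pr [set w | cell (wrap_mod n) i j (Y w) = cell (wrap_mod n) i' j' (Y w)] <= e.
Proof.
move=> hn h1 hi.
pose E := [set y : site d -> A | f (fun v => y (v + plane i j)) = f (fun v => y (v + plane i' j'))].
pose W := [set v | exists x : site d, (norm1 x <= r)%N /\ (v = x + plane i j \/ v = x + plane i' j')].
have mE : <<s G >> E by apply: meas_eq; exact: f_shift_meas.
have dE : depends_on W E.
  move=> y y' yy'; rewrite /E /=.
  rewrite (@f_dep (fun v => y (v + plane i j)) (fun v => y' (v + plane i j))); last first.
    by move=> v hv; apply: yy'; exists v; auto.
  rewrite (@f_dep (fun v => y (v + plane i' j')) (fun v => y' (v + plane i' j'))) //.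
  by move=> v hv; apply: yy'; exists v; auto.
have := law_inj (t := reindex_axis (wrap_mod n)) _ dE mE.
rewrite /E /= => ->; first exact: f_proper.
move=> v v'; rewrite !inE => Wv Wv' /rowP hs.
have e0 : v ord0 i0 = v' ord0 i0.
  have := hs i0; rewrite !mxE eqxx; move/wrap_mod_inj; apply.
  case: Wv => x [hx hv]; case: Wv' => x' [hx' hv'].
  have := norm1_coord x i0; have := norm1_coord x' i0.
  set a := x ord0 i0; set a' := x' ord0 i0 => ha ha'.
  by case: hv => ->; case: hv' => ->; rewrite !mxE eqxx -/a -/a'; lia.
apply/rowP => l; have := hs l; rewrite !mxE; case: eqP => [-> _|//].
exact: e0.
Qed.

Lemma norm1_plane i j : norm1 (plane i j) = (`|i| + `|j|)%N.
Proof.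
rewrite /norm1 (bigD1 i0) //= (bigD1 i1) 1?eq_sym //= !mxE eqxx.
rewrite [in X in (_ + (X + _))%N]eq_sym (negbTE i01) eqxx addnA.
rewrite big1 ?addn0 // => k /andP[k0 k1].
by rewrite mxE (negbTE k0) (negbTE k1).
Qed.

Lemma planeB i j i' j' : plane i j - plane i' j' = plane (i - i') (j - j').
Proof.
by apply/rowP => k; rewrite !mxE; case: ifP => // _; case: ifP; rewrite ?subrr.
Qed.

(* The smallest distance at which two rows depend on disjoint sets of
   labels. *)
Let m := (2 * r + 1)%N.

Definition proper_strip n := [set y : site d -> A |
  (forall i j : nat, (i < n)%N -> (j <= m)%N ->
     cell (wrap_mod n) i%:Z j%:Z y != cell (wrap_mod n) i.+1%:Z j%:Z y) /\
  (forall i j : nat, (i < n)%N -> (j < m)%N ->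
     cell (wrap_mod n) i%:Z j%:Z y != cell (wrap_mod n) i%:Z j.+1%:Z y)].

Definition bad_edge n (p : 'I_n * 'I_m.+1 * bool) := [set y : site d -> A |
  if p.2 then cell (wrap_mod n) (nat_of_ord p.1.1)%:Z (nat_of_ord p.1.2)%:Z y =
              cell (wrap_mod n) p.1.1.+1%:Z (nat_of_ord p.1.2)%:Z y
  else cell (wrap_mod n) (nat_of_ord p.1.1)%:Z (nat_of_ord p.1.2)%:Z y =
       cell (wrap_mod n) (nat_of_ord p.1.1)%:Z p.1.2.+1%:Z y].

Lemma bad_edge_meas n p : <<s G >> (@bad_edge n p).
Proof. by case: p => [[i j] []]; apply: meas_eq; exact: cell_meas. Qed.

Lemma proper_strip_bad_edge n : ~` proper_strip n `<=`
  \bigcup_(p in [set` enum {: 'I_n * 'I_m.+1 * bool}]) @bad_edge n p.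
Proof.
move=> y; apply: contra_notP => hn; split => i j hi hj; apply/negP => /eqP h; apply: hn.
  have hj' : (j < m.+1)%N by [].
  by exists (Ordinal hi, Ordinal hj', true) => //=; rewrite mem_enum.
have hj' : (j < m.+1)%N by exact: ltnW.
by exists (Ordinal hi, Ordinal hj', false) => //=; rewrite mem_enum.
Qed.

(** The finite intersection form of [proper_strip], for which a union bound is
    immediate. *)
Definition all_proper n := [set y : site d -> A | forall p, ~ @bad_edge n p y].

Lemma all_proper_meas n : <<s G >> (all_proper n).
Proof.
rewrite (_ : all_proper n = \bigcap_(p in [set` enum {: 'I_n * 'I_m.+1 * bool}]) ~` @bad_edge n p).
  apply: (@fin_bigcap_measurable _ (g_sigma_algebraType G)) => // p _.
  apply: (@measurableC _ (g_sigma_algebraType G)); exact: bad_edge_meas.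
apply/seteqP; split => y /= h p; first by move=> _; exact: h.
by apply: h; rewrite /= mem_enum.
Qed.

Lemma all_proper_strip n : all_proper n `<=` proper_strip n.
Proof.
move=> y h; apply: contrapT => /proper_strip_bad_edge[p _]; exact: h.
Qed.

Lemma pr_all_proper n : (2 * r + 2 <= n)%N ->
  1 - e *+ (n * m.+1 * 2) <= pr [set w | all_proper n (Y w)].
Proof.
move=> hn; have mp := event_meas (all_proper_meas n).
rewrite -[X in pr X]setCK prC; last exact: measurableC.
rewrite lerD2l lerN2.
have -> : ~` [set w | all_proper n (Y w)] =
  \bigcup_(p in [set` enum {: 'I_n * 'I_m.+1 * bool}]) [set w | @bad_edge n p (Y w)].
  apply/seteqP; split => w /=.
    by move=> /existsNP[p /contrapT hp]; exists p => //=; rewrite mem_enum.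
  by move=> [p _ hp] /(_ p).
have -> : (n * m.+1 * 2)%N = size (enum {: 'I_n * 'I_m.+1 * bool}).
  by rewrite -cardE !card_prod !card_ord card_bool.
apply: pr_bigcup_le => p _; first exact: event_meas (bad_edge_meas p).
case: p => [[i j] []] /=; apply: edge_proper => //; rewrite ?planeB ?norm1_plane; lia.
Qed.

Lemma winding_row_indep n a : (2 * r + 2 <= n)%N ->
  pr ([set w | winding (wrap_mod n) n 0 (Y w) = a] `&` [set w | winding (wrap_mod n) n m%:Z (Y w) = a]) =
  pr [set w | winding (wrap_mod n) n 0 (Y w) = a] * pr [set w | winding (wrap_mod n) n m%:Z (Y w) = a].
Proof.
move=> hn.
have dW j : depends_on [set v : site d | `|v ord0 i1 - j| <= r%:Z] [set y | winding (wrap_mod n) n j y = a].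
  move=> y y' yy' /= <-; rewrite /winding.
  have eC (k : nat) : cell (wrap_mod n) k%:Z j y = cell (wrap_mod n) k%:Z j y'.
    apply: f_dep => v hv; apply: yy'; rewrite /= !mxE eq_sym (negbTE i01) eqxx.
    by have := norm1_coord v i1; set b := v ord0 i1; lia.
  by apply: eq_bigr => i _; rewrite !eC.
apply: (indep2 mY iY _ (dW 0) (dW m%:Z)).
- by apply/seteqP; split => // v [/=]; set b := v ord0 i1; rewrite /m; lia.
- exact: (winding_meas _ _ _ [set a]).
- exact: (winding_meas _ _ _ [set a]).
Qed.

Lemma winding_row_law n j a :
  pr [set w | winding (wrap_mod n) n j (Y w) = a] = pr [set w | winding (wrap_mod n) n 0 (Y w) = a].
Proof.
pose t (v : site d) := v + plane 0 j.
rewrite -(law_inj (t := t) (W := setT) (E := [set y | winding (wrap_mod n) n 0 y = a])) //.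
- congr (fine (P _)); apply/seteqP; split => w /=; rewrite /winding => <-; apply: eq_bigr => i _;
  by congr step; congr f; apply/funext => v; congr (Y w); apply/rowP => l; rewrite !mxE eqxx;
    case: (l == i0); rewrite ?addr0 //; case: (l == i1); rewrite ?addr0.
- by move=> v v' _ _; rewrite /t => /addIr.
- exact: depends_on_setT.
- exact: (winding_meas _ _ _ [set a]).
Qed.

(** Omitting a column of labels is a relabelling by an injection, so it does
    not change the law of the winding. *)
Lemma winding_skip_law n h a :
  pr [set w | winding (wrap_skip h n) n 0 (Y w) = a] = pr [set w | winding (wrap_mod n) n 0 (Y w) = a].
Proof.
rewrite -[RHS](law_inj (t := reindex_axis (skip h)) (W := setT) (E := [set y | winding (wrap_mod n) n 0 y = a])) //.
- congr (fine (P _)); apply/seteqP; split => w /=; rewrite /winding => <-; apply: eq_bigr => i _;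
  by congr step; congr f; apply/funext => v; congr (Y w); apply/rowP => l; rewrite !mxE eqxx;
    case: (l =P i0).
- move=> v v' _ _ /rowP hs; apply/rowP => l; have := hs l; rewrite !mxE.
  by case: (l =P i0) => // -> /skip_inj.
- exact: depends_on_setT.
- exact: (winding_meas _ _ _ [set a]).
Qed.

(** The windings of the rows [0] and [m] are independent with the same law and
    coincide when the strip between them is properly coloured, so they are
    nearly constant. The constant is attained together with a properly
    coloured strip, hence has the arithmetic properties of a winding. *)
Lemma winding_concentrated n (eta : R) : (2 * r + 2 <= n)%N ->
  e *+ (n * m.+1 * 2) <= eta -> eta < 1 / 2 ->
  exists a : int, [/\ 1 - eta <= pr [set w | winding (wrap_mod n) n 0 (Y w) = a],
    `|a| <= n%:Z, exists k : int, a = k * 3 & exists k : int, a = n%:Z + k * 2].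
Proof.
move=> hn he h2.
have wle y j : `|winding (wrap_mod n) n j y| <= n%:Z by exact: (sum_step_le (fun i => cell (wrap_mod n) i%:Z j y)).
(* The winding takes values in [-n, n]; it is shifted to a natural number
   below [2 n + 1]. *)
pose X j w := absz (winding (wrap_mod n) n j (Y w) + n%:Z).
have XE j a : [set w | X j w = a] = [set w | winding (wrap_mod n) n j (Y w) = a%:Z - n%:Z].
  by apply/seteqP; split => w /=; rewrite /X; have := wle (Y w) j; lia.
have mw j a : measurable [set w | winding (wrap_mod n) n j (Y w) = a].
  exact: event_meas (winding_meas _ _ _ [set a]).
have mA := event_meas (all_proper_meas n).
have agree : [set w | all_proper n (Y w)] `<=` [set w | X 0 w = X m%:Z w].
  by move=> w /= /all_proper_strip[hh hv]; rewrite /X (winding_row hh hv).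
have [|||a|a|||a ha] := @atom_of_agreeing_copies R dO O P (X 0) (X m%:Z) (2 * n + 1) eta.
- by move=> a; rewrite XE; exact: mw.
- by move=> a; rewrite XE; exact: mw.
- by move=> w; rewrite /X; have := wle (Y w) 0; lia.
- by rewrite !XE; exact: winding_row_indep.
- by rewrite !XE; exact: winding_row_law.
- apply: (@le_trans _ _ (pr [set w | all_proper n (Y w)])).
    by apply: le_trans (pr_all_proper hn); lra.
  apply: le_pr => //.
  rewrite (_ : mkset _ = \bigcup_a ([set w | X 0 w = a] `&` [set w | X m%:Z w = a])).
    by apply: bigcupT_measurable => a; rewrite !XE; exact: measurableI.
  apply/seteqP; split => w /=; first by exists (X 0 w).
  by move=> [a _ [-> ->]].
- lra.
rewrite XE in ha; exists (a%:Z - n%:Z).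
have [w [/= hw1 hw2]] : exists w, [set w | winding (wrap_mod n) n 0 (Y w) = a%:Z - n%:Z] w /\ [set w | all_proper n (Y w)] w.
  by apply: pr_meet => //; have := pr_all_proper hn; lra.
split => //; rewrite -hw1 //.
- have [k hk] := sum_step_mod3 (fun i => cell (wrap_mod n) i%:Z 0 (Y w)) n.
  by exists k; rewrite /winding hk cell_per subrr add0r.
- apply: (sum_step_odd (c := fun i => cell (wrap_mod n) i%:Z 0 (Y w))) => i hi.
  by have [hh _] := all_proper_strip hw2; exact: (hh i 0%N hi).
Qed.

(** If [e * r ^ 2] were smaller, the winding [w_n] would be nearly
    deterministic for all circumferences [n] between [2 r + 2] and [23 r].
    Inserting a column shows that [w] is affine in [n]. Consecutive values
    differ by a multiple of 3 which is odd, so the slope is at least 3 in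
    absolute value, against [|w_n| <= n] at [n = n0] and at [n = 2 n0 + 1]. *)
Lemma local_rule_error : (0 < r)%N -> 1 / 100 ^+ 2 <= e * r%:R ^+ 2.
Proof.
move=> r0; rewrite leNgt; apply/negP => he.
have e0 : 0 <= e.
  apply: le_trans (f_proper (u := plane 1 0) (u' := 0) _); first exact: pr_ge0.
  by rewrite subr0 norm1_plane.
(* The strip has at most [23 r * (2 r + 2) * 2 <= 184 r ^ 2] edges, and
   [184 / 100 ^ 2 < 1 / 5]. *)
have hn n : (2 * r + 2 <= n)%N -> (n <= 23 * r)%N -> exists a : int,
   [/\ 4 / 5 <= pr [set w | winding (wrap_mod n) n 0 (Y w) = a],
    `|a| <= n%:Z, exists k : int, a = k * 3 & exists k : int, a = n%:Z + k * 2].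
  move=> h1 h2; have [| |a [ha1 ha2 ha3 ha4]] := @winding_concentrated n (1 / 5) h1.
  - rewrite -[e *+ _]mulr_natr.
    apply: le_trans (_ : e * (184 * r%:R ^+ 2) <= _); last by lra.
    apply: ler_wpM2l => //; rewrite -natrX -natrM ler_nat /m; nia.
  - lra.
  - by exists a; split => //; lra.
(* Any value that is at least [4 r + 3], as the insertion of a column asks,
   and such that [2 n0 + 1 <= 23 r]. *)
pose n0 := (5 * r + 2)%N.
have [wn hwn] : exists wn : nat -> int, forall n, (2 * r + 2 <= n)%N -> (n <= 23 * r)%N ->
   [/\ 4 / 5 <= pr [set w | winding (wrap_mod n) n 0 (Y w) = wn n],
    `|wn n| <= n%:Z, exists k : int, wn n = k * 3 & exists k : int, wn n = n%:Z + k * 2].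
  have /choice[wn hw] : forall n, exists a : int, (2 * r + 2 <= n)%N -> (n <= 23 * r)%N ->
   [/\ 4 / 5 <= pr [set w | winding (wrap_mod n) n 0 (Y w) = a],
    `|a| <= n%:Z, exists k : int, a = k * 3 & exists k : int, a = n%:Z + k * 2].
    move=> n; case: (pselect ((2 * r + 2 <= n)%N /\ (n <= 23 * r)%N)) => [[h1 h2]|h].
      by have [a ha] := hn n h1 h2; exists a.
    by exists 0 => h1 h2; case: h.
  by exists wn.
(* Four events of probability at least 4/5 occur simultaneously with positive
   probability: the windings on the circumferences [n + 2] and [n + 1] and,
   with a skipped column, on [n + 1] and [n] all take their typical values. *)
have hlin n : (4 * r + 3 <= n)%N -> (n.+2 <= 23 * r)%N -> wn n.+2 - wn n.+1 = wn n.+1 - wn n.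
  move=> h1 h2.
  have [a0 [a1 [a2 [a3 a4]]]] : (2 * r + 2 <= n)%N /\ (n <= 23 * r)%N /\
      (2 * r + 2 <= n.+1)%N /\ (n.+1 <= 23 * r)%N /\ (2 * r + 2 <= n.+2)%N.
    by clear -h1 h2; lia.
  have [p2 _ _ _] := hwn n.+2 a4 h2.
  have [p1 _ _ _] := hwn n.+1 a2 a3.
  have [p0 _ _ _] := hwn n a0 a1.
  have q1 := winding_skip_law n.+1 (2 * r + 1)%N%:Z (wn n.+1).
  have q0 := winding_skip_law n (2 * r + 1)%N%:Z (wn n).
  have mw k n' a : measurable [set w | winding k n' 0 (Y w) = a].
    exact: event_meas (winding_meas _ _ _ [set a]).
  rewrite -q1 in p1 *; have p1' := p1; rewrite q1 in p1'; rewrite -q0 in p0.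
  have [w [[/= w2 w1] [w1' w0]]] : exists w,
     ([set w | winding (wrap_mod n.+2) n.+2 0 (Y w) = wn n.+2] `&`
      [set w | winding (wrap_mod n.+1) n.+1 0 (Y w) = wn n.+1]) w /\
     ([set w | winding (wrap_skip (2 * r + 1)%N%:Z n.+1) n.+1 0 (Y w) = wn n.+1] `&`
      [set w | winding (wrap_skip (2 * r + 1)%N%:Z n) n 0 (Y w) = wn n]) w.
    apply: pr_meet; [exact: measurableI|exact: measurableI|].
    have := prI_ge P (mw (wrap_mod n.+2) n.+2 (wn n.+2)) (mw (wrap_mod n.+1) n.+1 (wn n.+1)).
    have := prI_ge P (mw (wrap_skip (2 * r + 1)%N%:Z n.+1) n.+1 (wn n.+1)) (mw (wrap_skip (2 * r + 1)%N%:Z n) n (wn n)).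
    lra.
  by have := @winding_insert_const d i0 i1 A f r f_dep n (Y w) h1; rewrite w2 w1 w1' w0.
(* A vanishing second difference makes [wn] affine from [n0] on. *)
have hD k : (n0 + k.+1 <= 23 * r)%N -> wn (n0 + k.+1)%N - wn (n0 + k)%N = wn n0.+1 - wn n0.
  elim: k => [|k IH] hk; first by rewrite addn1 addn0.
  have a0 : (4 * r + 3 <= n0 + k)%N by rewrite /n0; clear -r0; lia.
  have a1 : ((n0 + k).+2 <= 23 * r)%N by clear -hk; lia.
  by have := hlin _ a0 a1; rewrite !addnS in IH hk * => ->; apply: IH; exact: ltnW.
have hS k : (n0 + k <= 23 * r)%N -> wn (n0 + k)%N = wn n0 + (wn n0.+1 - wn n0) * k%:Z.
  elim: k => [|k IH] hk; first by rewrite addn0 mulr0 addr0.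
  have h1 := hD k hk; rewrite addnS in hk; have h2 := IH (ltnW hk).
  rewrite (_ : k.+1%:Z = k%:Z + 1); last by rewrite -addn1 PoszD.
  by rewrite mulrDr mulr1 addrA -h2 -h1 addrC subrK.
have [a0 [a1 [a2 [a3 a4]]]] : (2 * r + 2 <= n0)%N /\ (n0 <= 23 * r)%N /\ (n0.+1 <= 23 * r)%N /\
    (n0 + n0.+1 <= 23 * r)%N /\ (2 * r + 2 <= n0 + n0.+1)%N.
  by rewrite /n0; clear -r0; lia.
have [_ b0 [k0 c0] [l0 o0]] := hwn n0 a0 a1.
have [_ b1 [k1 c1] [l1 o1]] := hwn n0.+1 (leqW a0) a2.
have [_ b2 _ _] := hwn (n0 + n0.+1)%N a4 a3.
have e2 := hS n0.+1 a3.
have e3 : wn n0.+1 - wn n0 = (k1 - k0) * 3 by rewrite c0 c1; ring.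
have e4 : wn n0.+1 - wn n0 = 1 + (l1 - l0) * 2 by rewrite o0 o1 -addn1 PoszD; ring.
move: e2 b0 b2; rewrite e3; rewrite e3 in e4.
(* The slope is [3 * (k1 - k0)] and odd, so [k1 - k0] is not zero. *)
have D0 : k1 - k0 <= -1 \/ 1 <= k1 - k0 by clear -e4; lia.
have : (k1 - k0) * 3 * n0.+1%:Z <= - 3 * n0.+1%:Z \/ 3 * n0.+1%:Z <= (k1 - k0) * 3 * n0.+1%:Z.
  have n1 : 0 <= n0.+1%:Z by [].
  by case: D0 => hD0; [left|right]; apply: ler_wpM2r => //; clear -hD0; lia.
move: (_ * 3 * _) (wn _) (wn _) => t x y; clear; lia.
Qed.
End Rigidity.

(** * The second moment from dyadic scales *)

Section LowerIntegral.
Context (R : realType) (dO : measure_display) (O : measurableType dO).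
Variable P : probability O R.
Notation pr := (prob P).

(** No measurability is involved: the integral of a nonnegative function is a
    supremum over the simple functions below it. *)
Lemma ge0_le_lower_integral (f g : O -> \bar R) :
  (forall w, 0 <= f w)%E -> (forall w, f w <= g w)%E ->
  (\int[P]_w f w <= \int[P]_w g w)%E.
Proof.
move=> f0 fg; have g0 w : (0 <= g w)%E by exact: le_trans (fg w).
rewrite !ge0_integralTE //; apply: le_ereal_sup; apply: image_subset => h /= hf w.
exact: le_trans (fg w).
Qed.

Lemma natr_pow4 k : (4 ^ k)%:R = (2 ^ k)%:R ^+ 2 :> R.
Proof. by rewrite (_ : 4 = 2 ^ 2)%N // -expnM mulnC expnM natrX. Qed.

(** A geometric sum is dominated by its last term:
    [4 ^ K * (1 + 1/4 + ...) / 2 = (2/3) * 4 ^ K]. *)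
Lemma sum_pow4 (b : nat -> bool) (x : R) K : 0 <= x ->
  (forall k, b k -> (2 ^ k)%:R <= x) ->
  \sum_(k < K) (if b k then (4 ^ k)%:R / 2 else 0) <= x ^+ 2.
Proof.
move=> x0 hb.
have {}hb k : b k -> (4 ^ k)%:R <= x ^+ 2.
  by move=> /hb h; rewrite natr_pow4 lerXn2r ?nnegrE.
suff H : \sum_(k < K) (if b k then (4 ^ k)%:R / 2 else 0) <= (2 / 3 : R) * x ^+ 2.
  apply: le_trans H _; have := sqr_ge0 x; lra.
elim: K => [|K IH]; first by rewrite big_ord0; have := sqr_ge0 x; lra.
rewrite big_ord_recr /=; case: ifP => bK; last by rewrite addr0.
have : \sum_(k < K) (if b k then (4 ^ k)%:R / 2 else 0) <= ((4 ^ K)%:R / 6 : R).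
  elim: K {IH bK} => [|K IH]; first by rewrite big_ord0; lra.
  rewrite big_ord_recr /= expnS natrM; have : 0 <= (4 ^ K)%:R :> R by [].
  by case: ifP => _; lra.
by have := hb _ bK; lra.
Qed.

(** For [r = 2 ^ k] the event [D r] contributes [4 ^ k * P(D r) / 2 >= c / 2]
    to the second moment. The sum of these contributions over [k] stays below
    [Z ^ 2] pointwise by [sum_pow4], although the events overlap. [Z] stands
    for the coding radius, which may fail to be measurable. *)
Lemma second_moment_dyadic (Z : O -> \bar R) (D : nat -> set O) (c : R) : 0 < c ->
  (forall w, 0 <= Z w)%E -> (forall r, measurable (D r)) ->
  (forall r w, D r w -> (r%:R%:E <= Z w)%E) ->
  (forall r, (0 < r)%N -> c <= pr (D r) * r%:R ^+ 2) ->
  (\int[P]_w (Z w ^+ 2) = +oo)%E.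
Proof.
move=> c0 Z0 mD hD hc.
pose g k w : \bar R := (((4 ^ k)%:R / 2) * \1_(D (2 ^ k)%N) w)%:E.
have mg k : measurable_fun setT (g k).
  by apply/measurable_EFinP; apply: measurable_funM => //; exact: measurable_indic.
have g0 k w : (0 <= g k w)%E by rewrite lee_fin mulr_ge0 // divr_ge0.
have key K : ((K%:R * (c / 2))%:E <= \int[P]_w (Z w ^+ 2))%E.
  apply: (@le_trans _ _ (\int[P]_w (\sum_(k <- iota 0 K) g k w))%E).
    rewrite ge0_integral_sum // (@eq_bigr _ _ _ _ _ _ _ (fun k => (((4 ^ k)%:R / 2) * pr (D (2 ^ k)%N))%:E)); last first.
      move=> k _; rewrite /g; under eq_integral do rewrite EFinM.
      rewrite ge0_integralZl_EFin ?divr_ge0 //.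
      + by rewrite integral_indic // setIT [RHS]EFinM; congr (mule _ _); exact: (prE P).
      + by apply/measurable_EFinP; exact: measurable_indic.
    rewrite sumEFin lee_fin.
    rewrite (_ : K%:R * (c / 2) = \sum_(k <- iota 0 K) (c / 2)); last first.
      by rewrite big_const_seq count_predT size_iota iter_addr_0 mulr_natl.
    apply: ler_sum => k _.
    have := hc (2 ^ k)%N; rewrite expn_gt0 => /(_ isT).
    rewrite natr_pow4; lra.
  apply: ge0_le_lower_integral => w; first by apply: sume_ge0.
  have [Zoo|Zf] := eqVneq (Z w) +oo%E; first by rewrite Zoo expeS /= ?mulyy leey.
  have /fineK <- : Z w \is a fin_num by rewrite ge0_fin_numE // ltey.
  rewrite -EFin_expe sumEFin lee_fin -{1}(subn0 K) big_mkord.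
  have := @sum_pow4 (fun k => w \in D (2 ^ k)%N) (fine (Z w)) K.
  rewrite fine_ge0 // => /(_ isT) h.
  apply: le_trans (h _).
    by apply: ler_sum => k _; rewrite indicE; case: (w \in _); rewrite ?mulr1 ?mulr0.
  move=> k; rewrite inE => /hD hZ; rewrite -lee_fin fineK // ge0_fin_numE // ltey //.
apply/eqyP => x x0.
have /ltW h := (truncnS_gt (x / (c / 2))).
apply: le_trans (key (Num.trunc (x / (c / 2))).+1); rewrite lee_fin.
by rewrite -ler_pdivrMr // divr_gt0.
Qed.
End LowerIntegral.

(** * Resampling the labels outside a ball *)

Section Resample.
Context (R : realType) (dO : measure_display) (O : measurableType dO).
Variable P : probability O R.
Context (d : nat) (dA : measure_display) (A : measurableType dA).
Notation pr := (prob P).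

Lemma RV_coord_meas (Y : {RV P >-> config d A}) : coord_meas (Y : O -> site d -> A).
Proof.
move=> v B mB.
have := @measurable_funPTI _ _ _ _ Y [set y | B (y v)].
by apply; apply: sub_gen_smallest; exists v; exists B.
Qed.

Lemma mfun_disc_meas (F : {mfun config d A >-> config d 'I_3}) v :
  disc_meas (@cyl (site d) dA A) (fun y => F y v).
Proof.
move=> B; have := @measurable_funPTI _ _ _ _ F [set x | B (x v)].
by apply; apply: sub_gen_smallest; exists v; exists B.
Qed.

Lemma indepE (Y : {RV P >-> config d A}) : independent Y -> indep P (Y : O -> site d -> A).
Proof.
move=> h s B us mB; apply: EFin_inj.
have mY := RV_coord_meas Y.
rewrite -prE; last exact: measurable_all.
rewrite h // -prodEFin; apply: eq_bigr => v _.
by rewrite (prE P) //; exact: mY.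
Qed.

Definition mix r (y y' : site d -> A) : site d -> A :=
  fun v => if (norm1 v <= r)%N then y v else y' v.

Variables (Y : {RV P >-> config d A}) (F : {mfun config d A >-> config d 'I_3}).

Definition resample_set r : set (O * O) :=
  [set p | F (mix r (Y p.1) (Y p.2)) 0 <> F (Y p.1) 0].

Lemma resample_meas r : measurable (resample_set r).
Proof.
have mY := RV_coord_meas Y.
have c1 : coord_meas (fun p : O * O => Y p.1 : site d -> A).
  move=> v B mB; rewrite (_ : mkset _ = setT `&` fst @^-1` [set w | B (Y w v)]); last by rewrite setTI.
  exact (@measurable_fst _ _ O O measurableT _ (mY v B mB)).
have c2 : coord_meas (fun p : O * O => mix r (Y p.1) (Y p.2)).
  move=> v B mB; rewrite /mix; case: (norm1 v <= r)%N; first exact (c1 v B mB).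
  rewrite (_ : mkset _ = setT `&` snd @^-1` [set w | B (Y w v)]); last by rewrite setTI.
  exact (@measurable_snd _ _ O O measurableT _ (mY v B mB)).
have mF := mfun_disc_meas F (v:=0).
rewrite (_ : resample_set r = \bigcup_(c in [set: 'I_3])
   ([set p | F (mix r (Y p.1) (Y p.2)) 0 = c] `&` ~` [set p | F (Y p.1) 0 = c])).
  apply: fin_bigcup_measurable => // c _; apply: measurableI.
    exact: (measurable_pre c2 (mF [set c])).
  by apply: measurableC; exact: (measurable_pre c1 (mF [set c])).
apply/seteqP; split => p /=.
  by move=> h; exists (F (mix r (Y p.1) (Y p.2)) 0) => //; split => //= /esym.
by move=> [c _ [/= h1 h2]]; rewrite /resample_set /= h1 => /esym/h2.
Qed.

(** The measurable substitute for the event that the coding radius is at least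
    [r]. *)
Definition undetermined r : set O := [set w | (0 < P (xsection (resample_set r) w))%E].

Lemma undetermined_meas r : measurable (undetermined r).
Proof.
have := measurable_fun_xsection P (resample_meas r) => h.
by have := emeasurable_fun_o_infty measurableT h (0%E); rewrite setTI.
Qed.

(** If a ball of radius less than [r] determines the colour of the origin,
    resampling outside the ball of radius [r] never changes it. *)
Lemma undetermined_radius r w : undetermined r w ->
  (r%:R%:E <= coding_radius F R (Y w))%E.
Proof.
move=> hw; apply: le_ereal_inf_tmp => _ /= [r' hr' <-]; rewrite lee_fin ler_nat.
rewrite leqNgt; apply/negP => rr'; move: hw; rewrite /undetermined /=.
rewrite (_ : xsection _ _ = set0) ?measure0 ?ltxx //.
apply/seteqP; split => // w'; rewrite /xsection /= inE /resample_set /=; apply.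
by apply: hr' => v hv; rewrite /mix (leq_trans hv (ltnW rr')).
Qed.

(** The probability that resampling changes the colour is at most that of
    [undetermined r]. If it exceeded [c] for every fixed choice of the outside
    labels, Fubini would give a larger value. *)
Lemma good_outside r (c : R) : pr (undetermined r) < c ->
  exists w', pr [set w | F (mix r (Y w) (Y w')) 0 <> F (Y w) 0] <= c.
Proof.
move=> hc; apply: contrapT => /forallNP hn.
have mS := resample_meas r.
have eS w' : [set w | F (mix r (Y w) (Y w')) 0 <> F (Y w) 0] = ysection (resample_set r) w'.
  by apply/seteqP; split => w; rewrite /ysection /= inE.
have h1 : ((P \x P)%E (resample_set r) <= P (undetermined r))%E.
  rewrite /product_measure1 -[X in (_ <= P X)%E]setIT -integral_indic //; last exact: undetermined_meas.
  apply: ge0_le_integral => //.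
  - exact: measurable_fun_xsection.
  - by apply/measurable_EFinP; apply: measurable_indic; exact: undetermined_meas.
  move=> w _ /=; rewrite indicE.
  have [hw|hw] := pselect (undetermined r w).
    rewrite mem_set //; apply: probability_le1; exact: measurable_xsection.
  rewrite memNset //= leNgt; exact/negP.
have h2 : (c%:E <= (P \x P)%E (resample_set r))%E.
  have -> : (P \x P)%E (resample_set r) = (P \x^ P)%E (resample_set r).
    apply: product_measure_unique => // B C mB mC; exact: product_measure2E.
  rewrite /product_measure2.
  have -> : c%:E = (\int[P]_w (cst c%:E w))%E.
    by rewrite integral_cst // -[LHS]mule1; congr (mule _ _); apply/esym; exact: (probability_setT P).
  apply: ge0_le_integral => //.
  - move=> w _; rewrite lee_fin; apply: le_trans (ltW hc); exact: pr_ge0.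
  - exact: measurable_fun_ysection.
  move=> w' _ /=; rewrite -eS (prE P) ?lee_fin; last by rewrite eS; exact: measurable_ysection.
  by have /negP := hn w'; rewrite -ltNge => /ltW.
have := le_trans h2 h1; rewrite (prE P) ?lee_fin; last exact: undetermined_meas.
by rewrite leNgt hc.
Qed.

(** With the outside labels fixed as in [good_outside] the factor becomes a
    rule of range [r] that differs from the colouring at a given site with
    probability at most [c]. It violates an edge only if it errs at one of its
    ends, hence with probability at most [2 c], and [local_rule_error]
    applies. *)
Lemma pr_undetermined_ge r (X : {RV P >-> config d 'I_3}) : (2 <= d)%N ->
  coloring X -> ffiid_via X Y F -> (0 < r)%N ->
  1 / 200 ^+ 2 <= pr (undetermined r) * r%:R ^+ 2.
Proof.
move=> d2 colX [[idY iY] eqF _ XF] r0; rewrite leNgt; apply/negP => hu.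
have mY := RV_coord_meas Y; have iY' := indepE iY.
have r2 : 0 < r%:R ^+ 2 :> R by rewrite exprn_gt0 // ltr0n.
pose c : R := 1 / 200 ^+ 2 / r%:R ^+ 2.
have [w' hw'] : exists w', pr [set w | F (mix r (Y w) (Y w')) 0 <> F (Y w) 0] <= c.
  by apply: good_outside; rewrite /c ltr_pdivlMr.
pose f (y : site d -> A) : 'I_3 := F (mix r y (Y w')) 0.
have mixc : coord_meas (fun y : g_sigma_algebraType (@cyl (site d) dA A) => mix r y (Y w')).
  move=> v B mB; rewrite /mix; case: (norm1 v <= r)%N.
    by apply: sub_gen_smallest; exists v; exists B.
  case: (pselect (B (Y w' v))) => h.
    by rewrite (_ : mkset _ = setT) //; apply/seteqP; split.
  by rewrite (_ : mkset _ = set0) //; apply/seteqP; split.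
have mf : disc_meas (@cyl (site d) dA A) f.
  by move=> B; exact: (measurable_pre mixc (mfun_disc_meas F (v:=0) B)).
have df y y' : (forall v, (norm1 v <= r)%N -> y v = y' v) -> f y = f y'.
  move=> h; congr (F _ 0); apply/funext => v; rewrite /mix.
  by case: ifP => // /h.
have idY' u v B : measurable B -> pr [set w | B (Y w u)] = pr [set w | B (Y w v)].
  by move=> mB; rewrite /prob (idY u v).
have hF u : pr [set w | f (fun v => Y w (v + u)) <> F (Y w) u] <= c.
  pose E := [set y : site d -> A | f y <> F y 0].
  have mE : <<s @cyl (site d) dA A >> E.
    have /(_ [set b | ~ b]) := disc_meas2 (fun a b => a = b) mf (mfun_disc_meas F (v:=0)).
    by [].
  have := @law_inj _ _ _ P _ _ _ Y mY iY' idY' (fun v => v + u) setT E.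
  move=> /(_ _ _ mE) h.
  rewrite (_ : mkset _ = [set w | E (fun v => Y w (v + u))]) ?h //.
  - by move=> v v' _ _ /addIr.
  - by apply: depends_on_setT.
  apply/seteqP; split => w; rewrite /E /=;
    by have := congr1 (fun z => z 0) (eqF u (Y w)); rewrite /translate /= add0r => ->.
(* The colouring is proper outside a null set [N]. *)
have pf u u' : norm1 (u - u') = 1%N ->
   pr [set w | f (fun v => Y w (v + u)) = f (fun v => Y w (v + u'))] <= 2 * c.
  move=> huu.
  have mfu x : measurable [set w | f (fun v => Y w (v + x)) <> F (Y w) x].
    have /(_ [set b | ~ b]) := disc_meas2 (fun a b => a = b) (f_shift_meas mf (fun v => v + x)) (mfun_disc_meas F (v:=x)).
    exact: measurable_pre.
  have [N [mN N0 hN]] := colX.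
  have mE : measurable [set w | f (fun v => Y w (v + u)) = f (fun v => Y w (v + u'))].
    have := meas_eq (f_shift_meas mf (fun v => v + u)) (f_shift_meas mf (fun v => v + u')).
    exact: measurable_pre.
  apply: (@le_trans _ _ (pr (([set w | f (fun v => Y w (v + u)) <> F (Y w) u] `|`
    [set w | f (fun v => Y w (v + u')) <> F (Y w) u']) `|` N))).
    apply: le_pr => //; first by apply: measurableU => //; exact: measurableU.
    move=> w /= hw; have [hN'|hN'] := pselect (N w); first by right.
    left; have [h1|h1] := pselect (f (fun v => Y w (v + u)) = F (Y w) u); last by left.
    right => h2; apply: hN'; apply: hN => /= h.
    by have := h u u' huu; rewrite XF -h1 -h2.
  apply: le_trans (prU_le _ _ mN) _; first exact: measurableU.
  apply: le_trans (lerD (prU_le _ (mfu u) (mfu u')) (lexx _)) _.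
  have := hF u; have := hF u'; rewrite [pr N]/prob N0 /=; lra.
have i0 : (0 < d)%N by exact: ltn_trans d2.
have := @local_rule_error R _ _ P d _ A Y mY iY' idY' (Ordinal i0) (Ordinal d2) isT r f (2 * c) mf df pf r0.
by rewrite /c; rewrite -mulrA divfK ?gt_eqF //; lra.
Qed.

Theorem second_moment_infinite (X : {RV P >-> config d 'I_3}) : (2 <= d)%N ->
  coloring X -> ffiid_via X Y F -> radius_second_moment Y F = +oo%E.
Proof.
move=> d2 colX hX; apply: (second_moment_dyadic (D := undetermined) (c := 1 / 200 ^+ 2)) => //.
- by move=> w; apply: le_ereal_inf_tmp => _ [r _ <-]; rewrite lee_fin.
- exact: undetermined_meas.
- exact: undetermined_radius.
- by move=> r r0; exact: pr_undetermined_ge hX r0.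
Qed.
End Resample.

(** * Hierarchical domains *)

Lemma absz_parity (a : int) : exists q, a = q * 2 + (odd (absz a) : nat)%:Z.
Proof.
case: a => n; first by exists (n./2)%:Z; have := odd_double_half n; rewrite /=; lia.
exists (- (n.+1./2)%:Z - (odd n.+1 : nat)%:Z); rewrite NegzE abszN.
by have := odd_double_half n.+1; rewrite /absz; lia.
Qed.

Lemma odd_abszD (a b : int) : odd (absz (a + b)) = odd (absz a) (+) odd (absz b).
Proof.
have [p hp] := absz_parity a; have [q hq] := absz_parity b; have [s hs] := absz_parity (a + b).
by move: hp hq hs; case: (odd _); case: (odd _); case: (odd _) => /=; lia.
Qed.

Section Geometry.
Variable d : nat.
Implicit Types (u v w x z s : site d) (y : site d -> nat -> bool).

(** Boxes are balls of the sup-norm; unlike balls of the 1-norm they have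
    simple volumes. *)
Definition inbox (r : nat) u v : bool := [forall i, (absz (u ord0 i - v ord0 i) <= r)%N].

Lemma inboxP r u v : reflect (forall i, (absz (u ord0 i - v ord0 i) <= r)%N) (inbox r u v).
Proof. exact: forallP. Qed.

Lemma inbox_refl r u : inbox r u u.
Proof. by apply/inboxP => i; rewrite subrr. Qed.

Lemma inbox_sym r u v : inbox r u v -> inbox r v u.
Proof. by move=> /inboxP h; apply/inboxP => i; rewrite -opprB abszN. Qed.

Lemma inbox_trans a b u v w : inbox a u v -> inbox b v w -> inbox (a + b) u w.
Proof. by move=> /inboxP h /inboxP h'; apply/inboxP => i; have := h i; have := h' i; lia. Qed.

Lemma inbox_le a b u v : (a <= b)%N -> inbox a u v -> inbox b u v.
Proof. by move=> ab /inboxP h; apply/inboxP => i; exact: leq_trans ab. Qed.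

Lemma inbox_trans_le c a b u v w : inbox a u v -> inbox b v w -> (a + b <= c)%N -> inbox c u w.
Proof. by move=> h1 h2 h; exact: inbox_le h (inbox_trans h1 h2). Qed.

Lemma inboxD r u v x : inbox r (u + x) (v + x) = inbox r u v.
Proof. by apply: eq_forallb => i; rewrite !mxE opprD addrACA subrr addr0. Qed.

Lemma inbox_norm1 u v : inbox (norm1 (u - v)) u v.
Proof.
apply/inboxP => i; have -> : u ord0 i - v ord0 i = (u - v) ord0 i by rewrite !mxE.
by rewrite /norm1 (bigD1 i) //= leq_addr.
Qed.

Lemma path_inbox a s p : path (inbox a) s p -> inbox (a * size p) s (last s p).
Proof.
elim: p s => [|t p IH] s /=; first by rewrite inbox_refl.
by move=> /andP[h1 /IH h2]; apply: inbox_trans_le h1 h2 _; rewrite mulnS.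
Qed.

(** The scales. The factor 32 leaves room for the multiples of the previous
    scale that add up when a box is joined with clusters and collars. *)
Definition rad (k : nat) : nat := 32 ^ k.

Lemma radS k : rad k.+1 = (32 * rad k)%N.
Proof. by rewrite /rad expnS. Qed.

Lemma rad_gt0 k : (0 < rad k)%N.
Proof. by rewrite expn_gt0. Qed.

Lemma rad_ge k : (0 < k)%N -> (32 <= rad k)%N.
Proof. by case: k => // k _; rewrite radS; have := rad_gt0 k; lia. Qed.

(** A cluster of fewer than [k] seeds has diameter at most [12 * k], which is
    thus negligible at scale [k]. *)
Lemma rad_lin k : (0 < k)%N -> (12 * k + 10 <= rad k)%N.
Proof.
case: k => // k _; elim: k => [//|k IH].
by rewrite radS; lia.
Qed.

Lemma rad_le j k : (j <= k)%N -> (rad j <= rad k)%N.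
Proof. by move=> ?; rewrite leq_exp2l. Qed.

Lemma rad_lt j k : (j < k)%N -> (32 * rad j <= rad k)%N.
Proof. by move=> /rad_le; rewrite radS. Qed.

(** The jumps are at most 12 because two boxes of radius 6 around seeds meet
    only within that distance. *)
Definition long_seed_chain y k x s p := [/\ uniq (s :: p), path (inbox 12) s p,
  all (fun t => y t 0%N) (s :: p), (size p).+1 = k & inbox (3 * rad k) x s].

(** The boxes of radius [2 * rad k] around two valid centres of level [k]
    remain disjoint even when clusters of diameter [rad k] are attached to one
    of them. The last clause bounds the clusters of seeds near the centre. *)
Definition valid y k x := [/\ y x k, (forall x', inbox (5 * rad k) x x' -> y x' k -> x' = x) &
  forall s p, ~ long_seed_chain y k x s p].

(** Objects of level [0] are seeds, objects of level [k > 0] are valid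
    centres. *)
Definition present y k x := if k == 0%N then y x 0%N : Prop else valid y k x.
(** The radius of the box that larger domains must contain or avoid. It
    exceeds the range of the domain of the object and of its collar. For
    seeds, radius 6 keeps collars away from the neighbours of the seed. *)
Definition reach k : nat := if k == 0%N then 6 else 2 * rad k.

Definition linked y k u v := exists j x,
  [/\ (j < k)%N, present y j x, inbox (reach j) x u & inbox (reach j) x v].

(** Connection through overlapping boxes of objects of level below [k]. *)
Inductive conn y k u : site d -> Prop :=
| conn0 : conn y k u u
| connS v w : conn y k u v -> linked y k v w -> conn y k u w.

Lemma linked_sym y k u v : linked y k u v -> linked y k v u.
Proof. by move=> [j [x [? ? ? ?]]]; exists j; exists x. Qed.

Lemma conn_trans y k u v w : conn y k u v -> conn y k v w -> conn y k u w.
Proof. by move=> h; elim => // v' w' _ IH hl; exact: connS hl. Qed.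

Lemma conn_sym y k u v : conn y k u v -> conn y k v u.
Proof.
elim => [|{}v w _ IH /linked_sym hl]; first exact: conn0.
by apply: conn_trans IH; apply: connS hl; exact: conn0.
Qed.

Lemma conn1_path y u v : conn y 1 u v -> u = v \/ exists s p,
  [/\ path (inbox 12) s p, all (fun t => y t 0%N) (s :: p), inbox 6 s u & inbox 6 (last s p) v].
Proof.
elim => [|{}v w _ IH [j [x [j1 hx xv xw]]]]; first by left.
have j0 : j = 0%N by case: j j1 {hx xv xw}.
rewrite j0 /present /reach /= in hx xv xw; right.
case: IH => [->|[s [p [h1 h2 h3 h4]]]].
  by exists x; exists [::]; split => //=; rewrite hx.
exists s; exists (rcons p x); split => //.
- rewrite rcons_path h1 /=; exact: inbox_trans_le h4 (inbox_sym xv) _.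
- by rewrite -rcons_cons all_rcons hx.
- by rewrite last_rcons.
Qed.

(** A longer cluster would contain a chain of seeds that invalidates [z]. *)
Lemma conn1_short y k z u v : (0 < k)%N -> valid y k z -> inbox (2 * rad k) z u ->
  conn y 1 u v -> inbox (rad k - 10) u v.
Proof.
move=> k0 [_ _ hz] zu /conn1_path[->|[s [p [h1 h2 h3 h4]]]]; first exact: inbox_refl.
have hk := rad_lin k0; have hr := rad_ge k0.
(* Loops are removed because the seeds of a forbidden chain are distinct. *)
move: h4; case: (shortenP h1) => p' p1 p2 p3 h4.
have a' : all (fun t => y t 0%N) (s :: p').
  apply/allP => t ht; apply: (allP h2); move: ht; rewrite !inE.
  by case/orP => [->//|/p3 ->]; rewrite orbT.
have [hs|hs] := leqP (size p').+1 k.-1; last first.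
  case: (hz s (take k.-1 p')); split.
  - by have := take_uniq k.-1.+1 p2.
  - exact: take_path.
  - apply/allP => t ht; apply: (allP a'); move: ht; rewrite !inE.
    by case/orP => [->//|/mem_take ->]; rewrite orbT.
  - by rewrite size_takel ?prednK.
  - by apply: inbox_trans_le zu (inbox_sym h3) _; lia.
have h5 := path_inbox p1.
have h6 := inbox_trans (inbox_sym h3) (inbox_trans h5 h4).
by apply: inbox_le h6; move: (size p') hs => n; lia.
Qed.

Definition attached y j z v := exists u, inbox (2 * rad j) z u /\ conn y j u v.

(** Induction on the level. At most one object of the highest level [J] takes
    part: to reach a second one, a cluster of lower objects would have to
    bridge the distance [5 * rad J] between valid centres, but it is shorter
    than [rad J], by induction or by the condition on seed chains. So the
    cluster consists of one box of radius [2 * rad J] and of clusters attached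
    to it. *)
Lemma conn_diam y j u v : (0 < j)%N -> conn y j u v -> conn y 1 u v \/ inbox (rad j - 10) u v.
Proof.
elim: j u v => // -[|j] IH u v _ huv; first by left.
set J := j.+1 in IH huv *; have J0 : (0 < J)%N by [].
have hr := rad_ge J0.
have bnd z u' v' : valid y J z -> inbox (2 * rad J) z u' -> conn y J u' v' -> inbox (rad J - 10) u' v'.
  by move=> hz zu' /(IH _ _ J0)[/(conn1_short J0 hz zu')|].
have bst z v' : valid y J z -> attached y J z v' -> inbox (3 * rad J) z v'.
  by move=> hz [u' [h1 h2]]; apply: inbox_trans_le h1 (bnd _ _ _ hz h1 h2) _; lia.
(* Either no object of level [J] is used, or exactly one, called [z]. *)
suff : conn y J u v \/ exists z, [/\ valid y J z, attached y J z u & attached y J z v].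
  case=> [/(IH _ _ J0)[|h]|[z [hz /(bst _ _ hz) h1 /(bst _ _ hz) h2]]]; first by left.
    by right; apply: inbox_le h; rewrite radS; lia.
  by right; apply: inbox_trans_le (inbox_sym h1) h2 _; rewrite radS; lia.
elim: huv => [|{}v w _ IHv [i [x [iJ hx xv xw]]]]; first by left; exact: conn0.
move: iJ; rewrite ltnS leq_eqVlt => /orP[/eqP iE|iJ]; last first.
  have hl : linked y J v w by exists i; exists x.
  case: IHv => [h|[z [hz h1 [u' [h2 h3]]]]]; first by left; exact: connS hl.
  by right; exists z; split => //; exists u'; split => //; exact: connS hl.
rewrite iE /present /reach /= -/J in hx xv xw.
case: IHv => [h|[z [hz h1 h2]]].
  right; exists x; split => //; first by exists v; split => //; exact: conn_sym.
  by exists w; split => //; exact: conn0.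
have xz : x = z.
  have [_ hiso _] := hz; have [hxJ _ _] := hx; apply: hiso => //.
  by apply: inbox_trans_le (bst _ _ hz h2) (inbox_sym xv) _; lia.
by right; exists z; split => //; exists w; split; [rewrite -xz|exact: conn0].
Qed.

Lemma conn_bound y k z u v : (0 < k)%N -> valid y k z -> inbox (2 * rad k) z u ->
  conn y k u v -> inbox (rad k - 10) u v.
Proof.
by move=> k0 hz zu /(conn_diam k0)[/(conn1_short k0 hz zu)|].
Qed.

(** A box of radius [rad k] enlarged by all the clusters of lower objects that
    meet it, so that no lower box crosses its boundary. *)
Definition domain y k x v := [/\ (0 < k)%N, valid y k x & exists u, inbox (rad k) x u /\ conn y k u v].

(** For collars, which have width 2, and for the comparison of collars of
    adjacent sites. *)
Definition near_domain y t k x v := exists u, inbox t v u /\ domain y k x u.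

Lemma domain_bound y k x v : domain y k x v -> inbox (2 * rad k - 10) x v.
Proof.
move=> [k0 hx [u [h1 h2]]]; have hr := rad_ge k0.
have h3 : inbox (2 * rad k) x u by apply: inbox_le h1; lia.
by apply: inbox_trans_le h1 (conn_bound k0 hx h3 h2) _; lia.
Qed.

(** The slack of 10 in the bounds on clusters is spent here: the collars also
    stay within the reach of the object. *)
Lemma near_bound y t k x v : (t <= 9)%N -> near_domain y t k x v -> inbox (2 * rad k) x v.
Proof.
move=> ht [u [h1 h2]]; have [k0 _ _] := h2; have hr := rad_ge k0.
by apply: inbox_trans_le (domain_bound h2) (inbox_sym h1) _; lia.
Qed.

Lemma near_pos y t k x v : near_domain y t k x v -> (0 < k)%N /\ valid y k x.
Proof. by move=> [u [_ []]]. Qed.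

Lemma domain_near y t k x v : domain y k x v -> near_domain y t k x v.
Proof. by move=> h; exists v; rewrite inbox_refl. Qed.

Lemma near_step y t t' k x u v : inbox t' v u -> near_domain y t k x u -> near_domain y (t' + t) k x v.
Proof. by move=> h [w [h1 h2]]; exists w; split => //; exact: inbox_trans h h1. Qed.

Lemma near_le y t t' k x v : (t <= t')%N -> near_domain y t k x v -> near_domain y t' k x v.
Proof. by move=> h [w [h1 h2]]; exists w; split => //; exact: inbox_le h1. Qed.

(** A box that meets a domain of higher level is linked to it, hence contained
    in it. *)
Lemma domain_object y j k z x u v : (j < k)%N -> present y j z -> inbox (reach j) z u -> inbox (reach j) z v ->
  domain y k x u -> domain y k x v.
Proof.
move=> jk hz zu zv [k0 hx [w [h1 h2]]]; split => //; exists w; split => //.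
by apply: connS h2 _; exists j; exists z.
Qed.

Lemma domain_lower y j k z x u v : (j < k)%N -> (0 < j)%N -> valid y j z ->
  inbox (2 * rad j) z u -> inbox (2 * rad j) z v -> domain y k x u -> domain y k x v.
Proof.
move=> jk j0 hz zu zv; apply: (domain_object (z := z) jk); rewrite /present /reach;
  by case: eqP j0 => // ->.
Qed.

Lemma domain_seed y k s x u v : y s 0%N -> inbox 6 s u -> inbox 6 s v -> domain y k x u -> domain y k x v.
Proof. by move=> hs su sv h; have [k0 _ _] := h; exact: (domain_object k0 hs su sv h). Qed.

Lemma near_same y t t' k x x' v : (t <= 9)%N -> (t' <= 9)%N ->
  near_domain y t k x v -> near_domain y t' k x' v -> x = x'.
Proof.
move=> ht ht' h h'; have h1 := near_bound ht h; have h2 := near_bound ht' h'.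
have [_ [_ hiso _]] := near_pos h'; have [k0 [hx _ _]] := near_pos h.
by apply: hiso => //; apply: inbox_trans_le h2 (inbox_sym h1) _; lia.
Qed.

(** The point and the smaller domain are within the reach of [z], and the
    larger domain comes so close that it meets the box of [z]. *)
Lemma near_nested y t t' j k z x v : (t <= 4)%N -> (t' <= 4)%N -> (j < k)%N ->
  near_domain y t j z v -> near_domain y t' k x v -> domain y k x v.
Proof.
move=> ht ht' jk h [u [vu hu]]; have [j0 hz] := near_pos h.
apply: (domain_lower jk j0 hz _ _ hu).
  have := near_step (inbox_sym vu) h => /near_bound; apply; lia.
by apply: near_bound h; lia.
Qed.

(** * The colouring *)

Definition parity x v := odd (absz (\sum_i (x - v) ord0 i)).

Lemma parity_flip x u v : norm1 (u - v) = 1%N -> parity x u = ~~ parity x v.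
Proof.
move=> h; have : odd (norm1 (u - v)) by rewrite h.
have -> : odd (norm1 (u - v)) = odd (absz (\sum_i (u - v) ord0 i)).
  by rewrite /norm1; elim/big_rec2: _ => // i a b _ h'; rewrite oddD odd_abszD -h'.
rewrite /parity; have -> : \sum_i (x - v) ord0 i = \sum_i (x - u) ord0 i + \sum_i (u - v) ord0 i.
  by rewrite -big_split /=; apply: eq_bigr => i _; rewrite !mxE addrA subrK.
by rewrite odd_abszD => ->; rewrite addbT negbK.
Qed.

Definition lowest_level y k v := (exists x, domain y k x v) /\ forall j, (j < k)%N -> forall x, ~ domain y j x v.

Definition phase y k v := `[< exists x, domain y k x v /\ parity x v >].
(** At a site whose lowest level is [k]: some domain that does not contain it
    is at distance at most [t], is of lower level, and has a checkerboard of
    the other phase. *)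
Definition collar y t k v := exists j z, [/\ (j < k)%N, near_domain y t j z v & parity z v != phase y k v].

(** Heights modulo 3. A lower domain of the opposite phase uses the
    checkerboard with heights 0 and 1; at distance 1 from it the heights are 1
    and 2, at distance 2 they are 2 and 3, and beyond they are 3 and 4, that
    is 0 and 1 with the two classes of sites exchanged. *)
Definition level_color y k v : 'I_3 :=
  if `[< collar y 1 k v >] then (if phase y k v then @Ordinal 3 2 isT else @Ordinal 3 1 isT)
  else if `[< collar y 2 k v >] then (if phase y k v then @Ordinal 3 2 isT else @Ordinal 3 0 isT)
  else (if phase y k v then @Ordinal 3 1 isT else @Ordinal 3 0 isT).

(** These sites get a colour of their own, which the bits at the site and at
    its neighbours reveal. *)
Definition lone_seed y v := y v 0%N /\ forall u, norm1 (u - v) = 1%N -> ~~ y u 0%N.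

(** The default colour is used only at the sites that no domain covers, a null
    event. *)
Definition color y v : 'I_3 :=
  if `[< lone_seed y v >] then @Ordinal 3 2 isT
  else if pselect (exists k, lowest_level y k v) is left h then level_color y (projT1 (cid h)) v
  else @Ordinal 3 0 isT.

Lemma lowest_level_uniq y j k v : lowest_level y j v -> lowest_level y k v -> j = k.
Proof.
move=> [[x hx] hj] [[z hz] hk]; have [jk|jk|//] := ltngtP j k.
  by case: (hk _ jk x).
by case: (hj _ jk z).
Qed.

Lemma colorE y k v : ~ lone_seed y v -> lowest_level y k v -> color y v = level_color y k v.
Proof.
move=> hs hk; rewrite /color asboolF //; case: pselect => [h|[]]; last by exists k.
by rewrite (lowest_level_uniq hk (projT2 (cid h))).
Qed.

Lemma phaseE y k x v : domain y k x v -> phase y k v = parity x v.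
Proof.
move=> h; apply/asboolP/idP => [[x' [h' hp]]|]; last by exists x.
have e : x = x' by apply: near_same (domain_near 0 h) (domain_near 0 h').
by rewrite e.
Qed.

(** The two sites are in the same domain and have opposite phases. A site at
    distance 1 from a lower domain has its neighbours at distance at most 2,
    so they use equal or consecutive checkerboards. *)
Lemma level_color_adj_same y k u v : norm1 (u - v) = 1%N -> lowest_level y k u -> lowest_level y k v ->
  level_color y k u != level_color y k v.
Proof.
move=> h1 [[x hx] _] [[x' hx'] _].
have uv : inbox 1 u v by rewrite -h1; exact: inbox_norm1.
have exx : x = x'.
  by apply: near_same (domain_near 0 hx) (near_step uv (domain_near 0 hx')).
rewrite -exx in hx'.
have flip z : parity z u = ~~ parity z v by exact: parity_flip.
have pE : phase y k u = ~~ phase y k v by rewrite (phaseE hx) (phaseE hx') flip.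
have c12 : collar y 1 k u -> collar y 2 k v.
  move=> [j [z [jk hz hp]]]; exists j; exists z; split => //.
    exact: near_step (inbox_sym uv) hz.
  by move: hp; rewrite pE flip; case: parity; case: phase.
have c21 : collar y 1 k v -> collar y 2 k u.
  move=> [j [z [jk hz hp]]]; exists j; exists z; split => //.
    exact: near_step uv hz.
  by move: hp; rewrite pE flip; case: parity; case: phase.
rewrite /level_color pE; case: (phase y k v) => /=;
case: (asboolP (collar y 1 k u)) => a1; case: (asboolP (collar y 1 k v)) => a2 //;
case: (asboolP (collar y 2 k u)) => a3; case: (asboolP (collar y 2 k v)) => a4 //; tauto.
Qed.

(** The site [u] is in a domain that leaves [v] out, so [v] is at distance 1
    from it. No other lower domain comes near [u] or [v], by [near_nested]:
    otherwise the larger one would contain [v]. So only the collar of the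
    domain of [u] matters. *)
Lemma level_color_adj_lt y j k u v : norm1 (u - v) = 1%N -> (j < k)%N -> lowest_level y j u -> lowest_level y k v ->
  level_color y j u != level_color y k v.
Proof.
move=> h1 jk [[x hx] hju] [[x' hx'] hkv].
have uv : inbox 1 u v by rewrite -h1; exact: inbox_norm1.
have xv : near_domain y 1 j x v by exact: near_step (inbox_sym uv) (domain_near 0 hx).
have flip z : parity z u = ~~ parity z v by exact: parity_flip.
have nou : ~ collar y 2 j u.
  move=> [i [z [ij hz _]]]; apply: (hkv _ jk x).
  have hz' : near_domain y 3 i z v by exact: near_step (inbox_sym uv) hz.
  exact: near_nested ij hz' xv.
have nou1 : ~ collar y 1 j u.
  by move=> [i [z [ij hz hp]]]; apply: nou; exists i; exists z; split => //; exact: near_le hz.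
rewrite {1}/level_color (asboolF nou) (asboolF nou1) (phaseE hx) flip.
have [hp|hp] := eqVneq (parity x v) (phase y k v); last first.
  have cv : collar y 1 k v by exists j; exists x; split.
  rewrite /level_color (asboolT cv); move: hp; case: parity; by case: phase.
have nov : ~ collar y 2 k v.
  move=> [i [z [ik hz]]]; rewrite -hp => hq.
  have [ij|ij|ij] := ltngtP i j.
  - by apply: (hkv _ jk x); exact: near_nested ij hz xv.
  - by apply: (hkv _ ik z); exact: near_nested ij xv hz.
  - have e : z = x by rewrite ij in hz; exact: near_same hz xv.
    by rewrite e eqxx in hq.
have nov1 : ~ collar y 1 k v.
  by move=> [i [z [ij hz hp']]]; apply: nov; exists i; exists z; split => //; exact: near_le hz.
by rewrite /level_color (asboolF nov) (asboolF nov1) -hp; case: parity.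
Qed.

Lemma norm1C u v : norm1 (u - v) = norm1 (v - u).
Proof. by apply: eq_bigr => i _; rewrite !mxE -opprB abszN. Qed.

(** The box of radius 6 around the seed contains its neighbours and all the
    sites at distance 2 from them. A lower domain with a collar at [v] would
    meet this box and contain [v]. So [v] uses a checkerboard with colours 0
    and 1. *)
Lemma color_lone_seed y k u v : norm1 (u - v) = 1%N -> lone_seed y u -> lowest_level y k v ->
  color y u != color y v.
Proof.
move=> h1 hs [[x' hx'] hkv].
have uv : inbox 1 u v by rewrite -h1; exact: inbox_norm1.
have hv : ~ lone_seed y v.
  by move=> [hv _]; have := hs.2 v; rewrite hv norm1C h1 => /(_ erefl).
have hmv : lowest_level y k v by split => //; exists x'.
rewrite (colorE hv hmv) {1}/color asboolT //.
have nov : ~ collar y 2 k v.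
  move=> [i [z [ik [w [vw hw]] _]]]; apply: (hkv _ ik z).
  have c1 : inbox 6 u v by exact: inbox_le uv.
  have c2 : inbox 6 u w by apply: inbox_trans_le uv vw _.
  exact: (domain_seed hs.1 c2 c1 hw).
have nov1 : ~ collar y 1 k v.
  by move=> [i [z [ij hz hp']]]; apply: nov; exists i; exists z; split => //; exact: near_le hz.
by rewrite /level_color (asboolF nov) (asboolF nov1); case: phase.
Qed.

Theorem color_proper y u v : norm1 (u - v) = 1%N ->
  (exists k x, domain y k x u) -> (exists k x, domain y k x v) -> color y u != color y v.
Proof.
have mk w : (exists k x, domain y k x w) -> exists k, lowest_level y k w.
  move=> [k hk].
  have hex : exists k, `[< exists x, domain y k x w >] by exists k; exact/asboolP.
  exists (ex_minn hex); case: ex_minnP => m /asboolP hm hmin; split => // j jm x hx.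
  by have := hmin j; rewrite leqNgt jm => /(_ _) h; have : false by apply: h; apply/asboolP; exists x.
move=> h1 /mk[j hj] /mk[k hk].
have h1' : norm1 (v - u) = 1%N by rewrite norm1C.
have [su|su] := pselect (lone_seed y u); first exact: color_lone_seed hk.
have [sv|sv] := pselect (lone_seed y v); first by rewrite eq_sym; exact: color_lone_seed hj.
rewrite (colorE su hj) (colorE sv hk).
have [jk|jk|jk] := ltngtP j k; first exact: level_color_adj_lt.
  by rewrite eq_sym; exact: level_color_adj_lt.
by rewrite -jk in hk *; exact: level_color_adj_same.
Qed.
End Geometry.

(** * Equivariance and locality of the colouring *)

Section Translation.
Variable d : nat.
Implicit Types (u v w x z s : site d) (y : site d -> nat -> bool).

Lemma translateK u y : translate (- u) (translate u y) = y.
Proof. by apply/funext => v; rewrite /translate -addrA addNr addr0. Qed.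

Lemma inboxN r u v x : inbox r (u - x) v = inbox r u (v + x).
Proof. by rewrite -[in RHS](inboxD _ _ _ (- x)) addrK. Qed.

Lemma valid_translate u y k x : valid y k x -> valid (translate u y) k (x - u).
Proof.
move=> [h1 h2 h3]; split; first by rewrite /translate subrK.
- move=> x' hx' hy; apply/eqP; rewrite eq_sym subr_eq; apply/eqP; apply/esym.
  by apply: h2 => //; rewrite -inboxN.
- move=> s p [b1 b2 b3 b4 b5]; apply: (h3 (s + u) [seq t + u | t <- p]); split.
  + by rewrite -[_ :: _]/[seq t + u | t <- s :: p] map_inj_uniq //; exact: addIr.
  + elim: p s b2 {b1 b3 b4 b5} => //= t p IH s /andP[b1 /IH ->].
    by rewrite inboxD b1.
  + rewrite -[_ :: _]/[seq t + u | t <- s :: p] all_map; exact: b3.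
  + by rewrite size_map.
  + by rewrite -inboxN.
Qed.

Lemma present_translate u y k x : present y k x -> present (translate u y) k (x - u).
Proof. by rewrite /present; case: eqP => _; [rewrite /translate subrK|exact: valid_translate]. Qed.

Lemma conn_translate u y k v w : conn y k v w -> conn (translate u y) k (v - u) (w - u).
Proof.
elim => [|v' w' _ IH [j [x [h1 h2 h3 h4]]]]; first exact: conn0.
apply: connS IH _; exists j; exists (x - u); split => //; first exact: present_translate.
  by rewrite inboxD.
by rewrite inboxD.
Qed.

Lemma domain_translate u y k x v : domain y k x v -> domain (translate u y) k (x - u) (v - u).
Proof.
move=> [h1 h2 [w [h3 h4]]]; split => //; first exact: valid_translate.
by exists (w - u); split; [rewrite inboxD|exact: conn_translate].
Qed.

Lemma near_translate u y t k x v : near_domain y t k x v -> near_domain (translate u y) t k (x - u) (v - u).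
Proof. by move=> [w [h1 h2]]; exists (w - u); split; [rewrite inboxD|exact: domain_translate]. Qed.

Lemma domain_translateE u y k x v : domain (translate u y) k x v <-> domain y k (x + u) (v + u).
Proof.
split => [/(domain_translate (- u))|/(domain_translate u)]; first by rewrite translateK !opprK.
by rewrite !addrK.
Qed.

Lemma near_translateE u y t k x v : near_domain (translate u y) t k x v <-> near_domain y t k (x + u) (v + u).
Proof.
split => [/(near_translate (- u))|/(near_translate u)]; first by rewrite translateK !opprK.
by rewrite !addrK.
Qed.

Lemma parity_translate u x v : parity (x + u) (v + u) = parity x v.
Proof. by rewrite /parity; congr (odd (absz _)); apply: eq_bigr => i _; rewrite opprD addrACA subrr addr0. Qed.

Lemma lowest_level_translate u y k v : lowest_level (translate u y) k v <-> lowest_level y k (v + u).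
Proof.
split => [[[x hx] h]|[[x hx] h]]; split.
- by exists (x + u); apply/domain_translateE.
- by move=> j jk z hz; apply: (h j jk (z - u)); apply/domain_translateE; rewrite subrK.
- by exists (x - u); apply/domain_translateE; rewrite subrK.
- by move=> j jk z /domain_translateE; exact: h.
Qed.

Lemma phase_translate u y k v : phase (translate u y) k v = phase y k (v + u).
Proof.
apply: asbool_equiv_eq; split => -[x [h1 h2]].
  by exists (x + u); rewrite parity_translate; split => //; apply/domain_translateE.
by exists (x - u); rewrite -(parity_translate u) subrK; split => //; apply/domain_translateE; rewrite subrK.
Qed.

Lemma collar_translate u y t k v : collar (translate u y) t k v <-> collar y t k (v + u).
Proof.
rewrite /collar phase_translate; split => -[j]; last first.
  move=> [z [h1 h2 h3]]; exists j; exists (z - u); split => //.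
    by apply/near_translateE; rewrite subrK.
  by rewrite -(parity_translate u) subrK.
move=> [z [h1 h2 h3]]; exists j; exists (z + u); split => //; first exact/near_translateE.
by rewrite parity_translate.
Qed.

Lemma level_color_translate u y k v : level_color (translate u y) k v = level_color y k (v + u).
Proof.
by rewrite /level_color phase_translate !(asbool_equiv_eq (collar_translate _ _ _ _ _)).
Qed.

Lemma lone_seed_translate u y v : lone_seed (translate u y) v <-> lone_seed y (v + u).
Proof.
split => -[h1 h2]; split => // w hw; last by apply: h2; rewrite opprD addrACA subrr addr0.
have := h2 (w - u); rewrite /translate subrK; apply.
by apply: etrans hw; congr (norm1 _); rewrite opprD addrA addrAC.
Qed.

Lemma color_dflt y v : ~ lone_seed y v -> ~ (exists k, lowest_level y k v) -> color y v = @Ordinal 3 0 isT.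
Proof. by move=> hs h; rewrite /color asboolF //; case: pselect. Qed.

Lemma color_of_lone_seed y v : lone_seed y v -> color y v = @Ordinal 3 2 isT.
Proof. by move=> hs; rewrite /color asboolT. Qed.

Theorem color_translate u y v : color (translate u y) v = color y (v + u).
Proof.
have [hs|hs] := pselect (lone_seed (translate u y) v).
  by rewrite !color_of_lone_seed //; apply/lone_seed_translate.
have hs' : ~ lone_seed y (v + u) by move=> /(lone_seed_translate u y v).2.
have [[k hk]|hk] := pselect (exists k, lowest_level (translate u y) k v).
  by rewrite (colorE hs hk) (colorE hs' ((lowest_level_translate _ _ _ _).1 hk)) level_color_translate.
by rewrite !color_dflt // => -[k /(lowest_level_translate u y k v).2 hk']; apply: hk; exists k.
Qed.

Definition agree k r v y y' := forall u, inbox r v u -> forall j, (j <= k)%N -> y u j = y' u j.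

Lemma agree_sym k r v y y' : agree k r v y y' -> agree k r v y' y.
Proof. by move=> h u hu j hj; rewrite h. Qed.

Lemma agree_sub k r j r' v w y y' : (j <= k)%N -> (forall u, inbox r' w u -> inbox r v u) ->
  agree k r v y y' -> agree j r' w y y'.
Proof. by move=> jk h ha u hu i ij; apply: ha; [exact: h|exact: leq_trans jk]. Qed.

Lemma path_mem_inbox a s p t : path (inbox a) s p -> t \in p -> inbox (a * size p) s t.
Proof.
elim: p s => [//|q p IH] s /= /andP[h1 h2]; rewrite inE mulnS.
case/orP => [/eqP ->|/(IH _ h2) h3]; first by apply: inbox_le h1; rewrite leq_addr.
exact: inbox_trans h3.
Qed.

(** Rivals lie within [5 * rad k], and a chain of [k] seeds that starts within
    [3 * rad k] stays within [3 * rad k + 12 * k]. *)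
Lemma valid_loc y y' k x : (0 < k)%N -> agree k (5 * rad k) x y y' -> valid y k x -> valid y' k x.
Proof.
move=> k0 ha [h1 h2 h3]; have hk := rad_lin k0; split.
- by rewrite -ha // inbox_refl.
- by move=> x' hx; rewrite -ha //; exact: h2.
- move=> s p [b1 b2 b3 b4 b5]; apply: (h3 s p); split => //.
  apply/allP => t ht; rewrite ha //; first exact: (allP b3).
  move: ht; rewrite inE => /orP[/eqP ->|/(path_mem_inbox b2) h4]; first by apply: inbox_le b5; lia.
  by apply: inbox_trans_le b5 h4 _; move: (size p) b4 => n; lia.
Qed.

Lemma present_loc y y' k x : agree k (5 * rad k) x y y' -> present y k x -> present y' k x.
Proof.
rewrite /present; case: eqP => [->|/eqP]; first by move=> h; rewrite h // inbox_refl.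
by rewrite -lt0n; exact: valid_loc.
Qed.

Lemma reach_le j k : (j < k)%N -> (reach j <= rad k)%N.
Proof.
move=> jk; have := rad_lt jk; have := rad_gt0 j; rewrite /reach; case: eqP; lia.
Qed.

(** By [conn_bound] the cluster stays within [2 * rad k] of [z]; the validity
    of the lower objects it uses is visible at distance a few multiples of
    their smaller scale. *)
Lemma conn_loc y y' k z u v : (0 < k)%N -> valid y k z -> inbox (rad k) z u ->
  agree k (9 * rad k) z y y' -> conn y k u v -> conn y' k u v.
Proof.
move=> k0 hz zu ha; elim => [|v' w' hv IH [j [x [jk hx xv xw]]]]; first exact: conn0.
apply: connS IH _; exists j; exists x; split => //.
have zv : inbox (2 * rad k) z v'.
  have zu2 : inbox (2 * rad k) z u by apply: (inbox_le _ zu); lia.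
  by apply: (inbox_trans_le zu (conn_bound k0 hz zu2 hv)); lia.
have zx := inbox_trans zv (inbox_sym xv); have ht := reach_le jk; have hr := rad_lt jk.
apply: present_loc hx; apply: agree_sub (ltnW jk) _ ha => t xt.
by apply: inbox_trans_le zx xt _; lia.
Qed.

Lemma domain_loc y y' k x v : agree k (9 * rad k) x y y' -> domain y k x v -> domain y' k x v.
Proof.
move=> ha [k0 hx [u [h1 h2]]]; split => //.
  apply: valid_loc k0 _ hx; apply: agree_sub (leqnn k) _ ha => t h; apply: inbox_le h; lia.
by exists u; split => //; exact: (conn_loc k0 hx h1 ha h2).
Qed.

Lemma near_loc y y' t k x v : (t <= 2)%N -> agree k (12 * rad k) v y y' ->
  near_domain y t k x v -> near_domain y' t k x v.
Proof.
move=> ht ha hn; have xv := near_bound (leq_trans ht (isT : (2 <= 9)%N)) hn.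
have [u [h1 h2]] := hn; exists u; split => //; apply: domain_loc h2.
apply: agree_sub (leqnn k) _ ha => s xs.
by apply: inbox_trans_le (inbox_sym xv) xs _; lia.
Qed.

Lemma near_locE K y y' t k x v : (t <= 2)%N -> (k <= K)%N -> agree K (12 * rad K) v y y' ->
  near_domain y t k x v <-> near_domain y' t k x v.
Proof.
move=> ht kK ha; have ha' : agree k (12 * rad k) v y y'.
  have hr := rad_le kK.
  by apply: (agree_sub kK _ ha) => u h; apply: inbox_le h; lia.
by split; apply: near_loc => //; exact: agree_sym.
Qed.

Lemma near0 y k x v : near_domain y 0 k x v <-> domain y k x v.
Proof.
split; last exact: domain_near.
move=> [u [/inboxP h hu]]; rewrite (_ : v = u) //; apply/rowP => i.
by apply/eqP; rewrite -subr_eq0 -absz_eq0; have := h i; rewrite leqn0.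
Qed.

Lemma domain_locE K y y' k x v : (k <= K)%N -> agree K (12 * rad K) v y y' ->
  domain y k x v <-> domain y' k x v.
Proof. by move=> kK ha; rewrite -!near0; exact: near_locE ha. Qed.

Lemma lowest_level_loc K y y' v : agree K (12 * rad K) v y y' -> lowest_level y K v -> lowest_level y' K v.
Proof.
move=> ha [[x hx] h]; split; first by exists x; apply/(domain_locE x (leqnn K) ha).
by move=> j jk z /(domain_locE z (ltnW jk) ha); exact: h.
Qed.

Lemma phase_loc K y y' v : agree K (12 * rad K) v y y' -> phase y K v = phase y' K v.
Proof.
move=> ha; apply: asbool_equiv_eq.
by split => -[x [/(domain_locE x (leqnn K) ha) hx hp]]; exists x.
Qed.

Lemma collar_loc K y y' t v : (t <= 2)%N -> agree K (12 * rad K) v y y' -> collar y t K v <-> collar y' t K v.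
Proof.
move=> ht ha; rewrite /collar (phase_loc ha).
by split => -[j [z [jk /(near_locE z ht (ltnW jk) ha) hn hp]]]; exists j; exists z.
Qed.

Lemma lone_seed_loc K y y' v : agree K (12 * rad K) v y y' -> lone_seed y v <-> lone_seed y' v.
Proof.
move=> ha; have hr := rad_gt0 K.
have hu u : norm1 (u - v) = 1%N -> y u 0%N = y' u 0%N.
  by move=> h; apply: ha => //; apply: (inbox_le _ (inbox_sym (inbox_norm1 u v))); rewrite h; lia.
have hv : y v 0%N = y' v 0%N by apply: ha; rewrite ?inbox_refl.
split => -[h1 h2].
  by split; [rewrite -hv|move=> u h; rewrite -hu //; exact: h2].
by split; [rewrite hv|move=> u h; rewrite hu //; exact: h2].
Qed.

(** The domains that matter at [v] have their centres within [2 * rad K], and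
    each of them is determined within [9 * rad K] of its centre. *)
Theorem color_loc K y y' v : agree K (12 * rad K) v y y' -> lowest_level y K v -> color y v = color y' v.
Proof.
move=> ha hK; have hK' := lowest_level_loc ha hK.
have [hs|hs] := pselect (lone_seed y v).
  by rewrite !color_of_lone_seed //; apply/(lone_seed_loc ha).
rewrite (colorE hs hK) (colorE _ hK'); last by move/(lone_seed_loc ha).
rewrite /level_color (phase_loc ha).
by rewrite !(asbool_equiv_eq (collar_loc _ ha)).
Qed.
End Translation.

(** * Fair bits from a uniform variable *)

Section FairBits.
Variable R : realType.
Notation Om := (measurableTypeR R).
Definition unif : probability Om R := uniform_prob (ltr01 : (0 : R) < 1).
Notation pr := (prob unif).

(** On the unit interval: the first [n] binary digits, read as a number. *)
Definition dyad (n : nat) (w : Om) : nat := Num.trunc ((w : R) * 2 ^+ n).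
Definition bit (w : Om) (n : nat) : bool := odd (dyad n.+1 w).

Lemma dyad_half n w : dyad n w = (dyad n.+1 w)./2.
Proof.
rewrite /dyad exprS (mulrCA _ 2); set x := (w : R) * 2 ^+ n.
have [x0|x0] := ltP x 0.
  have /truncn0Pn -> : ~~ (1 <= x) by rewrite -ltNge; lra.
  by have /truncn0Pn -> : ~~ (1 <= 2 * x) by rewrite -ltNge; lra.
apply: truncn_def; have /truncn_itv : 0 <= 2 * x by lra.
set T := Num.trunc _; rewrite -{1 2}(odd_double_half T) -addnn.
have : (odd T : nat)%:R <= 1 :> R by rewrite lern1; case: odd.
have : 0 <= (odd T : nat)%:R :> R by [].
by rewrite -[T./2.+1]addn1 -[(odd T + _).+1]addn1 !natrD => *; lra.
Qed.

Lemma dyad_succ n w a : dyad n w = a <->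
  dyad n.+1 w = a.*2 \/ dyad n.+1 w = a.*2.+1.
Proof.
rewrite dyad_half; split.
  by move=> <-; rewrite -{1 3}(odd_double_half (dyad n.+1 w)); case: odd; [right|left].
by case=> ->; rewrite /= ?uphalf_double ?doubleK.
Qed.

Lemma dyad_meas n a : measurable [set w | dyad n w = a].
Proof.
have mle b : measurable [set w | (dyad n w <= b)%N].
  rewrite (_ : mkset _ = [set` `]-oo, (b.+1%:R / 2 ^+ n : R)[ ] :> set Om); first exact: measurable_itv.
  apply/seteqP; split => w /=; rewrite /dyad in_itv /= truncn_le_nat ltr_pdivlMr ?exprn_gt0 //.
case: a => [|a].
  rewrite (_ : mkset _ = [set w | (dyad n w <= 0)%N]) //.
  by apply/seteqP; split => w /=; rewrite leqn0 => /eqP.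
rewrite (_ : mkset _ = [set w | (dyad n w <= a.+1)%N] `\` [set w | (dyad n w <= a)%N]).
  exact: measurableD.
apply/seteqP; split => w /=; first by move=> ->; rewrite ltnn.
by move=> [h1 /negP]; rewrite -ltnNge => h2; apply/eqP; rewrite eqn_leq h1.
Qed.

Lemma bit_meas : coord_meas bit.
Proof.
move=> n B _; rewrite (_ : mkset _ = \bigcup_a ([set w | dyad n.+1 w = a] `&` [set w | B (odd a)])).
  apply: bigcupT_measurable => a; apply: measurableI; first exact: dyad_meas.
  case: (pselect (B (odd a))) => h.
    by rewrite (_ : mkset _ = setT) //; apply/seteqP; split.
  by rewrite (_ : mkset _ = set0) //; apply/seteqP; split.
apply/seteqP; split => w /=; first by exists (dyad n.+1 w).
by move=> [a _ [/= <-]].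
Qed.

Lemma pr_dyad n a : (a < 2 ^ n)%N -> pr [set w | dyad n w = a] = 2^-1 ^+ n.
Proof.
move=> ha; have p2 : 0 < 2 ^+ n :> R by rewrite exprn_gt0.
have haR : a.+1%:R <= 2 ^+ n :> R by rewrite -natrX ler_nat.
rewrite /prob /unif /= /uniform_prob integral_uniform_pdf.
have -> : [set w | dyad n w = a] `&` [set` `[0, 1]] = [set` `[(a%:R / 2 ^+ n : R), (a.+1%:R / 2 ^+ n)[ ].
  apply/seteqP; split => w /=; rewrite !in_itv /= ler_pdivrMr // ltr_pdivlMr //.
    move=> [h1 /andP[h2 _]]; rewrite -truncn_eq; first exact/eqP.
    by rewrite mulr_ge0 // ltW.
  move=> /andP[h1 h2]; split.
    by apply: truncn_def; rewrite h1.
  have w0 : 0 <= w by rewrite -(pmulr_lge0 _ p2); exact: le_trans h1.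
  by rewrite w0 -(ler_pM2r p2) mul1r; lra.
rewrite (eq_integral (fun=> 1%:E)); last first.
  move=> w; rewrite inE /= in_itv /= => /andP[]; rewrite ler_pdivrMr // ltr_pdivlMr // => h1 h2.
  have w0 : 0 <= w by rewrite -(pmulr_lge0 _ p2); exact: le_trans h1.
  have w1 : w <= 1 by rewrite -(ler_pM2r p2) mul1r; lra.
  by rewrite /uniform_pdf w0 w1 subr0 invr1.
rewrite integral_cst //= mul1e lebesgue_measure_itv /= lte_fin.
rewrite ltr_pM2r ?invr_gt0 // ltr_nat ltnSn -EFinB /= -mulrBl -natr1 addrAC subrr add0r mul1r.
by rewrite exprVn.
Qed.

(** The mass of [B] for a fair bit. *)
Definition half_mass (B : set bool) : R := (`[< B true >]%:R + `[< B false >]%:R) / 2.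

(** Induction on the number of digits that are read, for all values of the
    digits that precede them: a dyadic interval splits into two halves,
    according to the next digit. *)
Lemma pr_bits_after m n a (B : nat -> set bool) : (a < 2 ^ n)%N ->
  pr [set w | dyad n w = a /\ forall i, (i < m)%N -> B i (bit w (n + i))] =
  2^-1 ^+ n * \prod_(i < m) half_mass (B i).
Proof.
elim: m n a B => [|m IH] n a B ha.
  rewrite big_ord0 mulr1 -(pr_dyad ha); congr (fine (unif _)).
  by apply/seteqP; split => w /= => [[]|].
pose S b := [set w | dyad n.+1 w = (b + a.*2)%N /\ forall i, (i < m)%N -> B i.+1 (bit w (n.+1 + i))].
have eS : [set w | dyad n w = a /\ forall i, (i < m.+1)%N -> B i (bit w (n + i))] =
   (if `[< B 0%N true >] then S 1%N else set0) `|` (if `[< B 0%N false >] then S 0%N else set0).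
  apply/seteqP; split => w /=.
    move=> [/dyad_succ hd hB].
    have hB' i : (i < m)%N -> B i.+1 (bit w (n.+1 + i)) by move=> hi; rewrite addSnnS; exact: hB.
    have := hB 0%N isT; rewrite addn0 /bit; case: hd => hd.
      by rewrite hd odd_double => h; right; rewrite asboolT.
    by rewrite hd /= odd_double => h; left; rewrite asboolT.
  case; case: asboolP => // hb [hd hB]; split.
  - by apply/dyad_succ; right; rewrite hd.
  - case=> [_|i hi]; last by rewrite -addSnnS; exact: hB.
    by rewrite addn0 /bit hd /= odd_double.
  - by apply/dyad_succ; left; rewrite hd.
  - case=> [_|i hi]; last by rewrite -addSnnS; exact: hB.
    by rewrite addn0 /bit hd /= odd_double.
have mS b : measurable (S b).
  rewrite (_ : S b = [set w | dyad n.+1 w = (b + a.*2)%N] `&`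
     [set w | forall j, j \in map (addn n.+1) (iota 0 m) -> B (j - n)%N (bit w j)]).
    apply: measurableI; first exact: dyad_meas.
    exact: (measurable_all (B := fun j => B (j - n)%N) _ bit_meas).
  apply/seteqP; split => w /= [h1 h2]; split => //.
    move=> j /mapP[i]; rewrite mem_iota => /andP[_ hi] ->.
    rewrite add0n in hi; have e : (n.+1 + i - n = i.+1)%N by clear; lia.
    by rewrite e; exact: h2 hi.
  move=> i hi; have := h2 (n.+1 + i)%N; rewrite (_ : n.+1 + i - n = i.+1)%N; last by lia.
  by apply; apply/mapP; exists i; rewrite // mem_iota.
have pS b : (b < 2)%N -> pr (S b) = 2^-1 ^+ n.+1 * \prod_(i < m) half_mass (B i.+1).
  by move=> hb; apply: (IH n.+1 _ (fun i => B i.+1)); rewrite expnS; lia.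
have mif (b : bool) k : measurable (if b then S k else set0) by case: b.
rewrite eS prU //; last first.
  apply/seteqP; split => // w []; case: asboolP => // _; case: asboolP => // _ [h1 _] [h2 _].
  by move: h1; rewrite h2; lia.
have -> : \prod_(i < m.+1) half_mass (B i) = half_mass (B 0%N) * \prod_(i < m) half_mass (B i.+1).
  by rewrite big_ord_recl.
set p := \prod_(i < m) _ in pS *; clearbody p; rewrite /half_mass.
by case: asboolP => _; case: asboolP => _; rewrite ?pS // ?pr0 ?exprS /= ?mulr1n ?mulr0n; lra.
Qed.

Lemma pr_bits m (B : nat -> set bool) :
  pr [set w | forall i, (i < m)%N -> B i (bit w i)] = \prod_(i < m) half_mass (B i).
Proof.
have := @pr_bits_after m 0 0 B isT; rewrite expr0 mul1r => <-.
set E := [set w | forall i, _]; set G := [set w | _ /\ _].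
have mE : measurable E.
  rewrite (_ : E = [set w | forall i, i \in iota 0 m -> B i (bit w i)]).
    exact: (measurable_all _ bit_meas).
  by apply/seteqP; split => w /= h i; have := h i; rewrite mem_iota.
have m0 := dyad_meas 0 0.
have GE : G = [set w | dyad 0 w = 0%N] `&` E by [].
have p1 : pr [set w | dyad 0 w = 0%N] = 1 by rewrite pr_dyad // expr0.
apply/eqP; rewrite eq_le GE; apply/andP; split.
  by have := prI_ge unif m0 mE; rewrite p1; lra.
by apply: le_pr => //; exact: measurableI.
Qed.

Lemma half_mass_setT : half_mass setT = 1.
Proof. by rewrite /half_mass !asboolT //= -natrD divff. Qed.

Lemma pr_bits_seq (s : seq nat) (B : nat -> set bool) : uniq s ->
  pr [set w | forall i, i \in s -> B i (bit w i)] = \prod_(i <- s) half_mass (B i).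
Proof.
move=> us; pose m := (\max_(i <- s) i).+1.
have hm i : i \in s -> (i < m)%N by move=> si; rewrite ltnS; exact: leq_bigmax_seq.
pose B' i := if i \in s then B i else setT.
rewrite (_ : mkset _ = [set w | forall i, (i < m)%N -> B' i (bit w i)]); last first.
  apply/seteqP; split => w /= h i hi; last by have := h i (hm i hi); rewrite /B' hi.
  by rewrite /B'; case: ifP => // /h.
rewrite pr_bits -(big_mkord xpredT (fun i => half_mass (B' i))).
rewrite (eq_bigr (fun i => if i \in s then half_mass (B i) else 1)); last first.
  by move=> i _; rewrite /B'; case: ifP => // _; exact: half_mass_setT.
rewrite -big_mkcond /= -big_filter; apply: perm_big; apply: uniq_perm => //.
  by rewrite filter_uniq // iota_uniq.
by move=> i; rewrite mem_filter mem_index_iota /=; case si: (i \in s) => //=; exact: hm.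
Qed.

Lemma bit_indep : indep unif bit.
Proof.
move=> s B us _; rewrite pr_bits_seq //; apply: eq_bigr => i _.
have := @pr_bits_seq [:: i] B isT; rewrite big_seq1 => <-.
congr (fine (unif _)); apply/seteqP; split => w /=; first by apply; rewrite inE.
by move=> h j; rewrite inE => /eqP ->.
Qed.

Lemma pr_bit_true i : pr [set w | bit w i] = 1 / 2.
Proof.
have := @pr_bits_seq [:: i] (fun=> [set b : bool | b]) isT; rewrite big_seq1 /half_mass asboolT // asboolF //.
rewrite /= mulr1n mulr0n addr0 => <-; congr (fine (unif _)); apply/seteqP; split => w /=; last by apply; rewrite inE.
by move=> h j; rewrite inE => /eqP ->.
Qed.

(** * Independent events from blocks of bits *)

Section Blocks.
Variables (J : countType) (n : J -> nat).

Definition blockbits (y : nat -> bool) (j : J) : bool := all (fun i => y (pickle (j, i))) (iota 0 (n j)).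
Definition blocks (w : Om) (j : J) : bool := blockbits (bit w) j.

(* The positions of the digits reserved for [j]. *)
Let U (j : J) : set nat := [set c | exists i : nat, c = pickle (j, i)].

Lemma blockbits_meas j : disc_meas (@cyl nat _ bool) (fun y => blockbits y j).
Proof.
rewrite /blockbits; elim: (iota 0 (n j)) => [|i s IH] /=; first exact: disc_meas_cst.
apply: (disc_meas2 andb _ IH) => B; apply: sub_gen_smallest.
by exists (pickle (j, i)); exists B.
Qed.

Lemma blocks_indep (s : seq J) (B : J -> set bool) : uniq s ->
  pr [set w | forall j, j \in s -> B j (blocks w j)] = \prod_(j <- s) pr [set w | B j (blocks w j)].
Proof.
move=> us.
apply: (indep_blocks (U := U) (E := fun j => [set y | B j (blockbits y j)]) bit_meas bit_indep us).
- move=> i j ij; apply/seteqP; split => // c [[a ->] [b /(pcan_inj pickleK)[e _]]].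
  by rewrite e eqxx in ij.
- move=> j y y' yy' /=; congr (B j _); apply: eq_all => i; apply: yy'; by exists i.
- by move=> j; exact: (blockbits_meas j (B j)).
Qed.

Lemma pr_blocks j : pr [set w | blocks w j] = (1 / 2) ^+ n j.
Proof.
pose s := [seq pickle (j, i) | i <- iota 0 (n j)].
have us : uniq s by rewrite map_inj_uniq ?iota_uniq // => a b /(pcan_inj pickleK)[].
rewrite (_ : mkset _ = [set w | forall c, c \in s -> [set b : bool | b] (bit w c)]).
  rewrite (bit_indep (B := fun=> [set b : bool | b])) // (eq_bigr (fun=> 1 / 2)).
    by rewrite big_const_seq count_predT size_map size_iota iter_mulr_1.
  by move=> i _; exact: pr_bit_true.
apply/seteqP; split => w /=.
  by move=> /allP h c /mapP[i hi ->]; exact: h.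
by move=> h; apply/allP => i hi; apply: h; apply/mapP; exists i.
Qed.

Lemma blocks_meas : coord_meas blocks.
Proof. by move=> j B _; exact: (measurable_pre bit_meas (blockbits_meas j B)). Qed.
End Blocks.
End FairBits.

(** Induction on the coordinates: fix the value of one of them and consider
    the two resulting events, which depend on fewer coordinates. This spares
    all direct measurability proofs for the geometric events. *)
Lemma fin_dep_meas (I : eqType) (s : seq I) (E : set (I -> bool)) :
  depends_on [set` s] E -> <<s @cyl I _ bool >> E.
Proof.
elim: s E => [|i s IH] E dE.
  have [[y Ey]|h] := pselect (exists y, E y).
    rewrite (_ : E = setT); first exact: (@measurableT _ (g_sigma_algebraType (@cyl I _ bool))).
    by apply/seteqP; split => // y' _; apply: dE Ey.
  rewrite (_ : E = set0); first exact: (@measurable0 _ (g_sigma_algebraType (@cyl I _ bool))).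
  by apply/seteqP; split => // y Ey; apply: h; exists y.
pose upd (b : bool) (y : I -> bool) j := if j == i then b else y j.
have cc b : <<s @cyl I _ bool >> [set y : I -> bool | y i = b].
  by apply: sub_gen_smallest; exists i; exists [set b].
have mE b : <<s @cyl I _ bool >> [set y | E (upd b y)].
  apply: IH => y y' yy' /=; apply: dE => j; rewrite /= inE /upd.
  by case: eqP => //= _; exact: yy'.
rewrite (_ : E = ([set y | y i = true] `&` [set y | E (upd true y)]) `|`
                 ([set y | y i = false] `&` [set y | E (upd false y)])).
  apply: (@measurableU _ (g_sigma_algebraType (@cyl I _ bool)));
  by apply: (@measurableI _ (g_sigma_algebraType (@cyl I _ bool))); [exact: cc|exact: mE].
have updE y : upd (y i) y = y.
  by apply/funext => j; rewrite /upd; case: eqP => // ->.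
apply/seteqP; split => y /=.
  by case yi: (y i) => Ey; [left|right]; rewrite -yi updE.
by case=> -[<-]; rewrite updE.
Qed.

(** * Counting sites and chains of seeds *)

Section Boxes.
Variable d : nat.
Implicit Types (u v x s : site d).

Definition box_point (r : nat) v (f : {ffun 'I_d -> 'I_(2 * r).+1}) : site d :=
  \row_i (v ord0 i - r%:Z + (nat_of_ord (f i))%:Z).

Definition box r v : seq (site d) := [seq box_point v f | f <- enum {: {ffun 'I_d -> 'I_(2 * r).+1}}].

Lemma size_box r v : size (box r v) = ((2 * r).+1 ^ d)%N.
Proof. by rewrite size_map -cardE card_ffun !card_ord. Qed.

Lemma mem_box r v x : (x \in box r v) = inbox r v x.
Proof.
apply/mapP/idP => [[f _ ->]|/inboxP h].
  apply/inboxP => i; rewrite mxE; have := ltn_ord (f i); move: (nat_of_ord _) => n.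
  by set a := v ord0 i; lia.
exists [ffun i => inord (absz (x ord0 i - v ord0 i + r%:Z))]; first by rewrite mem_enum.
apply/rowP => i; rewrite mxE ffunE; have := h i.
rewrite (_ : 0 = ord0 :> 'I_1) //; set a := v ord0 i; set b := x ord0 i => hab.
by rewrite inordK; lia.
Qed.

Lemma uniq_box r v : uniq (box r v).
Proof.
rewrite map_inj_uniq ?enum_uniq // => f g /rowP h; apply/ffunP => i; apply: val_inj => /=.
by have := h i; rewrite !mxE => /addrI [].
Qed.

(** Lists the chains of [n] jumps that start at [s], without [s] itself; there
    are at most [25 ^ (d * n)] of them. *)
Fixpoint chains n s : seq (seq (site d)) :=
  if n is n'.+1 then flatten [seq [seq t :: q | q <- chains n' t] | t <- box 12 s] else [:: [::]].

Lemma size_flatten_const (T T' : Type) (f : T -> seq T') c (l : seq T) :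
  (forall t, size (f t) = c) -> size (flatten [seq f t | t <- l]) = (size l * c)%N.
Proof. by move=> h; elim: l => [//|t l IH] /=; rewrite size_cat h IH mulSn. Qed.

Lemma size_chains n s : size (chains n s) = ((25 ^ d) ^ n)%N.
Proof.
elim: n s => [//|n IH] s /=.
rewrite (size_flatten_const (c := (25 ^ d) ^ n)) ?size_box ?expnS // => t.
by rewrite size_map IH.
Qed.

Lemma mem_chains s p : path (inbox 12) s p -> p \in chains (size p) s.
Proof.
elim: p s => [//|t p IH] s /= /andP[plane /IH h].
apply/flattenP; exists [seq t :: q | q <- chains (size p) t]; last by apply: map_f.
by apply/mapP; exists t => //; rewrite mem_box.
Qed.

(** The radius is [4 * rad k] because a centre that covers [v] is within
    [rad k] of it, and its forbidden chains start within [3 * rad k] of the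
    centre. *)
Definition chains_near k v : seq (seq (site d)) :=
  flatten [seq [seq t :: q | q <- chains k.-1 t] | t <- box (4 * rad k) v].

Lemma size_chains_near k v :
  size (chains_near k v) = ((2 * (4 * rad k)).+1 ^ d * (25 ^ d) ^ k.-1)%N.
Proof.
rewrite /chains_near (size_flatten_const (c := (25 ^ d) ^ k.-1)) ?size_box // => t.
by rewrite size_map size_chains.
Qed.

Lemma mem_size_chains_near k v q : (0 < k)%N -> q \in chains_near k v -> size q = k.
Proof.
move=> k0 /flattenP[l /mapP[t _ ->] /mapP[p hp ->]] /=.
suff -> : size p = k.-1 by rewrite prednK.
elim: (k.-1) t p hp => [|n IH] t p /=; first by rewrite inE => /eqP ->.
by move=> /flattenP[l' /mapP[t' _ ->] /mapP[p' /IH <- ->]].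
Qed.
End Boxes.

(** * The probability that a site is not covered *)

Section Coverage.
Context (R : realType) (dO : measure_display) (O : measurableType dO).
Variables (P : probability O R) (d : nat).
Notation pr := (prob P).
Notation I := (site d * nat)%type.
Variable Z : O -> I -> bool.
Hypothesis mZ : coord_meas Z.
Hypothesis iZ : indep P Z.
Hypothesis pZ0 : forall v, pr [set w | Z w (v, 0%N)] = (1 / 2) ^+ (13 * d + 1).
Hypothesis pZ : forall v k, (0 < k)%N ->
  pr [set w | Z w (v, k)] = (1 / 2) ^+ (4 * d + 5 * (d * k) + 1).

Definition curried (z : I -> bool) : site d -> nat -> bool := fun v k => z (v, k).

Definition isolated (z : I -> bool) k x := z (x, k) /\ forall x', inbox (5 * rad k) x x' -> z (x', k) -> x' = x.
(** The condition of validity that concerns level [k] only, so that these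
    events are independent for distinct levels; the condition on the seeds is
    treated apart, in [has_seed_chain]. *)
Definition has_isolated k v : set (I -> bool) := [set z | exists x, inbox (rad k) v x /\ isolated z k x].
Definition has_seed_chain k v : set (I -> bool) := [set z | exists q, [/\ q \in chains_near k v, uniq q & all (fun t => z (t, 0%N)) q]].

Lemma good_covered z k v : (0 < k)%N -> has_isolated k v z -> ~ has_seed_chain k v z -> exists x, domain (curried z) k x v.
Proof.
move=> k0 [x [vx [h1 h2]]] hb; exists x; split => //; last first.
  by exists v; split; [exact: inbox_sym|exact: conn0].
split => // s p [b1 b2 b3 b4 b5]; apply: hb; exists (s :: p); split => //.
apply/flattenP; exists [seq s :: q | q <- chains k.-1 s]; last first.
  by rewrite (map_f (cons s)) // -b4; exact: mem_chains.
apply/mapP; exists s => //; rewrite mem_box.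
by apply: inbox_trans_le vx b5 _; lia.
Qed.

Lemma isolated_dep k x : depends_on [set` [seq (u, k) | u <- box (5 * rad k) x]] [set z | isolated z k x].
Proof.
move=> z z' zz' [h1 h2]; split.
  by rewrite -zz' //; apply/mapP; exists x; rewrite ?mem_box ?inbox_refl.
by move=> x' hx; rewrite -zz'; [exact: h2|apply/mapP; exists x'; rewrite ?mem_box].
Qed.

Lemma isolated_meas k x : <<s @cyl I _ bool >> [set z | isolated z k x].
Proof. exact: fin_dep_meas (@isolated_dep k x). Qed.

Lemma has_isolatedE k v : has_isolated k v = \bigcup_(x in [set` box (rad k) v]) [set z | isolated z k x].
Proof.
apply/seteqP; split => z /=; first by move=> [x [h1 h2]]; exists x; rewrite //= mem_box.
by move=> [x /=]; rewrite mem_box => h1 h2; exists x.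
Qed.

Lemma has_isolated_meas k v : <<s @cyl I _ bool >> (has_isolated k v).
Proof.
rewrite has_isolatedE; apply: (@fin_bigcup_measurable _ (g_sigma_algebraType (@cyl I _ bool))) => // x _.
exact: isolated_meas.
Qed.

Lemma has_isolated_dep k v : depends_on [set i | i.2 = k] (has_isolated k v).
Proof.
move=> z z' zz' [x [h1 h2]]; exists x; split => //; apply: isolated_dep h2.
by move=> i /mapP[u _ ->]; exact: zz'.
Qed.

Lemma has_seed_chain_meas k v : <<s @cyl I _ bool >> (has_seed_chain k v).
Proof.
apply: (@fin_dep_meas _ [seq (t, 0%N) | t <- flatten (chains_near k v)]) => z z' zz' [q [h1 h2 /allP h3]].
exists q; split => //; apply/allP => t tq; rewrite -zz' ?h3 //.
by apply/mapP; exists t => //; apply/flattenP; exists q.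
Qed.

Lemma pr_sum_disjoint (J : choiceType) (s : seq J) (E : J -> set O) (c : R) : uniq s ->
  (forall j, measurable (E j)) ->
  (forall i j w, i \in s -> j \in s -> E i w -> E j w -> i = j) ->
  (forall j, j \in s -> c <= pr (E j)) ->
  c *+ size s <= pr (\bigcup_(j in [set` s]) E j).
Proof.
move=> + mE; elim: s => [|j s IH] us hd hc; first by rewrite mulr0n; exact: pr_ge0.
rewrite bigcup_seq big_cons -bigcup_seq.
move: us => /= /andP[js us].
rewrite prU //.
- rewrite mulrS lerD //; first by apply: hc; rewrite inE eqxx.
  apply: IH => // [i k w hi hk|k hk]; last by apply: hc; rewrite inE hk orbT.
  by apply: hd; rewrite inE ?hi ?hk orbT.
- exact: fin_bigcup_measurable.
- apply/seteqP; split => // w [h1 [k /= ks h2]]; move: js.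
  by rewrite (hd j k w) ?ks // inE ?eqxx ?ks ?orbT.
Qed.

Lemma leq_expr m n e : (m <= n)%N -> (m ^ e <= n ^ e)%N.
Proof. by case: e => // e h; rewrite leq_exp2r. Qed.

Lemma radE k : rad k = (2 ^ (5 * k))%N.
Proof. by rewrite expnM. Qed.

Lemma natr_half a n : (a <= 2 ^ n)%N -> a%:R * (1 / 2 : R) ^+ n <= 1.
Proof.
move=> h; rewrite expr_div_n expr1n mul1r ler_pdivrMr ?exprn_gt0 // mul1r -natrX ler_nat //.
Qed.

(** The number of rivals within [5 * rad k] has expectation at most 1/2, since
    that box has at most [(16 * 32 ^ k) ^ d = 2 ^ (4 * d + 5 * d * k)]
    sites. *)
Lemma pr_isolated k x : (0 < k)%N ->
  (1 / 2) ^+ (4 * d + 5 * (d * k) + 2) <= pr [set w | isolated (Z w) k x].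
Proof.
move=> k0; set n := (4 * d + 5 * (d * k) + 1)%N.
have mz u : measurable [set w | Z w (u, k)] by exact: (mZ (u, k) (B := [set b : bool | b])).
pose B u := if u == x then set0 else [set w | Z w (x, k)] `&` [set w | Z w (u, k)].
have mB u : measurable (B u) by rewrite /B; case: ifP => // _; exact: measurableI.
have pB u : pr (B u) <= (1 / 2) ^+ n * (1 / 2) ^+ n.
  rewrite /B; case: eqP => [_|/eqP ux].
    by rewrite pr0 mulr_ge0 // exprn_ge0 // divr_ge0.
  rewrite (_ : _ `&` _ = [set w | forall i, i \in [:: (x, k); (u, k)] -> [set b : bool | b] (Z w i)]).
    rewrite (iZ (B := fun=> [set b : bool | b])) //; last first.
      by rewrite /= inE andbT xpair_eqE negb_and eq_sym ux.
    by rewrite big_cons big_seq1 /= !pZ.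
  apply/seteqP; split => w /=.
    by move=> [h1 h2] i; rewrite !inE => /orP[/eqP ->|/eqP ->].
  by move=> h; split; apply: h; rewrite !inE eqxx ?orbT.
pose U := \bigcup_(u in [set` box (5 * rad k) x]) B u.
have mU : measurable U by exact: fin_bigcup_measurable.
have -> : [set w | isolated (Z w) k x] = [set w | Z w (x, k)] `\` U.
  apply/seteqP; split => w /=.
    move=> [h1 h2]; split => // -[u /=]; rewrite mem_box /B => hu.
    by case: eqP => // ne [_ hz]; apply: ne; exact: h2.
  move=> [h1 h2]; split => // u hu hz; apply/eqP/negP => /negP ne; apply: h2.
  by exists u; rewrite /= ?mem_box // /B (negbTE ne).
rewrite prD //; have := pr_bigcup_le (fun u _ => mB u) (fun u _ => pB u) (s := box (5 * rad k) x).
rewrite size_box -/U => hU.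
have hU' : pr ([set w | Z w (x, k)] `&` U) <= pr U.
  by apply: le_pr => //; exact: measurableI.
rewrite pZ // -/n (_ : 4 * d + 5 * (d * k) + 2 = n.+1)%N; last by rewrite /n; lia.
(* The expected number of rivals. *)
have hN : ((2 * (5 * rad k)).+1 ^ d)%:R * (1 / 2 : R) ^+ n <= 1 / 2.
  rewrite /n addn1 exprS mulrCA.
  have : ((2 * (5 * rad k)).+1 ^ d)%:R * (1 / 2 : R) ^+ (4 * d + 5 * (d * k)) <= 1.
    apply: natr_half; rewrite (_ : 4 * d + 5 * (d * k) = (4 + 5 * k) * d)%N; last by lia.
    rewrite [leqRHS]expnM; apply: leq_expr; rewrite expnD -radE; have := rad_gt0 k; lia.
  by lra.
have h0 : 0 <= (1 / 2 : R) ^+ n by rewrite exprn_ge0 // divr_ge0.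
have := ler_wpM2r h0 hN; rewrite -mulrA mulr_natl => hN'.
rewrite exprS; move: hU hU' hN'; set a := pr U; set b := pr _; set c := _ *+ _; set h := _ ^+ n.
lra.
Qed.

(** Distinct sites of the box of radius [rad k] are rivals of each other, so
    the events that they are isolated are disjoint, and there are at least
    [2 ^ (5 * d * k)] of them. *)
Lemma pr_has_isolated k v : (0 < k)%N ->
  (1 / 2) ^+ (4 * d + 2) <= pr [set w | has_isolated k v (Z w)].
Proof.
move=> k0.
have mI x : measurable [set w | isolated (Z w) k x] by exact: (measurable_pre mZ (isolated_meas k x)).
rewrite (_ : mkset _ = \bigcup_(x in [set` box (rad k) v]) [set w | isolated (Z w) k x]); last first.
  by apply/seteqP; split => w /=; rewrite has_isolatedE.
apply: le_trans (pr_sum_disjoint (uniq_box _ _) mI _ (fun x _ => pr_isolated x k0)); last first.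
  move=> x x' w; rewrite !mem_box => hx hx' [h1 h2] [h1' h2'].
  by apply: h2' => //; apply: inbox_trans_le (inbox_sym hx') hx _; lia.
rewrite size_box -[leRHS]mulr_natl (_ : 4 * d + 5 * (d * k) + 2 = 5 * (d * k) + (4 * d + 2))%N; last by lia.
rewrite [in leRHS]exprD mulrA; apply: ler_peMl; first by rewrite exprn_ge0 // divr_ge0.
rewrite expr_div_n expr1n mulrA mulr1 ler_pdivlMr ?exprn_gt0 // mul1r -natrX ler_nat.
rewrite (_ : 5 * (d * k) = (5 * k) * d)%N; last by lia.
by rewrite expnM -radE; apply: leq_expr; have := rad_gt0 k; lia.
Qed.

(** At most [2 ^ (10 * d * k)] chains, each of probability
    [2 ^- ((13 * d + 1) * k)]. *)
Lemma pr_has_seed_chain k v : (0 < k)%N -> pr [set w | has_seed_chain k v (Z w)] <= (1 / 2) ^+ k.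
Proof.
move=> k0.
pose B q := if uniq q then [set w | forall i, i \in [seq (t, 0%N) | t <- q] -> [set b : bool | b] (Z w i)] else set0.
have mB q : measurable (B q).
  by rewrite /B; case: ifP => // _; exact: (@measurable_all _ _ _ _ _ Z _ (fun=> [set b : bool | b]) mZ).
have e0 n : 0 <= (1 / 2 : R) ^+ n by rewrite exprn_ge0 // divr_ge0.
have pB q : q \in chains_near k v -> pr (B q) <= (1 / 2) ^+ ((13 * d + 1) * k).
  move=> hq; rewrite /B; case: ifP => uq; last by rewrite pr0.
  rewrite (iZ (B := fun=> [set b : bool | b])) ?map_inj_uniq //; last by move=> a b [].
  rewrite big_map (eq_bigr (fun=> (1 / 2) ^+ (13 * d + 1))); last by move=> t _; exact: pZ0.
  by rewrite big_const_seq count_predT (mem_size_chains_near k0 hq) iter_mulr_1 -exprM.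
rewrite (_ : mkset _ = \bigcup_(q in [set` chains_near k v]) B q); last first.
  apply/seteqP; split => w /=.
    move=> [q [h1 h2 /allP h3]]; exists q => //; rewrite /B h2 => i /mapP[t tq ->]; exact: h3.
  move=> [q hq]; rewrite /B; case: ifP => // uq h; exists q; split => //.
  by apply/allP => t tq; apply: h; apply/mapP; exists t.
apply: le_trans (pr_bigcup_le (fun q _ => mB q) pB) _.
rewrite size_chains_near -[leLHS]mulr_natl (_ : (13 * d + 1) * k = 13 * d * k + k)%N; last by lia.
rewrite exprD mulrA ler_piMl //; apply: natr_half.
have e1 : ((2 * (4 * rad k)).+1 ^ d <= 2 ^ ((4 + 5 * k) * d))%N.
  by rewrite expnM; apply: leq_expr; rewrite expnD -radE; have := rad_gt0 k; lia.
have e2 : ((25 ^ d) ^ k.-1 <= 2 ^ (5 * d * k.-1))%N.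
  by rewrite expnM; apply: leq_expr; rewrite expnM; exact: leq_expr.
apply: leq_trans (leq_mul e1 e2) _; rewrite -expnD leq_exp2l //.
by case: (k) k0 => // k' _ /=; nia.
Qed.

Lemma pr_no_isolated (h n : nat) v : (0 < h)%N ->
  pr [set w | forall k, k \in iota h n -> ~ has_isolated k v (Z w)] <=
  (1 - (1 / 2) ^+ (4 * d + 2)) ^+ n.
Proof.
move=> h0.
have mC k : <<s @cyl I _ bool >> (~` has_isolated k v).
  by apply: (@measurableC _ (g_sigma_algebraType (@cyl I _ bool))); exact: has_isolated_meas.
rewrite (indep_blocks (U := fun k => [set i | i.2 = k]) (E := fun k => ~` has_isolated k v) mZ iZ) //.
- rewrite (_ : (1 - (1 / 2 : R) ^+ (4 * d + 2)) ^+ n = \prod_(k <- iota h n) (1 - (1 / 2 : R) ^+ (4 * d + 2))).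
    rewrite big_seq [leRHS]big_seq; apply: ler_prod => k; rewrite mem_iota => /andP[hk _].
    rewrite pr_ge0 /= (_ : mkset _ = ~` [set w | has_isolated k v (Z w)]) // prC.
      by rewrite lerD2l lerN2 pr_has_isolated //; exact: leq_trans hk.
    exact: (measurable_pre mZ (has_isolated_meas k v)).
  by rewrite big_const_seq count_predT size_iota iter_mulr_1.
- exact: iota_uniq.
- by move=> i j ij; apply/seteqP; split => // u [/= e1 e2]; rewrite -e1 -e2 eqxx in ij.
- move=> k z z' zz' hz hz'; apply: hz; apply: has_isolated_dep hz' => i hi; apply/esym; exact: zz'.
Qed.

Lemma geo_sum_half h n : \sum_(k <- iota h.+1 n) (1 / 2 : R) ^+ k <= (1 / 2) ^+ h.
Proof.
suff : \sum_(k <- iota h.+1 n) (1 / 2 : R) ^+ k = (1 / 2) ^+ h - (1 / 2) ^+ (h + n).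
  by move=> ->; have : 0 <= (1 / 2 : R) ^+ (h + n) by [rewrite exprn_ge0 // divr_ge0]; lra.
elim: n h => [|n IH] h; first by rewrite big_nil addn0 subrr.
by rewrite /= big_cons IH -addSnnS exprS; lra.
Qed.

Definition uncovered K v : set (I -> bool) := [set z | forall k x, (k <= K)%N -> ~ domain (curried z) k x v].

Definition loss : R := 1 - (1 / 2) ^+ (4 * d + 2).

Lemma loss_bounds : 1 / 2 <= loss < 1.
Proof.
have h0 : 0 < (1 / 2 : R) ^+ (4 * d) by rewrite exprn_gt0 // divr_gt0.
have h1 : (1 / 2 : R) ^+ (4 * d) <= 1 by apply: exprn_ile1; lra.
by rewrite /loss addn2 !exprS; apply/andP; split; lra.
Qed.

(** A measurable event that contains [uncovered]. Only the levels between
    [h + 1] and [2 * h] are used: their number makes it unlikely that none of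
    them has an isolated centre, and their size makes all seed chains
    unlikely. *)
Definition uncovered_sup h v : set (I -> bool) :=
  (\bigcup_(k in [set` iota h.+1 h]) has_seed_chain k v) `|` [set z | forall k, k \in iota h.+1 h -> ~ has_isolated k v z].

Lemma uncovered_sub h v : uncovered (2 * h) v `<=` uncovered_sup h v.
Proof.
move=> z hz; have [hb|hb] := pselect (exists2 k, k \in iota h.+1 h & has_seed_chain k v z).
  by left; case: hb => k hk ?; exists k.
right => k hk hg; have [||x hx] := @good_covered z k v _ hg.
- by move: hk; rewrite mem_iota; lia.
- by move=> hb'; apply: hb; exists k.
by apply: hz hx; move: hk; rewrite mem_iota; lia.
Qed.

Lemma uncovered_sup_meas h v : <<s @cyl I _ bool >> (uncovered_sup h v).
Proof.
apply: (@measurableU _ (g_sigma_algebraType (@cyl I _ bool))).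
  apply: (@fin_bigcup_measurable _ (g_sigma_algebraType (@cyl I _ bool))) => // k _.
  exact: has_seed_chain_meas.
rewrite (_ : mkset _ = \bigcap_(k in [set` iota h.+1 h]) ~` has_isolated k v) //.
apply: (@fin_bigcap_measurable _ (g_sigma_algebraType (@cyl I _ bool))) => // k _.
apply: (@measurableC _ (g_sigma_algebraType (@cyl I _ bool))); exact: has_isolated_meas.
Qed.

(** The seed chains contribute [2 ^- h] and the missing centres [loss ^ h],
    where [loss >= 1 / 2]. *)
Lemma pr_uncovered h v : pr [set w | uncovered_sup h v (Z w)] <= 2 * loss ^+ h.
Proof.
have mb k : measurable [set w | has_seed_chain k v (Z w)] by exact: (measurable_pre mZ (has_seed_chain_meas k v)).
have mg : measurable [set w | forall k, k \in iota h.+1 h -> ~ has_isolated k v (Z w)].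
  rewrite (_ : mkset _ = \bigcap_(k in [set` iota h.+1 h]) ~` [set w | has_isolated k v (Z w)]) //.
  apply: fin_bigcap_measurable => // k _; apply: measurableC.
  exact: (measurable_pre mZ (has_isolated_meas k v)).
rewrite (_ : mkset _ = (\bigcup_(k in [set` iota h.+1 h]) [set w | has_seed_chain k v (Z w)]) `|`
   [set w | forall k, k \in iota h.+1 h -> ~ has_isolated k v (Z w)]) //.
apply: le_trans (prU_le _ _ mg) _; first exact: fin_bigcup_measurable.
have h1 : pr (\bigcup_(k in [set` iota h.+1 h]) [set w | has_seed_chain k v (Z w)]) <=
    \sum_(k <- iota h.+1 h) (1 / 2) ^+ k.
  apply: pr_bigcup_sum => // k; rewrite mem_iota => /andP[hk _]; apply: pr_has_seed_chain.
  exact: leq_trans hk.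
have h2 := pr_no_isolated h v (ltn0Sn h).
have h3 := geo_sum_half h h.
have h4 : (1 / 2 : R) ^+ h <= loss ^+ h.
  have h5 : (1 / 2 : R) <= loss by have := loss_bounds; lra.
  by apply: lerXn2r; rewrite ?nnegrE //; lra.
rewrite /loss in h4 *; lra.
Qed.
End Coverage.

(** * From geometric scales to a power law *)

Section Numeric.
Import numFieldNormedType.Exports.
Variable R : realType.

Lemma expr_small (x e : R) : 0 <= x -> x < 1 -> 0 < e -> exists m, forall n, (m <= n)%N -> x ^+ n < e.
Proof.
move=> x0 x1 e0; have hx : `|x| < 1 by rewrite ger0_norm.
have /cvgrPdist_lt/(_ _ e0)[m _ hm] := cvg_expr hx.
exists m => n hn; have := hm n hn; rewrite /= sub0r normrN ger0_norm //.
by rewrite exprn_ge0.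
Qed.

(** The bound [2 * x ^ h] is available from radius [D * b ^ h] on. Between two
    consecutive radii [r] grows by the factor [b] only, so a large power of
    [2 * x ^ h] beats [r]. This fails for the finitely many [h] with
    [2 * x ^ h >= 1 / 2]; there the radius is bounded and a power of [q] beats
    it. *)
Lemma power_law_exponent (q x : R) (D b : nat) : (1 < b)%N -> 0 <= q -> q < 1 -> 0 <= x -> x < 1 -> (0 < D)%N ->
  exists2 n, (0 < n)%N & forall r : R, 1 <= r -> q ^+ n * r < 1 \/
    exists h, (D * b ^ h)%:R <= r /\ (2 * x ^+ h) ^+ n * r < 1.
Proof.
move=> b1 q0 q1 x0 x1 D0.
have b0 : (0 < b)%N by exact: ltnW.
have q4 : 0 < 1 / 4 :> R by lra.
(* From [h0] on, [x ^ h < 1 / 4], so that [(2 * x ^ h) ^ 2 <= x ^ h]. *)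
have [h0' hh0] := expr_small x0 x1 q4.
pose h0 := h0'.+1.
have pD : 0 < (2 * b ^ 2 * D)%:R :> R by rewrite ltr0n !muln_gt0 ?expn_gt0 b0 D0.
have pE : 0 < (D * b ^ h0)%:R :> R by rewrite ltr0n muln_gt0 D0 expn_gt0 b0.
have iD : 0 < (2 * b ^ 2 * D)%:R^-1 :> R by rewrite invr_gt0.
have iE : 0 < (D * b ^ h0)%:R^-1 :> R by rewrite invr_gt0.
have [m1 hm1] := expr_small x0 x1 iD.
have [m2 hm2] := expr_small q0 q1 iE.
pose m := (maxn m1 m2).+1.
exists (2 * m)%N => // r r1.
(* The scale of [r] is the least [h] with [r < D * b ^ (h + 1)]. *)
have rex : exists h, `[< r < (D * b ^ h.+1)%:R >].
  exists (Num.trunc r); apply/asboolP; apply: lt_le_trans (truncnS_gt r) _.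
  rewrite ler_nat; apply: leq_trans (ltn_expl _ b1) _.
  apply: leq_trans (leq_pexp2l _ (leqnSn _)) _ => //.
  by rewrite leq_pmull.
case: (ex_minnP rex) => h /asboolP hr hmin.
have [hh|hh] := ltnP h h0.
  left; apply: (@le_lt_trans _ _ (q ^+ m * (D * b ^ h0)%:R)).
    apply: ler_pM => //; first by rewrite exprn_ge0.
    - by lra.
    - by apply: ler_wiXn2l; [|exact: ltW|rewrite leq_pmull].
    apply: le_trans (ltW hr) _; rewrite ler_nat leq_mul2l leq_exp2l // hh.
    by rewrite orbT.
  rewrite -ltr_pdivlMr // div1r; apply: hm2; rewrite /m; exact: leqW (leq_maxr _ _).
right; exists h; split.
  rewrite leNgt; apply/negP => hlt; have h1 : (0 < h)%N by exact: leq_trans hh.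
  have := hmin h.-1; rewrite prednK // => /(_ (asboolT hlt)).
  by rewrite -ltnS prednK // ltnn.
have h1 : (0 < h)%N by exact: leq_trans hh.
have xh : x ^+ h < 1 / 4 by apply: hh0; exact: ltnW.
have xh0 : 0 <= x ^+ h by rewrite exprn_ge0.
have e1 : (2 * x ^+ h) ^+ (2 * m) <= (x ^+ m) ^+ h.
  rewrite exprM -(exprM x m) mulnC (exprM x h).
  apply: lerXn2r; rewrite ?nnegrE ?exprn_ge0 ?mulr_ge0 //.
  rewrite expr2; nra.
have e2 : x ^+ m <= (2 * b ^ 2 * D)%:R^-1.
  by apply/ltW/hm1; rewrite /m; exact: leqW (leq_maxl _ _).
have e3 : (x ^+ m) ^+ h <= ((2 * b ^ 2 * D)%:R^-1) ^+ h.
  by apply: lerXn2r; rewrite ?nnegrE ?exprn_ge0 ?invr_ge0 // ltW.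
apply: (@le_lt_trans _ _ (((2 * b ^ 2 * D)%:R^-1) ^+ h * r)).
  by rewrite ler_wpM2r //; [lra|exact: le_trans e3].
rewrite exprVn -natrX mulrC ltr_pdivrMr ?mul1r ?ltr0n ?expn_gt0 ?muln_gt0 ?expn_gt0 ?D0 ?b0 //.
(* It remains that [D * b ^ (h + 1) <= (2 * b ^ 2 * D) ^ h], which holds for
   [h > 0]. *)
apply: lt_le_trans hr _; rewrite ler_nat.
rewrite (expnMn _ D) (expnMn 2) -expnM [leqRHS]mulnC; apply: leq_mul; first by rewrite -[leqLHS]expn1 leq_pexp2l.
apply: (@leq_trans (b ^ (2 * h))); last by rewrite leq_pmull ?expn_gt0.
by rewrite leq_pexp2l // mul2n -addnn -addn1 leq_add2l.
Qed.

Lemma lt_powR_root (t r : R) n : (0 < n)%N -> 0 <= t -> 0 < r -> t ^+ n * r < 1 -> t < r `^ (- n%:R^-1).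
Proof.
move=> n0 t0 r0 h; rewrite ltNge; apply/negP => hle.
have := lerXn2r n _ _ hle; rewrite ?nnegrE ?powR_ge0 // => /(_ isT t0).
rewrite -powR_mulrn ?powR_ge0 // -powRrM mulNr mulVf ?pnatr_eq0 -?lt0n // powR_inv1 ?(ltW r0) //.
by rewrite -div1r ler_pdivrMr // leNgt h.
Qed.
End Numeric.

(** * The factor *)

Definition to_mfun d1 d2 (T1 : measurableType d1) (T2 : measurableType d2) (f : T1 -> T2)
  (mf : measurable_fun setT f) : {mfun T1 >-> T2} :=
  HB.pack f (isMeasurableFun.Build _ _ T1 T2 f mf).

Lemma config_measurable_fun dT (T : measurableType dT) d dA (A : measurableType dA)
    (f : T -> site d -> A) : coord_meas f -> measurable_fun setT (f : T -> config d A).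
Proof.
move=> mf _ B mB; rewrite setTI; exact: (measurable_pre mf mB).
Qed.

Section Rows.
Context (R : realType) (dO : measure_display) (O : measurableType dO).
Variables (P : probability O R) (d : nat).
Notation I := (site d * nat)%type.
Variable Z : O -> I -> bool.
Notation pr := (prob P).
Notation A := (g_sigma_algebraType (@cyl nat _ bool)).
Hypothesis mZ : coord_meas Z.
Hypothesis iZ : indep P Z.
Hypothesis shiftZ : forall x x' k, pr [set w | Z w (x, k)] = pr [set w | Z w (x', k)].

Lemma row_coord_meas v : coord_meas (fun (z : g_sigma_algebraType (@cyl I _ bool)) (k : nat) => z (v, k)).
Proof. by move=> k B mB; apply: sub_gen_smallest; exists (v, k); exists B. Qed.

Definition row_event (B : set A) (v : site d) : set (I -> bool) :=
  [set z | B (fun k => z (v, k))].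

Lemma row_event_meas B v : measurable B -> <<s @cyl I _ bool >> (row_event B v).
Proof. by move=> mB; exact: (measurable_pre (row_coord_meas v) mB). Qed.

Lemma row_event_dep B v : depends_on [set i | i.1 = v] (row_event B v).
Proof.
move=> z z' zz'; rewrite /row_event /= (_ : (fun k => z (v, k)) = (fun k => z' (v, k))) //.
by apply/funext => k; exact: zz'.
Qed.

Lemma rows_indep (s : seq (site d)) (B : site d -> set A) : uniq s ->
  (forall v, measurable (B v)) ->
  pr [set w | forall v, v \in s -> row_event (B v) v (Z w)] =
  \prod_(v <- s) pr [set w | row_event (B v) v (Z w)].
Proof.
move=> us mB.
apply: (indep_blocks (U := fun v : site d => [set i : I | i.1 = v])
  (E := fun v => row_event (B v) v) mZ iZ us).
- by move=> i j ij; apply/seteqP; split => // u [/= e1 e2]; rewrite -e1 -e2 eqxx in ij.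
- by move=> v; exact: row_event_dep.
- by move=> v; exact: row_event_meas.
Qed.

Lemma pr_bool_event (b : O -> bool) (B : set bool) : measurable [set w | b w] ->
  pr [set w | B (b w)] = `[< B true >]%:R * pr [set w | b w] + `[< B false >]%:R * (1 - pr [set w | b w]).
Proof.
move=> mb; have eC : [set w | ~~ b w] = ~` [set w | b w] by apply/seteqP; split => w /= /negP.
case: asboolP => ht; case: asboolP => hf; rewrite /= ?mul1r ?mul0r ?addr0 ?add0r.
- rewrite (_ : mkset _ = setT) ?prT; first by lra.
  by apply/seteqP; split => // w _ /=; case: (b w).
- by congr (fine (P _)); apply/seteqP; split => w /=; case: (b w).
- by rewrite -prC // -eC; congr (fine (P _)); apply/seteqP; split => w /=; case: (b w).
- by rewrite (_ : mkset _ = set0) ?pr0 //; apply/seteqP; split => // w /=; case: (b w).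
Qed.

(** Moving one row onto another is a translation of the whole family, which
    preserves the law by [law_relabel]. *)
Lemma rows_ident (u v : site d) (B : set A) : measurable B ->
  pr [set w | row_event B u (Z w)] = pr [set w | row_event B v (Z w)].
Proof.
move=> mB.
pose f (i : I) : I := (i.1 + (u - v), i.2).
rewrite -(law_relabel (W := setT) (f := f) (E := row_event B v) mZ iZ).
- congr (fine (P _)); apply/seteqP; split => w; rewrite /row_event /f /=;
  rewrite (_ : (fun k => Z w (v + (u - v), k)) = (fun k => Z w (u, k))) //;
  by apply/funext => k; rewrite addrC subrK.
- by move=> [x k] [x' k'] _ _ [/addIr -> ->].
- move=> [x k] C _ _.
  have mzz (i : I) : measurable [set w | Z w i] by exact: (mZ i (B := [set b : bool | b])).
  by rewrite (pr_bool_event C (mzz _)) (pr_bool_event C (mzz (x, k))) (shiftZ _ x).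
- by move=> z z' zz'; apply: row_event_dep => i _; exact: zz'.
- exact: row_event_meas.
Qed.
End Rows.

Section Construction.
Variables (R : realType) (d : nat).
Notation I := (site d * nat)%type.
Notation Om := (measurableTypeR R).
Notation P := (unif R).
Notation pr := (prob P).
Notation A := (g_sigma_algebraType (@cyl nat _ bool)).

(** The number of fair bits whose conjunction is the bit of a site at a level.
    At level [k > 0] a bit has probability half the inverse of a bound for the
    volume of the box of radius [5 * rad k]; at level [0] it is small enough
    to outweigh the number of chains of seeds. *)
Definition nbits (i : I) : nat :=
  if i.2 == 0%N then (13 * d + 1)%N else (4 * d + 5 * (d * i.2) + 1)%N.

Definition raw_bits (w : Om) : I -> bool := blocks nbits w.

Lemma raw_bits_meas : coord_meas raw_bits.
Proof. exact: blocks_meas. Qed.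

Lemma raw_bits_indep : indep P raw_bits.
Proof. by move=> s B us _; exact: blocks_indep. Qed.

Lemma pr_raw_bits0 v : pr [set w | raw_bits w (v, 0%N)] = (1 / 2) ^+ (13 * d + 1).
Proof. exact: pr_blocks. Qed.

Lemma pr_raw_bits v k : (0 < k)%N -> pr [set w | raw_bits w (v, k)] = (1 / 2) ^+ (4 * d + 5 * (d * k) + 1).
Proof. by case: k => // k _; exact: pr_blocks. Qed.

Lemma pr_raw_bits_shift x x' k : pr [set w | raw_bits w (x, k)] = pr [set w | raw_bits w (x', k)].
Proof. exact: (etrans (@pr_blocks R _ nbits (x, k)) (esym (@pr_blocks R _ nbits (x', k)))). Qed.

Definition label_map (w : Om) : site d -> A := fun v k => raw_bits w (v, k).

Lemma label_map_meas : coord_meas label_map.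
Proof.
move=> v B mB.
have mz : coord_meas (fun w (k : nat) => raw_bits w (v, k)) by move=> k C mC; exact: raw_bits_meas.
exact: (measurable_pre mz mB).
Qed.

Definition labels : {RV P >-> config d A} := to_mfun (config_measurable_fun label_map_meas).

Lemma uncurry_coord_meas : coord_meas (fun (y : config d A) (i : I) => y i.1 i.2).
Proof.
move=> [v k] B mB; apply: sub_gen_smallest; exists v.
exists [set a : A | B (a k)]; split => //.
by apply: sub_gen_smallest; exists k; exists B.
Qed.

Lemma config_event_meas (K : Type) (g : (I -> bool) -> K) :
  disc_meas (@cyl I _ bool) g -> forall B, measurable [set y : config d A | B (g (fun i => y i.1 i.2))].
Proof. by move=> mg B; exact: (measurable_pre uncurry_coord_meas (mg B)). Qed.

Definition color_map (y : config d A) : config d 'I_3 := fun v => color (fun u k => y u k) v.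

Definition box_levels K v : seq I := [seq (u, j) | u <- box (12 * rad K) v, j <- iota 0 K.+1].

Lemma mem_box_levels K v u j : inbox (12 * rad K) v u -> (j <= K)%N -> (u, j) \in box_levels K v.
Proof. by move=> h hj; apply: allpairs_f; rewrite ?mem_box ?mem_iota. Qed.

Lemma agree_box_levels K v (z z' : I -> bool) : (forall i, i \in box_levels K v -> z i = z' i) ->
  agree K (12 * rad K) v (curried z) (curried z').
Proof. by move=> h u hu j hj; apply: h; exact: mem_box_levels. Qed.

Lemma lowest_level_color_meas K v (B : set 'I_3) :
  <<s @cyl I _ bool >> [set z | lowest_level (curried z) K v /\ B (color (curried z) v)].
Proof.
apply: (@fin_dep_meas _ (box_levels K v)) => z z' zz' [h1 h2].
have ha := agree_box_levels zz'; split; first exact: lowest_level_loc ha h1.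
by rewrite -(color_loc ha h1).
Qed.

Lemma lone_seed_meas v : <<s @cyl I _ bool >> [set z | lone_seed (curried z) v].
Proof.
apply: (@fin_dep_meas _ (box_levels 0 v)) => z z' zz'.
by move/(lone_seed_loc (agree_box_levels zz')).
Qed.

(** The lowest level at [v] may be arbitrarily high, so the event is a
    countable union over its value; for each value only finitely many bits
    matter. *)
Lemma color_meas v : disc_meas (@cyl I _ bool) (fun z => color (curried z) v).
Proof.
move=> B.
have msU := @measurableU _ (g_sigma_algebraType (@cyl I _ bool)).
have msI := @measurableI _ (g_sigma_algebraType (@cyl I _ bool)).
have msC := @measurableC _ (g_sigma_algebraType (@cyl I _ bool)).
have msb := @bigcupT_measurable _ (g_sigma_algebraType (@cyl I _ bool)).
have mcst (b : Prop) : <<s @cyl I _ bool >> [set z : I -> bool | b].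
  case: (pselect b) => h.
    rewrite (_ : mkset _ = setT); first exact: (@measurableT _ (g_sigma_algebraType (@cyl I _ bool))).
    by apply/seteqP; split.
  rewrite (_ : mkset _ = set0); first exact: (@measurable0 _ (g_sigma_algebraType (@cyl I _ bool))).
  by apply/seteqP; split.
rewrite (_ : _ @^-1` B = (\bigcup_K [set z | lowest_level (curried z) K v /\ B (color (curried z) v)]) `|`
   (~` (\bigcup_K [set z | lowest_level (curried z) K v /\ setT (color (curried z) v)]) `&`
     (([set z | lone_seed (curried z) v] `&` [set z | B (@Ordinal 3 2 isT)]) `|`
      (~` [set z | lone_seed (curried z) v] `&` [set z | B (@Ordinal 3 0 isT)])))).
  apply: (msU _ _); first exact: (msb _ (fun K => lowest_level_color_meas K v B)).
  apply: (msI _ _); first by apply: (msC _); exact: (msb _ (fun K => lowest_level_color_meas K v setT)).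
  exact: (msU _ _ (msI _ _ (lone_seed_meas v) (mcst _)) (msI _ _ (msC _ (lone_seed_meas v)) (mcst _))).
apply/seteqP; split => z /=.
  move=> hB; have [[K hK]|hK] := pselect (exists K, lowest_level (curried z) K v); first by left; exists K.
  right; split; first by move=> [K _ [? _]]; apply: hK; exists K.
  have [hs|hs] := pselect (lone_seed (curried z) v).
    by left; split => //; rewrite color_of_lone_seed in hB.
  by right; split => //; rewrite color_dflt in hB.
case=> [[K _ []//]|[h1 h2]].
have hK : ~ exists K, lowest_level (curried z) K v by move=> [K hK]; apply: h1; exists K.
by case: h2 => -[hs hB]; [rewrite color_of_lone_seed|rewrite color_dflt].
Qed.

Lemma color_map_meas : coord_meas (color_map : config d A -> site d -> 'I_3).
Proof. by move=> v B mB; exact: (config_event_meas (@color_meas v) B). Qed.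

Definition color_factor : {mfun config d A >-> config d 'I_3} := to_mfun (config_measurable_fun color_map_meas).

Definition colors : {RV P >-> config d 'I_3} :=
  to_mfun (measurableT_comp (@measurable_funPT _ _ _ _ color_factor) (@measurable_funPT _ _ _ _ labels)).

Lemma color_factor_equivariant : equivariant color_factor.
Proof. by move=> u y; apply/funext => v; exact: (color_translate u (fun x k => y x k) v). Qed.

Lemma labels_independent : independent labels.
Proof.
move=> s B us mB.
have mz v : measurable [set w | row_event (B v) v (raw_bits w)].
  by exact: (measurable_pre raw_bits_meas (row_event_meas v (mB v))).
have mall : measurable [set w | forall v, v \in s -> row_event (B v) v (raw_bits w)].
  rewrite (_ : mkset _ = \bigcap_(v in [set` s]) [set w | row_event (B v) v (raw_bits w)]) //.
  exact: fin_bigcap_measurable.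
apply: (etrans (prE P mall)); rewrite (rows_indep raw_bits_meas raw_bits_indep us mB) -prodEFin.
by apply: eq_bigr => v _; exact: (esym (prE P (mz v))).
Qed.

Lemma labels_identically_distributed : identically_distributed labels.
Proof.
move=> u v B mB.
have mz x : measurable [set w | row_event B x (raw_bits w)].
  by exact: (measurable_pre raw_bits_meas (row_event_meas x mB)).
apply: (etrans (prE P (mz u))); apply: (etrans _ (esym (prE P (mz v)))).
exact: congr1 (rows_ident raw_bits_meas raw_bits_indep pr_raw_bits_shift u v mB).
Qed.
End Construction.

(** * The tail of the coding radius *)

Section PowerLaw.
Variables (R : realType) (d : nat).
Hypothesis d0 : (0 < d)%N.
Notation I := (site d * nat)%type.
Notation Om := (measurableTypeR R).
Notation P := (unif R).
Notation pr := (prob P).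
Notation A := (g_sigma_algebraType (@cyl nat _ bool)).
Notation raw_bits := (@raw_bits R d).
Notation labels := (@labels R d).
Notation color_factor := (color_factor d).
Notation colors := (@colors R d).

Lemma uncovered_event_meas h v : measurable [set w | uncovered_sup h v (raw_bits w)].
Proof. exact: (measurable_pre (@raw_bits_meas R d) (uncovered_sup_meas h v)). Qed.

Lemma pr_uncovered_event h v : pr [set w | uncovered_sup h v (raw_bits w)] <= 2 * loss R d ^+ h.
Proof.
exact: (pr_uncovered (@raw_bits_meas R d) (@raw_bits_indep R d) (@pr_raw_bits0 R d) (@pr_raw_bits R d)).
Qed.

(** Each of these events has probability at most [2 * loss ^ h], so the
    intersection is null, and outside it some domain covers [v]. *)
Definition never_covered v : set Om := \bigcap_h [set w | uncovered_sup h v (raw_bits w)].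

Lemma never_covered_meas v : measurable (never_covered v).
Proof. by apply: bigcapT_measurable => h; exact: uncovered_event_meas. Qed.

Lemma never_covered_null v : P (never_covered v) = 0%E.
Proof.
have [l1 l2] := andP (loss_bounds R d).
apply: (etrans (prE P (never_covered_meas v))); congr EFin.
apply/eqP; rewrite eq_le pr_ge0 andbT leNgt; apply/negP => h0.
have l0 : 0 <= loss R d by lra.
have e0 : 0 < pr (never_covered v) / 2 by lra.
have [h /(_ h (leqnn h)) hh] := expr_small l0 l2 e0.
have : pr (never_covered v) <= pr [set w | uncovered_sup h v (raw_bits w)].
  by apply: le_pr; [exact: never_covered_meas|exact: uncovered_event_meas|move=> w; apply].
by have := pr_uncovered_event h v; lra.
Qed.

Lemma covered_lowest_level (z : I -> bool) h v : ~ uncovered_sup h v z -> exists K, (K <= 2 * h)%N /\ lowest_level (curried z) K v.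
Proof.
move=> hn; have hu : ~ uncovered (2 * h) v z by move=> hu; apply: hn; exact: uncovered_sub.
have hex : exists k, `[< exists x, domain (curried z) k x v >].
  apply: contrapT => he; apply: hu => k x _ hd; apply: he; exists k; apply/asboolP; by exists x.
exists (ex_minn hex); case: ex_minnP => m /asboolP hm hmin; split.
  apply: contrapT => /negP; rewrite -ltnNge => hlt; apply: hu => k x kh hd.
  have := hmin k; rewrite asboolT; last by exists x.
  by move=> /(_ isT) hk; move: (leq_trans hlt (leq_trans hk kh)); rewrite ltnn.
split => // j jm x hd; have := hmin j; rewrite asboolT; last by exists x.
by move=> /(_ isT); rewrite leqNgt jm.
Qed.

Lemma colors_coloring : coloring colors.
Proof.
pose N n : set Om := if @unpickle (site d) n is Some v then never_covered v else set0.
have NN : P.-negligible (\bigcup_n N n).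
  apply: negligible_bigcup => n; rewrite /N; case: unpickle => [v|]; last exact: negligible_set0.
  by apply/negligibleP; [exact: never_covered_meas|exact: never_covered_null].
apply: negligibleS NN => w; apply: contra_notP => hN u v huv.
have cov x : exists k y, domain (curried (raw_bits w)) k y x.
  apply: contrapT => hx; apply: hN; exists (pickle x) => //; rewrite /N pickleK => h _ /=.
  apply: contrapT => /covered_lowest_level[K [_ [[y hy] _]]]; apply: hx; by exists K; exists y.
by apply/eqP; exact: (color_proper huv (cov u) (cov v)).
Qed.

Lemma inbox_norm1_le r (u : site d) : inbox r 0 u -> (norm1 u <= d * r)%N.
Proof.
move=> /inboxP h; rewrite /norm1; apply: leq_trans (_ : (\sum_(i < d) r <= _)%N).
  by apply: leq_sum => i _; have := h i; rewrite mxE sub0r abszN.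
by rewrite sum_nat_const card_ord.
Qed.

Lemma determined_lowest_level (y : config d A) K : lowest_level (y : site d -> nat -> bool) K 0 ->
  determined_by color_factor (d * (12 * rad K)) y.
Proof.
move=> hK y' hy'; apply/esym.
apply: (color_loc (K := K) _ hK) => u hu j _.
by rewrite hy' //; exact: inbox_norm1_le.
Qed.

Lemma determined_lone_seed (y : config d A) : lone_seed (y : site d -> nat -> bool) 0 -> determined_by color_factor 1 y.
Proof.
move=> [h1 h2] y' hy'; rewrite /color_factor /= /color_map !color_of_lone_seed //.
split; first by rewrite hy' // /norm1 big1 // => i _; rewrite mxE.
by move=> u hu; rewrite hy' ?h2 // -[u]subr0 hu.
Qed.

Lemma colors_ffiid : ffiid_via colors labels color_factor.
Proof.
split; [by split; [exact: labels_identically_distributed|exact: labels_independent]|exact: color_factor_equivariant| |by []].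
pose N : set (config d A) := \bigcap_h [set y | uncovered_sup h 0 (fun i => y i.1 i.2)].
have mN : measurable N.
  apply: bigcapT_measurable => h.
  exact: (measurable_pre (@uncurry_coord_meas d) (uncovered_sup_meas h 0)).
have N0 : P (labels @^-1` N) = 0%E.
  rewrite (_ : labels @^-1` N = never_covered 0); first exact: never_covered_null.
  apply: eq_bigcapr => h _; apply/funext => w /=.
  by congr (uncovered_sup h 0 _); apply/funext => -[v k].
exists N; split; [exact: mN|exact: N0|].
move=> y; apply: contra_notP => hN /=.
have [h hh] : exists h, ~ uncovered_sup h 0 (fun i => y i.1 i.2 : bool).
  by apply: contrapT => /forallNP ha; apply: hN => h _; apply: contrapT; exact: ha.
have [K [_ hK]] := covered_lowest_level hh.
by exists (d * (12 * rad K))%N; exact: determined_lowest_level.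
Qed.

Lemma radius_le (r : nat) (y : config d A) : determined_by color_factor r y -> (coding_radius color_factor R y <= r%:R%:E)%E.
Proof. by move=> h; apply: ereal_inf_lbound; exists r. Qed.

(** The tail is an outer probability, so any measurable event that contains
    the event in question bounds it. *)
Lemma tail_le (r : R) (E : set Om) : measurable E ->
  (forall w, ~ E w -> (coding_radius color_factor R (labels w) <= r%:E)%E) ->
  (radius_tail labels color_factor r <= (pr E)%:E)%E.
Proof.
move=> mE hE; rewrite -prE // /radius_tail.
apply: (@le_trans _ _ (mu_ext P E)); last by rewrite measurable_mu_extE.
apply: le_mu_ext => w /= hw; apply: contrapT => /hE; by rewrite leNgt hw.
Qed.

(** Prescribing all the bits of level 0 in the box makes the probability a
    product of positive factors. *)
Definition lone_seed_event : set Om :=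
  [set w | forall i, i \in [seq (u, 0%N) | u <- box 1 (0 : site d)] ->
     [set b : bool | b = (i == (0, 0%N))] (raw_bits w i)].

Lemma lone_seed_event_meas : measurable lone_seed_event.
Proof. exact: (@measurable_all _ _ _ _ _ raw_bits _ (fun i => [set b : bool | b = (i == (0, 0%N))]) (@raw_bits_meas R d)). Qed.

Lemma lone_seed_event_pos : 0 < pr lone_seed_event.
Proof.
rewrite /lone_seed_event (@raw_bits_indep R d _ (fun i => [set b : bool | b = (i == (0, 0%N))]));
  [|by rewrite map_inj_uniq ?uniq_box // => a b []|by []].
rewrite big_map; apply: prodr_gt0 => u _.
have p0 : 0 < (1 / 2 : R) ^+ (13 * d + 1) by rewrite exprn_gt0 // divr_gt0.
have p1 : (1 / 2 : R) ^+ (13 * d + 1) < 1 by rewrite exprn_ilt1 ?addn1 //; lra.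
have mz : measurable [set w | raw_bits w (u, 0%N)] by exact: (raw_bits_meas (u, 0%N) (B := [set b : bool | b])).
have hz := pr_raw_bits0 R u.
case: ((u, 0%N) == (0, 0%N)).
  rewrite (_ : mkset _ = [set w | raw_bits w (u, 0%N)]) ?hz //.
rewrite (_ : mkset _ = ~` [set w | raw_bits w (u, 0%N)]) ?prC ?hz ?subr_gt0 //.
by apply/seteqP; split => w /=; case: (raw_bits w _).
Qed.

Lemma lone_seed_radius w : lone_seed_event w -> (coding_radius color_factor R (labels w) <= 1%:E)%E.
Proof.
move=> h; apply: (@radius_le 1); apply: determined_lone_seed.
have hz u : inbox 1 0 u -> raw_bits w (u, 0%N) = ((u, 0%N) == (0, 0%N) :> I).
  by move=> hu; apply: h; apply: map_f; rewrite mem_box.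
split; first by rewrite /labels /= /label_map hz ?inbox_refl // eqxx.
move=> u; rewrite subr0 => hu; rewrite /labels /= /label_map hz.
  rewrite xpair_eqE andbT; apply/eqP => u0; move: hu; rewrite u0 /norm1 big1 // => i _.
  by rewrite mxE.
by apply: inbox_sym; apply: (inbox_le _ (inbox_norm1 u 0)); rewrite subr0 hu.
Qed.

Lemma tail_lone_seed (r : R) : 1 <= r -> (radius_tail labels color_factor r <= (1 - pr lone_seed_event)%:E)%E.
Proof.
move=> r1; rewrite -prC; last exact: lone_seed_event_meas.
apply: tail_le; first by apply: measurableC; exact: lone_seed_event_meas.
by move=> w /contrapT /lone_seed_radius h; apply: le_trans h _; rewrite lee_fin.
Qed.

(** Domains of level at most [2 * h] reveal the colour within sup-distance
    [12 * 32 ^ (2 * h)], and the 1-norm is at most [d] times the sup-norm;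
    [1024 = 32 ^ 2]. *)
Lemma tail_level (r : R) h : (12 * d * 1024 ^ h)%:R <= r ->
  (radius_tail labels color_factor r <= (2 * loss R d ^+ h)%:E)%E.
Proof.
move=> hr; apply: le_trans (_ : ((pr [set w | uncovered_sup h 0 (raw_bits w)])%:E <= _)%E); last first.
  by rewrite lee_fin pr_uncovered_event.
apply: tail_le; first exact: uncovered_event_meas.
move=> w /covered_lowest_level[K [hK hm]].
apply: le_trans (radius_le (determined_lowest_level (y := labels w) hm)) _.
rewrite lee_fin; apply: le_trans hr; rewrite ler_nat mulnCA mulnA leq_mul2l.
apply/orP; right; rewrite -[1024%N]/(32 ^ 2)%N -expnM; exact: rad_le.
Qed.

(** The exponent is the inverse of the one given by [power_law_exponent].
    Below radius 1 the bound exceeds 1; at the first scales [tail_lone_seed]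
    keeps the tail away from 1; at the others [tail_level] applies. *)
Theorem power_law_coloring : exists alpha : R, 0 < alpha /\
  forall r : R, 0 <= r -> (radius_tail labels color_factor r < neg_power r alpha)%E.
Proof.
have [l1 l2] := andP (loss_bounds R d).
have ps := lone_seed_event_pos; have ps1 := pr_le1 P lone_seed_event_meas.
have [||||||n n0 hn] := @power_law_exponent R (1 - pr lone_seed_event) (loss R d) (12 * d) 1024 => //.
- lra.
- lra.
- lra.
- by rewrite muln_gt0.
exists n%:R^-1; split; first by rewrite invr_gt0 ltr0n.
move=> r r0; rewrite /neg_power; case: eqP => [_|/eqP rn0].
  apply: (@le_lt_trans _ _ 1%:E); last exact: ltry.
  rewrite -(prT P); apply: tail_le => // w; by case.
have rp : 0 < r by rewrite lt_neqAle eq_sym rn0.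
have [r1|r1] := ltP r 1.
  apply: (@le_lt_trans _ _ 1%:E).
    by rewrite -(prT P); apply: tail_le => // w; case.
  by rewrite lte_fin; apply: lt_powR_root; rewrite // expr1n mul1r.
have [h|[k [hk h]]] := hn r r1.
  apply: le_lt_trans (tail_lone_seed r1) _; rewrite lte_fin; apply: lt_powR_root => //; lra.
apply: le_lt_trans (tail_level hk) _; rewrite lte_fin; apply: lt_powR_root => //.
by rewrite mulr_ge0 // exprn_ge0 //; lra.
Qed.
End PowerLaw.

Theorem theorem2 (R : realType) (d : nat) (hd : (2 <= d)%N) :
  (exists alpha : R, 0 < alpha /\
     exists (dO dA : measure_display)
            (Omega : measurableType dO) (A : measurableType dA)
            (P : probability Omega R)
            (X : {RV P >-> config d 'I_3}) (Y : {RV P >-> config d A})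
            (F : {mfun config d A >-> config d 'I_3}),
       [/\ coloring X,
           ffiid_via X Y F &
           forall r : R, 0 <= r -> (radius_tail Y F r < neg_power r alpha)%E])
  /\
  (forall (dO dA : measure_display)
          (Omega : measurableType dO) (A : measurableType dA)
          (P : probability Omega R)
          (X : {RV P >-> config d 'I_3}) (Y : {RV P >-> config d A})
          (F : {mfun config d A >-> config d 'I_3}),
     coloring X -> ffiid_via X Y F ->
     radius_second_moment Y F = +oo%E).
Proof.
split; last by move=> dO dA Omega A P X Y F; exact: second_moment_infinite.
have [alpha [alpha0 htail]] := power_law_coloring R (ltnW hd).
exists alpha; split => //; do 7 eexists.
exists (color_factor d); split; [exact: colors_coloring|exact: colors_ffiid|exact: htail].
Qed.
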